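(* Let $\omega>0$, $(B,A)\in\mathbb R^2$, $B,A>0$, $l=\frac B\omega$, $\mu=\frac A{2\omega}$, $\lambda=\frac1{4\omega^2}-\mu^2$, $\rho=\rho(B,A)$. The double confluent Heun equation $$z^2E''+((-l+1)z+\mu(1-z^2))E'+(\lambda+\mu(l-1)z)E=0$$ with these values of $\lambda,\mu,l$ has a (nontrivial) polynomial solution if and only if $l,\rho\in\mathbb Z$, $\rho\equiv l\pmod{2\mathbb Z}$, $0\leq\rho\leq l$, the point $(B,A)$ lies in the boundary of a phase-lock area, and $(B,A)$ is not an adjacency. In other terms, the points $(B,A)\in\mathbb R_+^2$ for which the equation $z^2E''+((-l+1)z+\mu(1-z^2))E'+(\lambda+\mu(l-1)z)E=0$ with $l=\frac B\omega$, $\mu=\frac A{2\omega}$, $\lambda=\frac1{4\omega^2}-\mu^2$ has a (nontrivial) polynomial solution lie in boundaries of phase-lock areas and are exactly their intersection points with the lines $l=\frac B\omega\equiv\rho\pmod{2\mathbb Z}$, $0\leq\rho\leq l$, that are not adjacencies.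
   Context: Fix $\omega>0$. For $(B,A)\in\mathbb R^2$ put $l=\frac B\omega$, $\mu=\frac A{2\omega}$ and consider the vector field $$\dot\phi=-\frac{\sin\phi}{\omega}+l+2\mu\cos\tau,\qquad \dot\tau=1$$ on the two-torus $\mathbb T^2=\mathbb R^2/2\pi\mathbb Z^2$ with coordinates $(\phi,\tau)$. Its rotation number is $$\rho(B,A)=\rho(B,A;\omega)=\lim_{k\to+\infty}\frac{\phi(2\pi k)}{2\pi k},$$ where $\phi(\tau)$ is an arbitrary real-valued solution of $\frac{d\phi}{d\tau}=-\frac{\sin\phi}\omega+l+2\mu\cos\tau$ (the limit does not depend on the solution). A phase-lock area is a level set $\{(B,A)\in\mathbb R^2 \mid \rho(B,A)=r\}$ having non-empty interior; it is known that this happens exactly for integer $r$. It is known that each phase-lock area is an infinite chain of domains (going to infinity in the vertical direction, the $B$-axis being horizontal) in which each two subsequent domains are separated by one point; those separation points that do not lie in the $B$-axis $\{A=0\}$ are called adjacency points, or adjacencies. (It is known that a point $(B,A)$ with $A\neq0$ is an adjacency if and only if the time $2\pi$ flow map of the vector field, restricted to the circle $\{\tau=0\}$, is the identity.) *)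

(* Defs.v *)
From HB Require Import structures.
From mathcomp Require Import all_boot all_order all_algebra.
From mathcomp Require Import all_classical all_reals all_analysis.
From mathcomp Require Import complex.

Set Implicit Arguments.
Unset Strict Implicit.
Unset Printing Implicit Defensive.

Import Order.TTheory GRing.Theory Num.Theory.
Import numFieldNormedType.Exports.

Local Open Scope classical_set_scope.
Local Open Scope ring_scope.

Definition ell (R : realType) (omega B : R) : R := B / omega.

Definition mu (R : realType) (omega A : R) : R := A / (2 * omega).

Definition lambda (R : realType) (omega A : R) : R :=
  1 / (4 * omega ^+ 2) - mu omega A ^+ 2.

(* The angle phi is lifted to the real line. *)
Definition is_solution (R : realType) (omega B A : R) (phi : R -> R) : Prop :=
  forall tau : R, is_derive tau (1 : R) phi
    (- (sin (phi tau) / omega) + ell omega B + 2 * mu omega A * cos tau).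

(* The existence clause prevents the universal one from being vacuous. *)
Definition is_rotation_number (R : realType) (omega B A r : R) : Prop :=
  (exists phi : R -> R, is_solution omega B A phi) /\
  (forall phi : R -> R, is_solution omega B A phi ->
     (fun k : nat => phi (2 * pi * k%:R) / (2 * pi * k%:R)) @ \oo --> r).

(* [get] returns the unique element of this set; the set is a singleton because
   the limit exists and does not depend on the solution. *)
Definition rho (R : realType) (omega B A : R) : R :=
  get [set r : R | is_rotation_number omega B A r].

(* In the parameter plane a point is the pair p = (B, A). *)
Definition level_set (R : realType) (omega r : R) : set (R * R) :=
  [set p | rho omega p.1 p.2 = r].

Definition phase_lock_area (R : realType) (omega : R) (L : set (R * R)) : Prop :=
  (exists r : R, L = level_set omega r) /\ interior L !=set0.

Definition boundary (T : topologicalType) (L : set T) : set T :=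
  closure L `\` interior L.

(* A phase-lock area is a connected chain of domains, consecutive ones being
   joined at a single point: the separation points of the chain are the points
   whose removal disconnects the area. *)
Definition separation_point (T : topologicalType) (L : set T) (p : T) : Prop :=
  L p /\ ~ connected (L `\ p).

(* The separation points on the B-axis, p.2 = 0, are not adjacencies. *)
Definition adjacency (R : realType) (omega : R) (p : R * R) : Prop :=
  p.2 != 0 /\
  exists2 L : set (R * R), phase_lock_area omega L & separation_point L p.

(* The double confluent Heun operator applied to a complex polynomial E. *)
Definition heun (R : realType) (l lam m : R) (E : {poly R[i]}) : {poly R[i]} :=
  'X^2 * E^`(2)
  + (real_complex R (- l + 1) *: 'X + real_complex R m *: (1 - 'X^2)) * E^`()
  + ((real_complex R lam)%:P + real_complex R (m * (l - 1)) *: 'X) * E.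

Definition has_polynomial_solution (R : realType) (omega B A : R) : Prop :=
  exists2 E : {poly R[i]}, E != 0 &
    heun (ell omega B) (lambda omega A) (mu omega A) E = 0.

(* The union of the lines l = n with n an integer, n = r mod 2, 0 <= r <= n. *)
Definition parity_lines (R : realType) (omega : R) (r : int) : set (R * R) :=
  [set p | exists n : int,
     [/\ ell omega p.1 = n%:~R, (r = n %[mod 2])%Z & (0 <= r <= n)%R]].

(* Main.v *)
(** Put [z = exp (i tau)] and [theta = l tau + 2 mu sin tau]. In half-angle polar coordinates
    [u = a exp (i (theta - phi) / 2)], [v = a exp (i (theta + phi) / 2)] the equation for [phi]
    becomes a linear system with the antilinear symmetry
    [(u, v) |-> (exp (i theta) conj v, exp (i theta) conj u)], and [u = exp (mu z) E (- z)]
    turns polynomial solutions [E] of the Heun equation into periodic solutions of this system.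
    For integers [l] and [rho] of the same parity, a symmetric periodic solution exists iff the
    Poincare map minus [2 pi rho] has a fixed point with multiplier 1. The monodromy is then the
    identity, which happens at an adjacency, or a nontrivial shear, in which case [rho] changes
    on exactly one side of [B]: these are the boundary points that are not adjacencies.

    If [E] is a polynomial solution, the monodromy cannot be the identity: otherwise [u] would
    be a combination of two solutions whose Fourier series have a gap of length [l = deg E + 1],
    and then a determinant of modified Bessel functions, which is positive, would vanish. The
    winding number of [E] around the unit circle is nonnegative, whence [rho <= l]. Conversely,
    if the monodromy is a nontrivial shear, half of the Fourier series of the periodic solution
    is itself a solution, hence a multiple of it, so that one half of its Fourier coefficients
    vanish; the symmetry then leaves exactly those of a polynomial times [exp (mu z)]. *)
Require Import Defs.
From HB Require Import structures.
From mathcomp Require Import all_boot all_order all_algebra.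
From mathcomp Require Import all_classical all_reals all_analysis.
From mathcomp Require Import complex ring lra zify perm.

Set Implicit Arguments.
Unset Strict Implicit.
Unset Printing Implicit Defensive.

Import Order.TTheory GRing.Theory Num.Theory.
Import numFieldNormedType.Exports.

Local Open Scope classical_set_scope.
Local Open Scope ring_scope.

Local Notation Re := complex.Re.
Local Notation Im := complex.Im.

(** * Real calculus *)

Section RealCalculus.
Context {R : realType}.
Implicit Types (f g h F : R -> R) (t a b x y K C : R).

(** Neither side of the equivalence uses function theory. An adjacency is defined by disconnection,
    so the shape of an area has to be known first: for an integer [r] the condition [rho >= r]
    persists near every point strictly to the right, whence the level set lies between two
    continuous graphs over the [A]-axis, and one of its points disconnects it exactly when the row
    through that point is a single point. Laurent expansions are replaced by Fourier coefficients on
    the circle, and products with [exp (c z^s)] by a linear flow in an auxiliary factor [x] of the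
    exponent, along which a bounded family with zero initial values stays zero. The same principle,
    stated for inequalities, drives the positivity of the Bessel determinants. Half a Fourier series
    is never summed: its truncations solve the system up to O(1/N), and pairing them with two basic
    solutions determines them asymptotically. The shear makes this work, because the increment of
    one pairing over a period is a nonzero multiple of the other pairing. *)

Definition ddt f f' := forall t, is_derive t (1 : R) f (f' t).

Lemma ddt_eq f f' g g' : ddt f f' -> f =1 g -> f' =1 g' -> ddt g g'.
Proof. by move=> df /funext <- /funext <-. Qed.

Lemma ddt_eqr f f' g' : ddt f f' -> f' =1 g' -> ddt f g'.
Proof. by move=> df /funext <-. Qed.

Lemma ddt_cst a : ddt (fun=> a) (fun=> 0).
Proof. by move=> t; exact: is_derive_cst. Qed.

Lemma ddt_id : ddt (fun t => t) (fun=> 1).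
Proof. by move=> t; exact: is_derive_id. Qed.

Lemma ddtD f f' g g' : ddt f f' -> ddt g g' ->
  ddt (fun t => f t + g t) (fun t => f' t + g' t).
Proof. by move=> df dg t; apply: is_deriveD; [exact: df|exact: dg]. Qed.

Lemma ddtN f f' : ddt f f' -> ddt (fun t => - f t) (fun t => - f' t).
Proof. by move=> df t; apply: is_deriveN; exact: df. Qed.

Lemma ddtB f f' g g' : ddt f f' -> ddt g g' ->
  ddt (fun t => f t - g t) (fun t => f' t - g' t).
Proof. by move=> df dg; apply: ddtD => //; exact: ddtN. Qed.

Lemma ddtM f f' g g' : ddt f f' -> ddt g g' ->
  ddt (fun t => f t * g t) (fun t => f' t * g t + f t * g' t).
Proof.
move=> df dg t; have := is_deriveM (df t) (dg t).
by rewrite addrC [g t *: _]mulrC.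
Qed.

Lemma ddtZ a f f' : ddt f f' -> ddt (fun t => a * f t) (fun t => a * f' t).
Proof.
move=> df; apply: ddt_eqr (ddtM (ddt_cst a) df) _ => t.
by rewrite mul0r add0r.
Qed.

Lemma ddt_comp (k k' : R -> R) f f' : ddt k k' -> ddt f f' ->
  ddt (fun t => k (f t)) (fun t => f' t * k' (f t)).
Proof.
move=> dk df t; rewrite mulrC.
exact: is_derive1_comp (dk _) (df t).
Qed.

Lemma ddt_expR : ddt expR expR.
Proof. by move=> t; exact: is_derive_expR. Qed.
Lemma ddt_sin : ddt sin cos.
Proof. by move=> t; exact: is_derive_sin. Qed.
Lemma ddt_cos : ddt cos (fun t => - sin t).
Proof. by move=> t; exact: is_derive_cos. Qed.

Lemma ddt_shift f f' a : ddt f f' -> ddt (fun t => f (t + a)) (fun t => f' (t + a)).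
Proof.
move=> df; apply: ddt_eqr (ddt_comp df (ddtD ddt_id (ddt_cst a))) _ => t.
by rewrite addr0 mul1r.
Qed.

Lemma ddt_opp f f' : ddt f f' -> ddt (fun t => f (- t)) (fun t => - f' (- t)).
Proof.
by move=> df; apply: ddt_eqr (ddt_comp df (ddtN ddt_id)) _ => t; rewrite mulN1r.
Qed.

Lemma ddt_cont f f' : ddt f f' -> continuous f.
Proof.
move=> df t; apply: differentiable_continuous; apply/derivable1_diffP.
by case: (df t).
Qed.

Lemma is_derive_mvt f f' a b : a <= b ->
  (forall t, a <= t <= b -> is_derive t (1 : R) f (f' t)) ->
  exists2 c, a <= c <= b & f b - f a = f' c * (b - a).
Proof.
move=> ab df; have [||c cab ->] := @MVT_segment R f f' a b ab.
- by move=> x; rewrite in_itv/= => /andP[ax xb]; apply: df; rewrite !ltW.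
- apply: derivable_within_continuous => x; rewrite in_itv/= => xab.
  by have [] := df x xab.
by exists c => //; rewrite in_itv/= in cab.
Qed.

Lemma ddt_mvt f f' a b : ddt f f' -> a <= b ->
  exists2 c, a <= c <= b & f b - f a = f' c * (b - a).
Proof. by move=> df ab; apply: is_derive_mvt => // t _. Qed.

Lemma ddt_le f f' a b : ddt f f' -> a <= b ->
  (forall t, a <= t <= b -> 0 <= f' t) -> f a <= f b.
Proof.
move=> df ab f'0; have [c cab e] := ddt_mvt df ab.
by rewrite -subr_ge0 e mulr_ge0 ?f'0// subr_ge0.
Qed.

Lemma ddt_lt f f' a b : ddt f f' -> a < b ->
  (forall t, a <= t <= b -> 0 < f' t) -> f a < f b.
Proof.
move=> df ab f'0; have [c cab e] := ddt_mvt df (ltW ab).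
by rewrite -subr_gt0 e mulr_gt0 ?f'0// subr_gt0.
Qed.

Lemma ddt0_cst f : ddt f (fun=> 0) -> forall s t, f s = f t.
Proof.
have H s t : ddt f (fun=> 0) -> s <= t -> f s = f t.
  by move=> df st; have [c _ /eqP] := ddt_mvt df st; rewrite mul0r subr_eq0 => /eqP.
by move=> df s t; have [/(H _ _ df)|/ltW/(H _ _ df)] := leP s t.
Qed.

Lemma primitive_from f N : continuous f ->
  exists F, forall t, - N < t -> is_derive t (1 : R) F (f t).
Proof.
move=> cf; exists (fun x => (\int[lebesgue_measure]_(s in `[- N, x]) f s)%R) => t Nt.
have [||||d e] := @continuous_FTC1 R f (BLeft (- N)) t (t + 1).
- by rewrite ltrDl.
- apply: continuous_compact_integrable; first exact: segment_compact.
  exact: continuous_subspaceT.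
- by have := ltW Nt.
- exact: cf.
by split; [exact: d|rewrite -derive1E; exact: e].
Qed.

Lemma primitive_exists f : continuous f -> exists2 F, ddt F f & F 0 = 0.
Proof.
move=> cf; have /choice[G GP] := fun N : R => primitive_from N cf.
(* Primitives with different base points agree once normalized at 0, so letting the base point
   depend on [x] still defines one primitive on the whole line. *)
pose F x := G (`|x| + 1) x - G (`|x| + 1) 0.
have FE N x : `|x| < N -> F x = G N x - G N 0.
  move=> xN; rewrite /F; set M := `|x| + 1.
  have MN u : `|u| <= `|x| -> is_derive u (1 : R) (fun t => G M t - G N t) 0.
    rewrite ler_norml => /andP[ux xu].
    have /GP d1 : - M < u by rewrite /M; lra.
    have /GP d2 : - N < u by lra.
    by rewrite -(subrr (f u)); apply: is_deriveB.
  have [x0|x0] := leP 0 x.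
    have [t /andP[? ?]|c _] := @is_derive_mvt (fun t => G M t - G N t) (fun=> 0) 0 x x0.
      by apply: MN; rewrite !ger0_norm.
    by rewrite mul0r; lra.
  have [t /andP[? ?]|c _] := @is_derive_mvt (fun t => G M t - G N t) (fun=> 0) x 0 (ltW x0).
    by apply: MN; rewrite !ler0_norm// ?lerN2// ltW.
  by rewrite mul0r; lra.
exists F; last by rewrite /F subrr.
move=> t; pose N := `|t| + 1.
have d : is_derive t (1 : R) (fun x => G N x - G N 0) (f t).
  have d1 : is_derive t (1 : R) (G N) (f t).
    apply: GP; rewrite /N; have := lerNnormlW (lexx `|t|); lra.
  have := is_deriveB d1 (ddt_cst (G N 0) t).
  by rewrite subr0.
apply: (near_eq_is_derive _ d).
near=> x; rewrite -FE//; rewrite /N.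
near: x.
have : \forall x \near t, x < `|t| + 1 /\ - (`|t| + 1) < x.
  near=> x; split; near: x.
    by apply: lt_nbhsl => //; have := ler_norm t; lra.
  by apply: lt_nbhsr => //; have := lerNnormlW (lexx `|t|); lra.
by apply: filterS => x [? ?]; rewrite ltr_norml; apply/andP.
Unshelve. all: by end_near. Qed.

End RealCalculus.

(** * Comparison, nested intervals and Picard iteration *)

Section Picard.
Context {R : realType}.
Implicit Types (f g h F : R -> R) (t a b x y K C : R).

Lemma ddt_mvt_oo f f' a b : ddt f f' -> a < b ->
  exists2 c, a < c < b & f b - f a = f' c * (b - a).
Proof.
move=> df ab; have [t _||c + ->] := @MVT R f f' a b ab; first exact: df.
  exact/continuous_subspaceT/ddt_cont/df.
by rewrite in_itv/= => ?; exists c.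
Qed.

(* The argument starts at the last time before [t] where [f] is nonnegative. *)
Lemma ddt_ge0_compare f f' K : ddt f f' -> 0 <= f 0 ->
  (forall t, 0 <= t -> f t < 0 -> K * f t <= f' t) ->
  forall t, 0 <= t -> 0 <= f t.
Proof.
move=> df f0 f'f T T0; rewrite leNgt; apply/negP => fT.
have cf := ddt_cont df.
pose A := `[0, T]%classic `&` f @^-1` [set y | 0 <= y].
have cA : compact A.
  apply: compact_closedI; first exact: segment_compact.
  by move/continuous_closedP : cf; apply; exact: closed_ge.
have [||c /set_mem[/=]] := @compact_EVT_max R R id A _ cA.
- by exists 0; split => //=; rewrite in_itv/= lexx.
- by apply: continuous_subspaceT => x; exact: cvg_id.
rewrite in_itv/= => /andP[c0 cT] fc cmax.
have {}cT : c < T.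
  by rewrite lt_neqAle cT andbT; apply: contraTneq fc => ->; rewrite -ltNge.
have neg t : c < t <= T -> f t < 0.
  move=> /andP[ct tT]; rewrite ltNge; apply/negP => ft.
  have : t <= c.
    by apply: cmax; apply/mem_set; split => //=; rewrite in_itv/= tT ltW// (le_lt_trans c0).
  by rewrite leNgt ct.
have dg := ddtM df (ddt_comp ddt_expR (ddtZ (- K) ddt_id)).
have [d /andP[cd dT] /= e] := ddt_mvt_oo dg cT.
have fd : K * f d <= f' d by apply: f'f; [lra|apply: neg; rewrite cd ltW].
have : 0 <= f T * expR (- K * T) - f c * expR (- K * c).
  rewrite {}e mulr_ge0//; last by lra.
  rewrite (_ : _ + _ = (f' d - K * f d) * expR (- K * d)); last by ring.
  by rewrite mulr_ge0 ?expR_ge0// subr_ge0.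
have : 0 <= f c * expR (- K * c) by rewrite mulr_ge0 ?expR_ge0.
have : f T * expR (- K * T) < 0 by rewrite pmulr_llt0 ?expR_gt0.
lra.
Qed.

Lemma eq_of_dist_le x y : (forall e, 0 < e -> `|x - y| <= e) -> x = y.
Proof.
move=> xy; apply/eqP; rewrite -subr_eq0 -(normr_le0 (x - y)).
by apply/ler_addgt0Pr => e e0; rewrite add0r; exact: xy.
Qed.

Lemma cut_exists (I : Type) (i0 : I) (l u : I -> R) : (forall i j, l i <= u j) ->
  exists x, forall i, l i <= x <= u i.
Proof.
move=> lu; exists (sup (range l)) => i; apply/andP; split.
  apply: ub_le_sup; last by exists i.
  by exists (u i0) => _ [j _ <-].
by apply: ge_sup; [exists (l i0), i0|move=> _ [j _ <-]].
Qed.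

(** The intervals of radius [2 C / 2 ^ n] about [u n] are nested; a common point is the limit and
    comes with the rate. *)
Lemma geometric_limit (u : nat -> R) C :
  (forall n, `|u n.+1 - u n| <= C / 2 ^+ n) ->
  exists x, forall n, `|x - u n| <= 2 * C / 2 ^+ n.
Proof.
move=> uC.
have step n : C / 2 ^+ n.+1 *+ 2 = C / 2 ^+ n.
  by rewrite exprS -mulr_natr; field; rewrite expf_neq0.
have dec n k : u (n + k)%N + C / 2 ^+ (n + k) *+ 2 <= u n + C / 2 ^+ n *+ 2 /\
               u n - C / 2 ^+ n *+ 2 <= u (n + k)%N - C / 2 ^+ (n + k) *+ 2.
  elim: k => [|k [IH1 IH2]]; first by rewrite addn0.
  have := uC (n + k)%N; rewrite addnS step ler_norml => /andP[]; lra.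
have C0 n : 0 <= C / 2 ^+ n by exact: le_trans (uC n).
have [|x xP] := @cut_exists nat 0%N (fun n => u n - C / 2 ^+ n *+ 2)
   (fun n => u n + C / 2 ^+ n *+ 2).
  move=> i j; have [_ h1] := dec i j; have [h2 _] := dec j i.
  by have := C0 (i + j)%N; move: h1 h2; rewrite [(j + i)%N]addnC; lra.
exists x => n; rewrite ler_norml -mulrA mulr_natl.
by have := xP n; lra.
Qed.

(** For nonnegative times [C exp (K t) - f t] is nondecreasing and starts at [C >= 0]; negative
    times follow by reflection. Integration thus divides the exponential weight by [K], which is the
    contraction used for Picard iterates. *)
Lemma ddt_exp_bound f f' K C : ddt f f' -> f 0 = 0 -> 0 < K ->
  (forall t, `|f' t| <= C * K * expR (K * `|t|)) ->
  forall t, `|f t| <= C * expR (K * `|t|).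
Proof.
move=> + + K0.
have H g g' : ddt g g' -> g 0 = 0 ->
    (forall t, `|g' t| <= C * K * expR (K * `|t|)) ->
    forall t, 0 <= t -> g t <= C * expR (K * `|t|).
  move=> dg g0 gb t t0; rewrite (ger0_norm t0).
  have C0 : 0 <= C.
    have := le_trans (normr_ge0 _) (gb 0).
    by rewrite normr0 mulr0 expR0 mulr1 pmulr_lge0.
  have := ddt_le (ddtB (ddtZ C (ddt_comp ddt_expR (ddtZ K ddt_id))) dg) t0.
  rewrite g0 mulr0 expR0 !mulr1 subr0 => h.
  have {}h : C <= C * expR (K * t) - g t.
    apply: h => s /andP[s0 _]; have := gb s; rewrite (ger0_norm s0) ler_norml.
    by move=> /andP[_]; rewrite subr_ge0 -mulrA.
  by lra.
move=> df f0 fb t; rewrite ler_norml; have [t0|t0] := leP 0 t.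
  have h1 := H _ _ df f0 fb t t0.
  have := H _ _ (ddtN df) _ _ t t0; rewrite f0 oppr0 => /(_ erefl) h2.
  have {}h2 : - f t <= C * expR (K * `|t|) by apply: h2 => s; rewrite normrN.
  by apply/andP; split; lra.
have t0' : 0 <= - t by lra.
have := H _ _ (ddt_opp df) _ _ (- t) t0'; rewrite oppr0 f0 => /(_ erefl) h1.
have {}h1 : f t <= C * expR (K * `|t|).
  by move: h1; rewrite opprK normrN; apply => s; rewrite normrN -[`|s|]normrN.
have := H _ _ (ddtN (ddt_opp df)) _ _ (- t) t0'; rewrite oppr0 f0 oppr0 => /(_ erefl) h2.
have {}h2 : - f t <= C * expR (K * `|t|).
  by move: h2; rewrite opprK normrN; apply => s; rewrite opprK -[`|s|]normrN.
by apply/andP; split; lra.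
Qed.

(* The weight [exp (2 K |t|)] makes the Picard operator a 1/2-contraction. *)
Lemma picard (v : R -> R -> R) K G x0 : 0 < K ->
  (forall t y z, `|v t y - v t z| <= K * `|y - z|) ->
  (forall t y, `|v t y| <= G) ->
  (forall f, continuous f -> continuous (fun t => v t (f t))) ->
  exists2 f, ddt f (fun t => v t (f t)) & f 0 = x0.
Proof.
move=> K0 vlip vG vcont.
have K20 : 0 < 2 * K by lra.
(* The value at a discontinuous [f] is arbitrary; it only makes the primitive a total operator. *)
have prim f : exists F, continuous f -> ddt F f /\ F 0 = 0.
  have [cf|ncf] := pselect (continuous f); last by exists f.
  by have [F dF F0] := primitive_exists cf; exists F.
have {prim}/choice[prim primP] := prim.
pose phi := fix phi n : R -> R := if n is n'.+1 then
  (fun t => x0 + prim (fun s => v s (phi n' s)) t) else (fun=> x0).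
have cphi n : continuous (phi n).
  elim: n => [|n IH]; first by move=> t; exact: cvg_cst.
  have [dF _] := primP _ (vcont _ IH).
  exact: ddt_cont (ddtD (ddt_cst x0) dF).
have dphi n : ddt (phi n.+1) (fun t => v t (phi n t)).
  have [dF _] := primP _ (vcont _ (cphi n)).
  by apply: ddt_eqr (ddtD (ddt_cst x0) dF) _ => t; rewrite add0r.
have phi0 n : phi n 0 = x0.
  by case: n => //= n; have [_ ->] := primP _ (vcont _ (cphi n)); rewrite addr0.
pose M := G / (2 * K).
have G0 : 0 <= G by exact: le_trans (vG 0 0).
have expK1 t : 1 <= expR (2 * K * `|t|).
  by rewrite -[X in X <= _]expR0 ler_expR mulr_ge0// ltW.
have step n t : `|phi n.+1 t - phi n t| <= M * expR (2 * K * `|t|) / 2 ^+ n.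
  elim: n t => [|n IH] t; rewrite -mulrA [_ / _]mulrC mulrA.
    rewrite expr0 divr1; have d := ddtB (dphi 0%N) (ddt_cst x0).
    apply: (ddt_exp_bound d); rewrite ?phi0 ?subrr// => s.
    rewrite subr0 /M (_ : _ * (2 * K) = G); last by field; rewrite gt_eqF.
    by rewrite (le_trans (vG _ _))// ler_peMr.
  have d := ddtB (dphi n.+1) (dphi n).
  apply: (ddt_exp_bound d); rewrite ?phi0 ?subrr// => s.
  apply: le_trans (vlip _ _ _) _.
  rewrite (_ : _ * _ * _ = K * (M * expR (2 * K * `|s|) / 2 ^+ n)).
    by rewrite ler_pM2l.
  by rewrite exprS; field; rewrite expf_neq0.
have /choice[f fP] := fun t => geometric_limit (fun n => step n t).
(* All iterates are [G]-Lipschitz, a property that passes to pointwise limits and makes [f]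
   continuous. *)
have phiG n s t : `|phi n t - phi n s| <= G * `|t - s|.
  have H a b : a <= b -> `|phi n b - phi n a| <= G * `|b - a|.
    move=> ab; case: n => [|n]; first by rewrite /= subrr normr0 mulr_ge0.
    by have [c _ ->] := ddt_mvt (dphi n) ab; rewrite normrM ler_wpM2r.
  have [/H//|/ltW/H] := leP s t.
  by rewrite distrC [`|s - t|]distrC.
have half (C e : R) : 0 < e -> exists n, C / 2 ^+ n < e.
  move=> e0; have h2 : `|2^-1 : R| < 1 by rewrite ger0_norm ?invr_ge0// invf_lt1// ltr1n.
  have /cvgr0Pnorm_lt/(_ e e0)[n _ /(_ n (leqnn n))] := cvg_geometric C h2.
  rewrite /= exprVn => Cn; exists n.
  by rewrite (le_lt_trans _ Cn)// ler_norm.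
have fG s t : `|f t - f s| <= G * `|t - s|.
  apply/ler_addgt0Pr => e e0.
  have [n ne] := half (2 * (M * expR (2 * K * `|t|)) + 2 * (M * expR (2 * K * `|s|))) e e0.
  have := fP t n; have := fP s n; have := phiG n s t.
  move: ne; rewrite mulrDl -[f t - f s](_ : (f t - phi n t) + (phi n t - phi n s) + (phi n s - f s) = _); last by ring.
  move=> ne h1 h2 h3.
  apply: le_trans (ler_normD _ _) _; rewrite [`|phi n s - _|]distrC.
  by apply: le_trans (lerD (ler_normD _ _) (lexx _)) _; lra.
have cf : continuous f.
  move=> t; apply/cvgrPdist_lt => e e0.
  have G1 : 0 < G + 1 by lra.
  near=> s; apply: le_lt_trans (fG s t) _.
  have : `|t - s| < e / (G + 1).
    near: s; apply: cvgr_dist_lt; [exact: cvg_id|by rewrite divr_gt0].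
  rewrite ltr_pdivlMr// mulrC; apply: le_lt_trans.
  by rewrite ler_wpM2r// lerDl.
have [dF F0] := primP _ (vcont _ cf).
have dps := ddtD (ddt_cst x0) dF.
exists f; last first.
  apply: eq_of_dist_le => e e0.
  have [n ne] := half (2 * (M * expR (2 * K * `|0 : R|))) e e0.
  by have := fP 0 n; rewrite phi0 => h; exact: le_trans h (ltW ne).
apply: (ddt_eq dps); last by move=> t; rewrite add0r.
move=> t; apply: eq_of_dist_le => e e0.
have [n ne] := half (4 * (M * expR (2 * K * `|t|))) e e0.
have : `|(x0 + prim (fun s => v s (f s)) t) - phi n.+1 t| <=
    M / 2 ^+ n * expR (2 * K * `|t|).
  apply: (ddt_exp_bound (ddtB dps (dphi n))); rewrite ?phi0 ?F0 ?addr0 ?subrr// => s.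
  rewrite add0r; apply: le_trans (vlip _ _ _) _.
  rewrite (_ : _ * _ * _ = K * (2 * (M * expR (2 * K * `|s|)) / 2 ^+ n)); last by ring.
  by rewrite ler_pM2l//; exact: fP.
have := fP t n.+1; rewrite exprS invfM distrC => h1 h2.
rewrite (_ : _ - f t = (x0 + prim (fun s => v s (f s)) t - phi n.+1 t) + (phi n.+1 t - f t)); last by ring.
apply: le_trans (ler_normD _ _) _; apply: le_trans (lerD h2 h1) _.
apply: (le_trans _ (ltW ne)).
have : 0 <= M * expR (2 * K * `|t|) / 2 ^+ n.
  by rewrite divr_ge0 ?exprn_ge0// mulr_ge0 ?expR_ge0// divr_ge0// ltW.
lra.
Unshelve. all: by end_near. Qed.

End Picard.

(** * Solutions and the rotation number *)

Section Flow.
Context {R : realType}.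
Variable om : R.
Hypothesis om0 : 0 < om.
Implicit Types (phi psi : R -> R) (A B t x y : R).

Notation sol := (is_solution om).

Definition vfield B A t y := - (sin y / om) + ell om B + 2 * mu om A * cos t.

Lemma sinD2pi_int x (k : int) : sin (x + 2 * pi * k%:~R) = sin x.
Proof.
have H n y : sin (y + 2 * pi * n%:R) = sin y.
  by rewrite -(periodicn (@sinD2pi R) n y); congr (sin (y + _)); rewrite -[RHS]mulr_natr; ring.
case: k => n; first exact: H.
by rewrite -(H n.+1 (x + _)) NegzE; congr sin; rewrite mulrNz -pmulrn; ring.
Qed.

Lemma cosD2pi_int x (k : int) : cos (x + 2 * pi * k%:~R) = cos x.
Proof.
by rewrite -!sinDpihalf -(sinD2pi_int (x + pi / 2) k); congr sin; ring.
Qed.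

Lemma sin_lip x y : `|sin x - sin y| <= `|x - y|.
Proof.
have H a b : a <= b -> `|sin b - sin a| <= `|b - a|.
  move=> ab; have [c _ ->] := ddt_mvt ddt_sin ab.
  by rewrite normrM ler_piMl ?normr_ge0 ?cos_max.
by have [/H|/ltW/H] := leP y x; rewrite // distrC [X in _ <= X]distrC.
Qed.

Lemma sol_ddt B A phi : sol B A phi <-> ddt phi (fun t => vfield B A t (phi t)).
Proof. by []. Qed.

Lemma sol_exists B A x : exists phi, sol B A phi /\ phi 0 = x.
Proof.
have [||||phi dphi phi0] := @picard R (vfield B A) om^-1
  (om^-1 + `|ell om B| + `|2 * mu om A|) x.
- by rewrite invr_gt0.
- move=> t y z; rewrite /vfield.
  rewrite (_ : _ - _ = - (om^-1 * (sin y - sin z))); last by ring.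
  by rewrite normrN normrM gtr0_norm ?invr_gt0// ler_pM2l ?invr_gt0// sin_lip.
- move=> t y; apply: le_trans (ler_normD _ _) _; apply: lerD; last first.
    by rewrite normrM ler_piMr ?cos_max.
  apply: le_trans (ler_normD _ _) _; apply: lerD => //.
  rewrite normrN normrM [`|om^-1|]gtr0_norm ?invr_gt0//.
  by rewrite ler_piMl ?sin_max// invr_ge0 ltW.
- move=> f cf t; rewrite /vfield.
  apply: cvgD; first apply: cvgD.
  + apply: cvgN; apply: cvgMl; apply: continuous_comp; first exact: cf.
    exact: continuous_sin.
  + exact: cvg_cst.
  + by apply: cvgMr; exact: continuous_cos.
by exists phi.
Qed.

Definition flow B A x : R -> R :=
  xget (fun=> 0) [set phi | sol B A phi /\ phi 0 = x].

Lemma flowP B A x : sol B A (flow B A x) /\ flow B A x 0 = x.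
Proof. by rewrite /flow; have [phi h] := sol_exists B A x; exact: (xgetI (fun=> 0) (P := [set f | sol B A f /\ f 0 = x]) h). Qed.

Lemma flow_sol B A x : sol B A (flow B A x). Proof. by have [] := flowP B A x. Qed.
Lemma flow0 B A x : flow B A x 0 = x. Proof. by have [] := flowP B A x. Qed.

Lemma sol_shift B A phi (k m : int) : sol B A phi ->
  sol B A (fun t => phi (t + 2 * pi * k%:~R) + 2 * pi * m%:~R).
Proof.
move=> /sol_ddt d; apply/sol_ddt.
apply: ddt_eqr (ddtD (ddt_shift (2 * pi * k%:~R) d) (ddt_cst _)) _ => t.
by rewrite addr0 /vfield sinD2pi_int cosD2pi_int.
Qed.

(** This time-reversing symmetry transfers uniqueness from positive to negative times. *)
Lemma sol_reverse B A phi : sol B A phi -> sol B A (fun t => pi - phi (- t)).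
Proof.
move=> /sol_ddt d; apply/sol_ddt.
apply: ddt_eqr (ddtB (ddt_cst pi) (ddt_opp d)) _ => t.
by rewrite sub0r opprK /vfield cosN [pi - _]addrC sinDpi sinN opprK.
Qed.

(** Half a period changes the sign of the forcing term, so that [B] and the rotation number are
    reversed together; this is the source of [rho >= 0] for [B >= 0]. *)
Lemma sol_antisym B A phi : sol B A phi -> sol (- B) A (fun t => - phi (t + pi)).
Proof.
move=> /sol_ddt d; apply/sol_ddt.
apply: ddt_eqr (ddtN (ddt_shift pi d)) _ => t.
by rewrite /vfield /ell sinN cosDpi; ring.
Qed.

Lemma sol_le B1 B2 A phi psi : B1 <= B2 -> sol B1 A phi -> sol B2 A psi ->
  phi 0 <= psi 0 -> forall t, 0 <= t -> phi t <= psi t.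
Proof.
move=> B12 /sol_ddt d1 /sol_ddt d2 le0 t t0; rewrite -subr_ge0.
apply: (ddt_ge0_compare (K := om^-1) (ddtB d2 d1)); rewrite ?subr_ge0// => s s0 lt0.
have : `|sin (psi s) - sin (phi s)| <= phi s - psi s.
  by apply: le_trans (sin_lip _ _) _; rewrite ltr0_norm// opprB.
rewrite ler_norml => /andP[_ h].
have : om^-1 * (sin (psi s) - sin (phi s)) <= om^-1 * (phi s - psi s).
  by rewrite ler_pM2l ?invr_gt0.
have : ell om B1 <= ell om B2 by rewrite /ell ler_pM2r ?invr_gt0.
by rewrite /vfield; lra.
Qed.

(** Multiplied by [exp (t / om)], the gap between the two solutions is nondecreasing, and increasing
    if [B1 < B2]; hence either kind of strictness suffices. *)
Lemma sol_lt B1 B2 A phi psi : B1 <= B2 -> sol B1 A phi -> sol B2 A psi ->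
  phi 0 <= psi 0 -> B1 < B2 \/ phi 0 < psi 0 ->
  forall t, 0 < t -> phi t < psi t.
Proof.
move=> B12 s1 s2 le0 strict t t0.
have le s : 0 <= s -> phi s <= psi s by exact: (sol_le B12 s1 s2 le0).
move: (s1) (s2) => /sol_ddt d1 /sol_ddt d2.
have dE := ddt_comp ddt_expR (ddtZ om^-1 ddt_id).
have dg := ddtM (ddtB d2 d1) dE.
pose b := ell om B2 - ell om B1.
have g' s : 0 <= s <= t -> b * expR (om^-1 * s) <=
  (vfield B2 A s (psi s) - vfield B1 A s (phi s)) * expR (om^-1 * s) +
  (psi s - phi s) * (om^-1 * 1 * expR (om^-1 * s)).
  move=> /andP[s0 _]; rewrite mulr1 mulrA -mulrDl ler_pM2r ?expR_gt0//.
  have : `|sin (psi s) - sin (phi s)| <= psi s - phi s.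
    by apply: le_trans (sin_lip _ _) _; rewrite ger0_norm// subr_ge0 le.
  rewrite ler_norml => /andP[_ h].
  have : om^-1 * (sin (psi s) - sin (phi s)) <= om^-1 * (psi s - phi s).
    by rewrite ler_pM2l ?invr_gt0.
  by rewrite /vfield /b; lra.
have b0 : 0 <= b by rewrite subr_ge0 /ell ler_pM2r ?invr_gt0.
have E0 s : 0 < expR (om^-1 * s) by exact: expR_gt0.
have g0 : 0 <= (psi 0 - phi 0) * expR (om^-1 * 0) by rewrite mulr_ge0 ?expR_ge0// subr_ge0.
suff : 0 < (psi t - phi t) * expR (om^-1 * t) by rewrite pmulr_lgt0// subr_gt0.
case: strict => [Blt|xlt].
  apply: le_lt_trans g0 _; apply: (ddt_lt dg t0) => s st.
  apply: lt_le_trans (g' s st); rewrite mulr_gt0//.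
  by rewrite subr_gt0 /ell ltr_pM2r ?invr_gt0.
apply: (@lt_le_trans _ _ ((psi 0 - phi 0) * expR (om^-1 * 0))).
  by rewrite mulr_gt0// subr_gt0.
apply: (ddt_le dg (ltW t0)) => s st; apply: le_trans (g' s st).
by rewrite mulr_ge0// ltW.
Qed.

Lemma sol_uniq B A phi psi : sol B A phi -> sol B A psi -> phi 0 = psi 0 -> phi =1 psi.
Proof.
have H f g t : sol B A f -> sol B A g -> f 0 = g 0 -> 0 <= t -> f t = g t.
  move=> sf sg e t0; apply: le_anti.
  by apply/andP; split; [apply: (sol_le (lexx B) sf sg)|apply: (sol_le (lexx B) sg sf)];
    rewrite // e.
move=> s1 s2 e t; have [t0|t0] := leP 0 t; first exact: H.
have := H _ _ (- t) (sol_reverse s1) (sol_reverse s2).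
by rewrite opprK oppr0 e oppr_ge0 => /(_ erefl (ltW t0)) /addrI/oppr_inj.
Qed.

(** A Gronwall estimate: changes of size [d] in [B] and in [A] each add at most [d / om] to the
    slope, and [N exp (t / om) - 2 d] is the solution of [y' = (y + 2 d) / om] that starts at the
    initial distance. *)
Lemma sol_dist B1 B2 A1 A2 phi psi d : sol B1 A1 phi -> sol B2 A2 psi ->
  `|B1 - B2| <= d -> `|A1 - A2| <= d ->
  forall t, 0 <= t -> `|phi t - psi t| <= (`|phi 0 - psi 0| + 2 * d) * expR (om^-1 * t).
Proof.
have omV : 0 < om^-1 by rewrite invr_gt0.
have H b1 b2 a1 a2 f g t : sol b1 a1 f -> sol b2 a2 g ->
    `|b1 - b2| <= d -> `|a1 - a2| <= d -> 0 <= t ->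
    f t - g t <= (`|f 0 - g 0| + 2 * d) * expR (om^-1 * t).
  move=> /sol_ddt d1 /sol_ddt d2 bd ad t0.
  have d0 : 0 <= d by exact: le_trans bd.
  set N := `|f 0 - g 0| + 2 * d.
  have dE := ddt_comp ddt_expR (ddtZ om^-1 ddt_id).
  have dh := ddtB (ddtB (ddtZ N dE) (ddt_cst (2 * d))) (ddtB d1 d2).
  have e1 s : 0 <= s -> 1 <= expR (om^-1 * s).
    by move=> s0; rewrite -[leLHS]expR0 ler_expR mulr_ge0// ltW.
  have N2 : 2 * d <= N by rewrite /N lerDr.
  suff : 0 <= N * expR (om^-1 * t) - 2 * d - (f t - g t) by lra.
  apply: (ddt_ge0_compare (K := om^-1) dh) => //.
    by rewrite mulr0 expR0 /N; have := ler_norm (f 0 - g 0); lra.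
  move=> s s0 lt0.
  have fg : 0 <= f s - g s.
    have : 2 * d * 1 <= N * expR (om^-1 * s).
      by rewrite ler_pM// ?ler01 ?e1// mulr_ge0.
    lra.
  have h1 : om^-1 * - (sin (f s) - sin (g s)) <= om^-1 * (f s - g s).
    rewrite ler_pM2l//; have := sin_lip (f s) (g s).
    by rewrite [`|f s - g s|]ger0_norm// ler_norml; lra.
  have h2 : ell om b1 - ell om b2 <= om^-1 * d.
    rewrite /ell -mulrBl mulrC ler_pM2l//; exact: le_trans (ler_norm _) bd.
  have h3 : 2 * mu om a1 * cos s - 2 * mu om a2 * cos s <= om^-1 * d.
    rewrite /mu (_ : _ - _ = om^-1 * ((a1 - a2) * cos s)); last first.
      by field; rewrite gt_eqF.
    rewrite ler_pM2l//; apply: le_trans (ler_norm _) _; rewrite normrM.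
    by rewrite -[d]mulr1 ler_pM ?cos_max.
  by rewrite /vfield; move: h1 h2 h3; lra.
move=> s1 s2 bd ad t t0; rewrite ler_norml lerNl opprB.
apply/andP; split; last exact: H s1 s2 bd ad t0.
by rewrite distrC; apply: (H _ _ _ _ _ _ _ s2 s1); rewrite // distrC.
Qed.

Lemma flow_dist B1 B2 A1 A2 x y d t : `|B1 - B2| <= d -> `|A1 - A2| <= d -> 0 <= t ->
  `|flow B1 A1 x t - flow B2 A2 y t| <= (`|x - y| + 2 * d) * expR (om^-1 * t).
Proof.
move=> bd ad t0.
by have := sol_dist (flow_sol B1 A1 x) (flow_sol B2 A2 y) bd ad t0; rewrite !flow0.
Qed.

Lemma sol_flow B A phi : sol B A phi -> phi =1 flow B A (phi 0).
Proof. by move=> s; apply: (sol_uniq s (flow_sol _ _ _)); rewrite flow0. Qed.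

Definition poincare B A x := flow B A x (2 * pi).

Lemma pi2_gt0 : 0 < 2 * pi :> R. Proof. by rewrite mulr_gt0// pi_gt0. Qed.
Let pi20 := pi2_gt0.
Let pi20w : 0 <= 2 * pi :> R. Proof. exact: ltW. Qed.
Lemma poincareD B A x (k : int) :
  poincare B A (x + 2 * pi * k%:~R) = poincare B A x + 2 * pi * k%:~R.
Proof.
have := sol_flow (sol_shift 0 k (flow_sol B A x)) (2 * pi).
by rewrite /= !mulr0 !addr0 flow0 /poincare => <-.
Qed.

Lemma poincare_sol B A phi n : sol B A phi ->
  phi (2 * pi * n.+1%:R) = poincare B A (phi (2 * pi * n%:R)).
Proof.
move=> s; have := sol_flow (sol_shift n 0 s) (2 * pi).
rewrite /= mulr0 !addr0 add0r => e.
by rewrite (_ : 2 * pi * n.+1%:R = 2 * pi + 2 * pi * n%:R) ?e//; rewrite -addn1 natrD; ring.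
Qed.

Lemma poincare_lt B1 B2 A x y : B1 <= B2 -> x <= y -> B1 < B2 \/ x < y ->
  poincare B1 A x < poincare B2 A y.
Proof.
move=> B12 xy h; apply: (sol_lt B12 (flow_sol _ _ _) (flow_sol _ _ _)) => //; rewrite ?flow0//.
Qed.

Lemma poincare_ltB B1 B2 A x : B1 < B2 -> poincare B1 A x < poincare B2 A x.
Proof. by move=> B12; apply: poincare_lt => //; [exact: ltW|left]. Qed.

Lemma poincare_le B A x y : x <= y -> poincare B A x <= poincare B A y.
Proof.
move=> xy; apply: (sol_le (lexx B) (flow_sol _ _ _) (flow_sol _ _ _)) => //; rewrite ?flow0//.
Qed.

Lemma poincare_dist B1 B2 A1 A2 x y d : `|B1 - B2| <= d -> `|A1 - A2| <= d ->
  `|poincare B1 A1 x - poincare B2 A2 y| <= (`|x - y| + 2 * d) * expR (om^-1 * (2 * pi)).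
Proof. by move=> bd ad; exact: flow_dist. Qed.

Lemma continuous_poincare B A : continuous (poincare B A).
Proof.
move=> x; apply/cvgrPdist_lt => e e0.
have E0 := expR_gt0 (om^-1 * (2 * pi)).
near=> y; apply: le_lt_trans (poincare_dist (d := 0) x y _ _) _; rewrite ?subrr ?normr0//.
rewrite mulr0 addr0 -ltr_pdivlMr//.
by near: y; apply: cvgr_dist_lt; [exact: cvg_id|rewrite divr_gt0].
Unshelve. all: by end_near. Qed.

Lemma floor_2pi x y : exists k : int, y + 2 * pi * k%:~R <= x < y + 2 * pi * (k + 1)%:~R.
Proof.
exists (Num.floor ((x - y) / (2 * pi))); have /andP[] := floor_itv ((x - y) / (2 * pi)).
rewrite ler_pdivlMr// ltr_pdivrMr// => h1 h2.
by apply/andP; split; lra.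
Qed.

(** One solution starts, hence stays, between two consecutive [2 pi]-translates of the other. *)
Lemma sol_increments B A phi psi t : sol B A phi -> sol B A psi -> 0 <= t ->
  `|(phi t - phi 0) - (psi t - psi 0)| <= 2 * pi.
Proof.
move=> s1 s2 t0; have [k /andP[h1 h2]] := floor_2pi (phi 0) (psi 0).
have p1 := sol_le (lexx B) (sol_shift 0 k s2) s1.
have p2 := sol_le (lexx B) s1 (sol_shift 0 (k + 1) s2).
move: (p1) (p2); rewrite !mulr0 !addr0 => /(_ h1 t t0) q1 /(_ (ltW h2) t t0) q2.
move: h1 h2 q1 q2; rewrite intrD mulr1z addr0 ler_norml => *; apply/andP; split; lra.
Qed.

(** The values [b n] of one solution after [n] periods are additive up to [2 pi], so the intervals
    of radius [2 pi / n] about [b n / n] meet pairwise and have a common point. The bound [4 pi] is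
    [2 pi] for this and [2 pi] for the passage to another solution; its independence of [n] and of
    the parameters is what later makes [rho] continuous. *)
Lemma rotation_exists B A : exists r, forall phi n, sol B A phi ->
  `|phi (2 * pi * n%:R) - phi 0 - 2 * pi * n%:R * r| <= 4 * pi.
Proof.
pose psi := flow B A 0; have spsi : sol B A psi := flow_sol B A 0.
pose b n := psi (2 * pi * n%:R).
have T0 n : 0 <= 2 * pi * n%:R :> R by rewrite mulr_ge0.
have b0 : b 0%N = 0 by rewrite /b mulr0 /psi flow0.
have bD m n : `|b (m + n)%N - b m - b n| <= 2 * pi.
  have := sol_increments (sol_shift m 0 spsi) spsi (T0 n).
  rewrite mulr0 !addr0 add0r /psi flow0 subr0 -/psi -mulrDr -natrD addnC.
  by rewrite /b addrAC.
have bM m n : `|b (m * n)%N - m%:R * b n| <= 2 * pi * m%:R.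
  elim: m => [|m IH]; first by rewrite mul0n b0 !mul0r mulr0 subrr normr0.
  move: (bD n (m * n)%N) IH; rewrite mulSn -[m.+1]add1n natrD !ler_norml.
  by move=> /andP[? ?] /andP[? ?]; apply/andP; split; lra.
have [|r rP] := @cut_exists R nat 0%N (fun n => (b n.+1 - 2 * pi) / n.+1%:R)
  (fun n => (b n.+1 + 2 * pi) / n.+1%:R).
  move=> i j; rewrite ler_pdivrMr// mulrAC ler_pdivlMr//.
  have := bM i.+1 j.+1; have := bM j.+1 i.+1; rewrite [(j.+1 * i.+1)%N]mulnC.
  by rewrite !ler_norml => /andP[? ?] /andP[? ?]; lra.
exists (r / (2 * pi)) => phi n s.
have h := sol_increments s spsi (T0 n).
have : `|b n - r * n%:R| <= 2 * pi.
  case: n h => [|n] _; first by rewrite b0 mulr0 subr0 normr0.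
  have /andP[] := rP n; rewrite ler_pdivlMr// ler_pdivrMr// ler_norml => *.
  by apply/andP; split; lra.
move: h; rewrite {2}/psi flow0 subr0 -/psi -/(b n).
rewrite (_ : 2 * pi * n%:R * (r / _) = r * n%:R); last first.
  by move: pi20; move: (2 * pi) => p p0; field; rewrite gt_eqF.
by rewrite !ler_norml => /andP[? ?] /andP[? ?]; apply/andP; split; lra.
Qed.

Lemma bounded_mul_nat0 (x C : R) : (forall n : nat, n%:R * x <= C) -> x <= 0.
Proof.
move=> h; rewrite leNgt; apply/negP => x0.
have := h (Num.truncn (C / x)).+1; rewrite leNgt => /negP; apply.
by rewrite -ltr_pdivrMr// truncnS_gt.
Qed.

Lemma rotation_uniq B A r phi : sol B A phi ->
  (forall n, `|phi (2 * pi * n%:R) - phi 0 - 2 * pi * n%:R * r| <= 4 * pi) ->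
  (fun k : nat => phi (2 * pi * k%:R) / (2 * pi * k%:R)) @ \oo --> r.
Proof.
move=> s h; apply/cvgrPdist_lt => e e0.
pose C := `|phi 0| + 4 * pi.
near=> n.
have n0 : (0 < n)%N by near: n; exact: nbhs_infty_gt.
have nR : 0 < n%:R :> R by rewrite ltr0n.
have q0 : 0 < 2 * pi * n%:R :> R by rewrite mulr_gt0.
rewrite -(ltr_pM2r q0) -[X in _ * X < _](gtr0_norm q0) -normrM mulrBl divfK ?gt_eqF//.
apply: (@le_lt_trans _ _ C).
  have := h n; have := ler_norm (phi 0); have := ler_norm (- phi 0).
  by rewrite normrN !ler_norml /C => ? ? /andP[? ?]; apply/andP; split; lra.
have : C / (e * (2 * pi)) < n%:R by near: n; exact: nbhs_infty_gtr.
rewrite ltr_pdivrMr; last by rewrite !mulr_gt0// pi_gt0.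
by rewrite (_ : n%:R * _ = e * (2 * pi * n%:R)) //; ring.
Unshelve. all: by end_near. Qed.

Lemma rho_is_rotation_number B A : is_rotation_number om B A (rho om B A).
Proof.
apply: (@getPex _ [set r | is_rotation_number om B A r]).
have [r rP] := rotation_exists B A; exists r; split.
  by exists (flow B A 0); exact: flow_sol.
by move=> phi s; apply: rotation_uniq => // n; exact: rP.
Qed.

Lemma rho_bound B A phi n : sol B A phi ->
  `|phi (2 * pi * n%:R) - phi 0 - 2 * pi * n%:R * rho om B A| <= 4 * pi.
Proof.
have [r rP] := rotation_exists B A.
suff -> : rho om B A = r by exact: rP.
have [[phi' s] /(_ phi' s) c1] := rho_is_rotation_number B A.
have c2 := rotation_uniq s (fun n => rP phi' n s).
exact: cvg_unique c1 c2.
Qed.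

Lemma rho_ge B A r c phi : sol B A phi ->
  (forall n : nat, phi 0 + 2 * pi * n%:R * r <= phi (2 * pi * n%:R) + c) -> r <= rho om B A.
Proof.
move=> s h; rewrite -subr_le0; apply: (@bounded_mul_nat0 _ ((4 * pi + c) / (2 * pi))) => n.
rewrite ler_pdivlMr//; have := rho_bound n s; have := h n.
by rewrite ler_norml => ? /andP[? ?]; lra.
Qed.

Lemma rho_le B A r c phi : sol B A phi ->
  (forall n : nat, phi (2 * pi * n%:R) <= phi 0 + 2 * pi * n%:R * r + c) -> rho om B A <= r.
Proof.
move=> s h; rewrite -subr_le0; apply: (@bounded_mul_nat0 _ ((4 * pi + c) / (2 * pi))) => n.
rewrite ler_pdivlMr//; have := rho_bound n s; have := h n.
by rewrite ler_norml => ? /andP[? ?]; lra.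
Qed.

Lemma rho_continuous B A e : 0 < e -> exists2 d, 0 < d &
  forall B' A', `|B - B'| <= d -> `|A - A'| <= d -> `|rho om B A - rho om B' A'| < e.
Proof.
move=> e0; pose n := (Num.truncn ((8 * pi + 1) / (e * (2 * pi)))).+1.
have n0 : 0 < n%:R :> R by rewrite ltr0n.
have nP : (8 * pi + 1) < n%:R * (e * (2 * pi)).
  by rewrite -ltr_pdivrMr ?mulr_gt0// ?pi_gt0// truncnS_gt.
pose E := expR (om^-1 * (2 * pi * n%:R)); have E0 : 0 < E := expR_gt0 _.
exists ((2 * E)^-1); first by rewrite invr_gt0 mulr_gt0.
move=> B' A' hB hA.
have T0 : 0 <= 2 * pi * n%:R :> R by rewrite mulr_ge0.
have := flow_dist 0 0 hB hA T0; rewrite subrr normr0 add0r -/E.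
rewrite (_ : 2 * _ * E = 1); last by field; rewrite gt_eqF.
have := rho_bound n (flow_sol B A 0); have := rho_bound n (flow_sol B' A' 0).
rewrite !flow0 !subr0 => h1 h2 h3.
have nq : 0 < n%:R * (2 * pi) :> R by rewrite mulr_gt0.
rewrite -(ltr_pM2r nq) -[X in _ * X < _](gtr0_norm nq) -normrM.
apply: (@le_lt_trans _ _ (8 * pi + 1)); last by move: nP; lra.
by move: h1 h2 h3; rewrite !ler_norml => /andP[? ?] /andP[? ?] /andP[? ?]; apply/andP; split; lra.
Qed.

End Flow.

(** * Fixed points of the Poincare map *)

Section IntegerRotation.
Context {R : realType}.
Variable om : R.
Hypothesis om0 : 0 < om.
Implicit Types (phi psi : R -> R) (A B t x y : R) (r : int).

Notation sol := (is_solution om).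
Notation P := (poincare om).
Let p2 : 0 < 2 * pi :> R := pi2_gt0.

Lemma rho_ge_point B A x r : x + 2 * pi * r%:~R <= P B A x -> r%:~R <= rho om B A.
Proof.
move=> Px; have s := flow_sol om0 B A x.
apply: (rho_ge om0 (c := 0) s); rewrite flow0// => n; rewrite addr0.
elim: n => [|n IH]; first by rewrite mulr0 mul0r addr0 flow0.
rewrite (poincare_sol om0 _ s).
have := poincare_le om0 B A IH.
rewrite (_ : x + _ * _ * _ = x + 2 * pi * (n%:Z * r)%:~R); last by rewrite intrM -pmulrn; ring.
rewrite poincareD// => /(le_trans _); apply.
by move: Px; rewrite intrM -pmulrn -[n.+1]addn1 natrD; lra.
Qed.

Lemma rho_le_point B A x r : P B A x <= x + 2 * pi * r%:~R -> rho om B A <= r%:~R.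
Proof.
move=> Px; have s := flow_sol om0 B A x.
apply: (rho_le om0 (c := 0) s); rewrite flow0// => n; rewrite addr0.
elim: n => [|n IH]; first by rewrite mulr0 mul0r addr0 flow0.
rewrite (poincare_sol om0 _ s).
have := poincare_le om0 B A IH.
rewrite (_ : x + _ * _ * _ = x + 2 * pi * (n%:Z * r)%:~R); last by rewrite intrM -pmulrn; ring.
rewrite poincareD// => /le_trans; apply.
by move: Px; rewrite intrM -pmulrn -[n.+1]addn1 natrD; lra.
Qed.

Lemma poincare_gap B A : exists x0 x1, forall x,
  P B A x0 - x0 <= P B A x - x <= P B A x1 - x1.
Proof.
have c : {within `[0, 2 * pi], continuous (fun x => P B A x - x)}.
  apply: continuous_subspaceT => x.
  by apply: cvgB; [exact: continuous_poincare|exact: cvg_id].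
have [x0 _ h0] := EVT_min (ltW p2) c; have [x1 _ h1] := EVT_max (ltW p2) c.
exists x0, x1 => x; have [k /andP[kx xk]] := floor_2pi x 0.
have xin : x + 2 * pi * (- k)%:~R \in `[0, 2 * pi]%R.
  rewrite in_itv/= mulrNz; move: kx xk; rewrite intrD mulr1z => ? ?.
  by apply/andP; split; lra.
by move: (h0 _ xin) (h1 _ xin); rewrite poincareD// => ? ?; apply/andP; split; lra.
Qed.

(** Strictness survives the limit by compactness: the periodic function [P - id] attains its
    minimum, so every period gains a fixed [d > 0] over [2 pi r]. *)
Lemma rho_gt_all B A r : (forall x, x + 2 * pi * r%:~R < P B A x) -> r%:~R < rho om B A.
Proof.
move=> Px; have [x0 [x1 hx]] := poincare_gap B A.
pose d := P B A x0 - x0 - 2 * pi * r%:~R; have d0 : 0 < d by have := Px x0; rewrite /d; lra.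
suff : r%:~R + d / (2 * pi) <= rho om B A.
  by apply: lt_le_trans; rewrite ltrDl divr_gt0.
have s := flow_sol om0 B A 0; apply: (rho_ge om0 (c := 0) s) => n.
rewrite flow0// addr0 add0r (_ : _ * (_ + _) = n%:R * (2 * pi * r%:~R + d)); last first.
  by move: p2; move: (2 * pi) => p p0; field; rewrite gt_eqF.
elim: n => [|n IH]; first by rewrite mulr0 mul0r flow0.
rewrite (poincare_sol om0 _ s); have /andP[+ _] := hx (flow om B A 0 (2 * pi * n%:R)).
by move: IH; rewrite -[n.+1]addn1 natrD /d; lra.
Qed.

Lemma rho_lt_all B A r : (forall x, P B A x < x + 2 * pi * r%:~R) -> rho om B A < r%:~R.
Proof.
move=> Px; have [x1 [x0 hx]] := poincare_gap B A.
pose d := 2 * pi * r%:~R - (P B A x0 - x0); have d0 : 0 < d by have := Px x0; rewrite /d; lra.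
suff : rho om B A <= r%:~R - d / (2 * pi).
  by move=> /le_lt_trans; apply; rewrite ltrBlDr ltrDl divr_gt0.
have s := flow_sol om0 B A 0; apply: (rho_le om0 (c := 0) s) => n.
rewrite flow0// addr0 add0r (_ : _ * (_ - _) = n%:R * (2 * pi * r%:~R - d)); last first.
  by move: p2; move: (2 * pi) => p p0; field; rewrite gt_eqF.
elim: n => [|n IH]; first by rewrite mulr0 mul0r flow0.
rewrite (poincare_sol om0 _ s); have /andP[_ +] := hx (flow om B A 0 (2 * pi * n%:R)).
by move: IH; rewrite -[n.+1]addn1 natrD /d; lra.
Qed.

Lemma rho_geP B A r : r%:~R <= rho om B A <-> exists x, x + 2 * pi * r%:~R <= P B A x.
Proof.
split=> [h|[x]]; last exact: rho_ge_point.
apply: contrapT => /forallNP n; move: h; apply/negP; rewrite -ltNge.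
by apply: rho_lt_all => x; have /negP := n x; rewrite -ltNge.
Qed.

Lemma rho_leP B A r : rho om B A <= r%:~R <-> exists x, P B A x <= x + 2 * pi * r%:~R.
Proof.
split=> [h|[x]]; last exact: rho_le_point.
apply: contrapT => /forallNP n; move: h; apply/negP; rewrite -ltNge.
by apply: rho_gt_all => x; have /negP := n x; rewrite -ltNge.
Qed.

Lemma rho_eqP B A r : rho om B A = r%:~R <-> exists x, P B A x = x + 2 * pi * r%:~R.
Proof.
split=> [e|[x e]]; last first.
  by apply: le_anti; rewrite (@rho_ge_point _ _ x) ?(@rho_le_point _ _ x)// e.
have [x hx] : exists x, x + 2 * pi * r%:~R <= P B A x by apply/rho_geP; rewrite e.
have [y hy] : exists x, P B A x <= x + 2 * pi * r%:~R by apply/rho_leP; rewrite e.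
pose f z := P B A z - z.
have cf a b : {within `[a, b], continuous f}.
  apply: continuous_subspaceT => z.
  by apply: cvgB; [exact: continuous_poincare|exact: cvg_id].
have fx : 2 * pi * r%:~R <= f x by rewrite /f; lra.
have fy : f y <= 2 * pi * r%:~R by rewrite /f; lra.
have [z fz] : exists z, f z = 2 * pi * r%:~R.
  have [xy|/ltW yx] := leP x y.
    have [|z _] := IVT xy (cf x y) (v := 2 * pi * r%:~R); last by exists z.
    by rewrite ge_min le_max fx fy orbT.
  have [|z _] := IVT yx (cf y x) (v := 2 * pi * r%:~R); last by exists z.
  by rewrite ge_min le_max fx fy orbT.
by exists z; move: fz; rewrite /f; lra.
Qed.

Lemma poincare_near B A x e : 0 < e -> exists2 d, 0 < d & forall B' A',
  `|B - B'| <= d -> `|A - A'| <= d -> `|P B A x - P B' A' x| < e.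
Proof.
move=> e0; set E := expR (om^-1 * (2 * pi)); have E0 : 0 < E := expR_gt0 _.
exists (e / (4 * E)); first by rewrite divr_gt0// mulr_gt0.
move=> B' A' hB hA; apply: le_lt_trans (poincare_dist om0 x x hB hA) _.
rewrite subrr normr0 add0r -/E (_ : 2 * _ * E = e / 2); first by lra.
by field; rewrite gt_eqF.
Qed.

(** For integer [r] the condition has a witness [x] for a single iterate of [P]; a move to the right
    makes its inequality strict, hence open. This openness gives continuity of the edges of the
    level sets. *)
Lemma rho_ge_up B A B' r : r%:~R <= rho om B A -> B < B' -> exists2 d, 0 < d &
  forall b a, `|B' - b| <= d -> `|A - a| <= d -> r%:~R <= rho om b a.
Proof.
move=> /rho_geP[x hx] BB'.
have lt : P B A x < P B' A x by exact: poincare_ltB.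
have e0 : 0 < P B' A x - P B A x by rewrite subr_gt0.
have [d d0 dP] := poincare_near B' A x e0; exists d => // b a hb ha.
apply: (@rho_ge_point _ _ x); have := dP b a hb ha; rewrite ltr_norml => /andP[]; lra.
Qed.

Lemma rho_le_down B A B' r : rho om B A <= r%:~R -> B' < B -> exists2 d, 0 < d &
  forall b a, `|B' - b| <= d -> `|A - a| <= d -> rho om b a <= r%:~R.
Proof.
move=> /rho_leP[x hx] BB'.
have lt : P B' A x < P B A x by exact: poincare_ltB.
have e0 : 0 < P B A x - P B' A x by rewrite subr_gt0.
have [d d0 dP] := poincare_near B' A x e0; exists d => // b a hb ha.
apply: (@rho_le_point _ _ x); have := dP b a hb ha; rewrite ltr_norml => /andP[]; lra.
Qed.

Lemma nbhs_pair (L : set (R * R)) B A : nbhs (B, A) L <-> exists2 d, 0 < d &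
  forall b a, `|B - b| < d -> `|A - a| < d -> L (b, a).
Proof.
split.
  move=> /nbhs_ballP[d /= d0 dL]; exists d => // b a hb ha; apply: dL.
  by split; rewrite /= /ball/=.
move=> [d d0 dL]; apply/nbhs_ballP; exists d => //= -[b a] [/= hb ha].
exact: dL.
Qed.

Lemma rho_locally_constant B A r : (exists x, x + 2 * pi * r%:~R < P B A x) ->
  (exists x, P B A x < x + 2 * pi * r%:~R) -> interior (level_set om r%:~R) (B, A).
Proof.
move=> [x hx] [y hy].
have ex : 0 < P B A x - (x + 2 * pi * r%:~R) by lra.
have ey : 0 < (y + 2 * pi * r%:~R) - P B A y by lra.
have [d d0 dP] := poincare_near B A x ex; have [e e0 eP] := poincare_near B A y ey.
apply/nbhs_pair; exists (Num.min d e); first by rewrite lt_min d0.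
move=> b a; rewrite !lt_min => /andP[b1 b2] /andP[a1 a2].
apply: le_anti; apply/andP; split.
  apply: (@rho_le_point _ _ y); have := eP b a (ltW b2) (ltW a2).
  by rewrite ltr_norml => /andP[]; lra.
apply: (@rho_ge_point _ _ x); have := dP b a (ltW b1) (ltW a1).
by rewrite ltr_norml => /andP[]; lra.
Qed.

Lemma rho_increases B A B' r : (forall x, x + 2 * pi * r%:~R <= P B A x) -> B < B' ->
  r%:~R < rho om B' A.
Proof.
move=> h BB'; apply: rho_gt_all => x; apply: le_lt_trans (h x) _.
exact: poincare_ltB.
Qed.

Lemma rho_decreases B A B' r : (forall x, P B A x <= x + 2 * pi * r%:~R) -> B' < B ->
  rho om B' A < r%:~R.
Proof.
move=> h BB'; apply: rho_lt_all => x; apply: lt_le_trans (h x).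
exact: poincare_ltB.
Qed.

Definition amplitude phi (a : R -> R) :=
  [/\ ddt a (fun t => (2 * om)^-1 * cos (phi t) * a t), a 0 = 1 & forall t, 0 < a t].

Lemma amplitude_exists B A phi : sol B A phi -> exists a, amplitude phi a.
Proof.
move=> /sol_ddt d.
have c : continuous (fun t => (2 * om)^-1 * cos (phi t)).
  move=> t; apply: cvgMr; apply: continuous_comp; first exact: (ddt_cont d).
  exact: continuous_cos.
have [F dF F0] := primitive_exists c.
exists (fun t => expR (F t)); split; rewrite ?F0 ?expR0//; last by move=> t; exact: expR_gt0.
exact: ddt_comp ddt_expR dF.
Qed.

(* Half-angle polar coordinates: [a exp (i phi / 2)] solves a linear system, and this is
   its Wronskian. *)
Lemma amplitude_wronskian B A phi psi a b t : sol B A phi -> sol B A psi ->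
  amplitude phi a -> amplitude psi b ->
  a t * b t * sin ((phi t - psi t) / 2) = sin ((phi 0 - psi 0) / 2).
Proof.
move=> /sol_ddt d1 /sol_ddt d2 [da a0 _] [db b0 _].
have dS := ddt_comp ddt_sin (ddtM (ddtB d1 d2) (ddt_cst 2^-1)).
have d := ddtM (ddtM da db) dS.
rewrite (@ddt0_cst _ (fun t => a t * b t * sin ((phi t - psi t) / 2)) _ t 0).
  by rewrite a0 b0 !mul1r.
apply: ddt_eqr d _ => s; rewrite /vfield.
set c := cos ((phi s - psi s) / 2); set e := sin ((phi s - psi s) / 2).
have hphi : phi s = (phi s + psi s) / 2 + (phi s - psi s) / 2 by field.
have hpsi : psi s = (phi s + psi s) / 2 - (phi s - psi s) / 2 by field.
rewrite [in cos (phi s)]hphi [in cos (psi s)]hpsi [in sin (phi s)]hphi [in sin (psi s)]hpsi.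
rewrite cosD cosB sinD sinB -/c -/e.
by field; rewrite gt_eqF.
Qed.

Section FixedPoint.
Variables (B A x0 : R) (r : int).
Hypothesis fixed : P B A x0 = x0 + 2 * pi * r%:~R.
Variables a0 a1 : R -> R.
Hypothesis amp0 : amplitude (flow om B A x0) a0.
Hypothesis amp1 : amplitude (flow om B A (x0 + pi)) a1.

Let kap := a0 (2 * pi).
Let D1 := P B A (x0 + pi) - x0 - 2 * pi * r%:~R.

(** In half-angle coordinates the initial angles [x0] and [x0 + pi] are orthogonal directions. Up to
    the sign [(-1)^r] the period map is triangular there, with diagonal [kap], [kap^-1], and this is
    its off-diagonal entry. The multiplier of the fixed point is [kap^-2]. *)
Definition shear := a1 (2 * pi) * cos (D1 / 2).

Lemma fixed_sin1 : kap * (a1 (2 * pi) * sin (D1 / 2)) = 1.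
Proof.
have := amplitude_wronskian (2 * pi) (flow_sol om0 B A (x0 + pi))
  (flow_sol om0 B A x0) amp1 amp0.
rewrite !flow0// -/(P B A x0) -/(P B A (x0 + pi)) fixed -/kap.
rewrite (_ : x0 + pi - x0 = pi) ?sin_pihalf; last by ring.
by rewrite opprD addrA -/D1 => e; rewrite -[RHS]e; ring.
Qed.

Let kap0 : 0 < kap. Proof. by case: amp0 => _ _; exact. Qed.

(** The right-hand side is the determinant of the unit vector at angle [h / 2] and its image under
    the triangular period map; the left-hand side is the same determinant in polar form. The
    Wronskians with the two basis solutions supply the coordinates of the image. *)
Lemma fixed_mobius h a : amplitude (flow om B A (x0 + h)) a ->
  a (2 * pi) * sin ((P B A (x0 + h) - x0 - 2 * pi * r%:~R - h) / 2) =
  sin (h / 2) * ((kap^-1 - kap) * cos (h / 2) - shear * sin (h / 2)).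
Proof.
move=> amph; set D := P B A (x0 + h) - x0 - 2 * pi * r%:~R.
have e1 := fixed_sin1.
have e2 : kap * (a (2 * pi) * sin (D / 2)) = sin (h / 2).
  have := amplitude_wronskian (2 * pi) (flow_sol om0 B A (x0 + h))
    (flow_sol om0 B A x0) amph amp0.
  rewrite !flow0// -/(P B A x0) -/(P B A (x0 + h)) fixed -/kap.
  rewrite (_ : x0 + h - x0 = h); last by ring.
  by rewrite opprD addrA -/D => e; rewrite -[RHS]e; ring.
have e3 : a (2 * pi) * a1 (2 * pi) * sin (D / 2 - D1 / 2) = - cos (h / 2).
  have := amplitude_wronskian (2 * pi) (flow_sol om0 B A (x0 + h))
    (flow_sol om0 B A (x0 + pi)) amph amp1.
  rewrite !flow0// -/(P B A (x0 + pi)) -/(P B A (x0 + h)).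
  rewrite (_ : (x0 + h - _) / 2 = h / 2 - pi / 2); last by field.
  rewrite sinBpihalf => <-; congr (_ * sin _); rewrite /D /D1.
  by move: (2 * pi * _) => w; field.
have kn : kap != 0 by rewrite gt_eqF.
have e4 : a (2 * pi) * sin (D / 2) = kap^-1 * sin (h / 2).
  by rewrite -e2 mulKf.
have e5 : a1 (2 * pi) * sin (D1 / 2) = kap^-1.
  by apply: (mulfI kn); rewrite e1 divff.
have e6 : a (2 * pi) * cos (D / 2) = kap * cos (h / 2) + shear * sin (h / 2).
  apply: (mulfI (invr_neq0 kn)); rewrite -{1}e5.
  have -> : kap^-1 * (kap * cos (h / 2) + shear * sin (h / 2)) =
    cos (h / 2) + shear * (kap^-1 * sin (h / 2)) by field.
  rewrite -e4 /shear -[cos (h / 2)]opprK -e3 sinB; ring.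
rewrite mulrBl sinB mulrBr !mulrA e4 e6; ring.
Qed.

Lemma fixed_range h : 0 < h < 2 * pi ->
  0 < P B A (x0 + h) - x0 - 2 * pi * r%:~R < 2 * pi.
Proof.
move=> /andP[h0 h2].
have l1 : P B A x0 < P B A (x0 + h) by apply: poincare_lt => //; [lra|right; lra].
have : P B A (x0 + h) < P B A (x0 + 2 * pi * 1%:~R).
  by apply: poincare_lt => //; rewrite mulr1z; [lra|right; lra].
rewrite poincareD// mulr1z; move: l1; rewrite fixed => ? ?; apply/andP; split; lra.
Qed.

Lemma sin_half_gt0 (h : R) : 0 < h < 2 * pi -> 0 < sin (h / 2).
Proof. by move=> /andP[? ?]; apply: sin_gt0_pi; apply/andP; split; lra. Qed.

(** Both [h] and [D] lie in [(0, 2 pi)], so [sin ((D - h) / 2)] has the sign of [D - h]. *)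
Lemma fixed_sign h (D := P B A (x0 + h) - x0 - 2 * pi * r%:~R) : 0 < h < 2 * pi ->
  [/\ 0 < (kap^-1 - kap) * cos (h / 2) - shear * sin (h / 2) -> h < D,
     (kap^-1 - kap) * cos (h / 2) - shear * sin (h / 2) < 0 -> D < h &
     (kap^-1 - kap) * cos (h / 2) - shear * sin (h / 2) = 0 -> D = h].
Proof.
move=> hh; have /andP[D0 D2] := fixed_range hh; rewrite -/D in D0 D2.
have [a amph] := amplitude_exists (flow_sol om0 B A (x0 + h)).
have := fixed_mobius amph; rewrite -/D; case: amph => _ _ /(_ (2 * pi)) a20 e.
have sh := sin_half_gt0 hh.
set q := (kap^-1 - kap) * cos (h / 2) - shear * sin (h / 2) in e *.
have [hD|Dh|Dh] := ltgtP h D.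
- have : 0 < a (2 * pi) * sin ((D - h) / 2).
    by rewrite mulr_gt0// sin_half_gt0//; move: hh => /andP[? ?]; apply/andP; split; lra.
  by rewrite e pmulr_rgt0// => q0; split => //; [lra|move=> q00; rewrite q00 ltxx in q0].
- have : 0 < a (2 * pi) * sin ((h - D) / 2).
    by rewrite mulr_gt0// sin_half_gt0//; move: hh => /andP[? ?]; apply/andP; split; lra.
  rewrite -opprB mulNr sinN mulrN e oppr_gt0 pmulr_rlt0// => q0; split => //; first by lra.
  by move=> q00; rewrite q00 ltxx in q0.
- move: e; rewrite -Dh subrr mul0r sin0 mulr0 => /esym/eqP.
  rewrite mulf_eq0 gt_eqF//= => /eqP q0.
  by split => //; rewrite q0 ltxx.
Qed.

Lemma reduce_2pi x : exists (h : R) (k : int), 0 <= h < 2 * pi /\ x = x0 + h + 2 * pi * k%:~R.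
Proof.
have [k /andP[k1 k2]] := floor_2pi x x0.
exists (x - x0 - 2 * pi * k%:~R), k; split; last by ring.
by move: k2; rewrite intrD mulr1z => ?; apply/andP; split; lra.
Qed.

(** A translation-invariant relation between [x + 2 pi r] and [P x] need only be checked on one
    period measured from the fixed point; it is applied to equality and to both orders. *)
Lemma fixed_all (p : R -> R -> bool) : (forall h, 0 < h < 2 * pi ->
    p h (P B A (x0 + h) - x0 - 2 * pi * r%:~R)) -> p 0 0 ->
    (forall u v w, p u v -> p (u + w) (v + w)) ->
  forall x, p (x + 2 * pi * r%:~R) (P B A x).
Proof.
move=> ph p0 pD x; have [h [k [/andP[h0 h2] ->]]] := reduce_2pi x; rewrite poincareD//.
have {}p0 : p h (P B A (x0 + h) - x0 - 2 * pi * r%:~R).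
  move: h0; rewrite le_eqVlt => /predU1P[<-|h0]; last by apply: ph; rewrite h0.
  by rewrite addr0 fixed (_ : _ - _ = 0)//; ring.
have := pD _ _ (x0 + 2 * pi * r%:~R + 2 * pi * k%:~R) p0.
by congr (is_true (p _ _)); ring.
Qed.

Lemma fixed_identity : kap = 1 -> shear = 0 -> forall x, P B A x = x + 2 * pi * r%:~R.
Proof.
move=> k1 s0 x; apply/eqP; rewrite eq_sym.
apply: (@fixed_all (fun u v => u == v)) => // [h hh|u v w /eqP -> //].
have [_ _ /(_ _)/esym/eqP ->//] := fixed_sign hh.
by rewrite k1 s0 invr1 subrr !mul0r subrr.
Qed.

Lemma fixed_shear_lt0 : kap = 1 -> shear < 0 ->
  (forall x, x + 2 * pi * r%:~R <= P B A x) /\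
  exists x, x + 2 * pi * r%:~R < P B A x.
Proof.
move=> k1 s0.
have H h : 0 < h < 2 * pi -> h < P B A (x0 + h) - x0 - 2 * pi * r%:~R.
  move=> hh; have [+ _ _] := fixed_sign hh; apply.
  by rewrite k1 invr1 subrr mul0r sub0r oppr_gt0 pmulr_llt0// sin_half_gt0.
split; last first.
  have [pi1 pi2] : 0 < pi :> R /\ pi < 2 * pi :> R by have := @pi_gt0 R; split; lra.
  by exists (x0 + pi); have := H pi; rewrite pi1 pi2 => /(_ isT); lra.
apply: (@fixed_all (fun u v => u <= v)) => // [h /H/ltW//|u v w].
by rewrite lerD2r.
Qed.

Lemma fixed_shear_gt0 : kap = 1 -> 0 < shear ->
  (forall x, P B A x <= x + 2 * pi * r%:~R) /\
  exists x, P B A x < x + 2 * pi * r%:~R.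
Proof.
move=> k1 s0.
have H h : 0 < h < 2 * pi -> P B A (x0 + h) - x0 - 2 * pi * r%:~R < h.
  move=> hh; have [_ + _] := fixed_sign hh; apply.
  by rewrite k1 invr1 subrr mul0r sub0r oppr_lt0 pmulr_rgt0// sin_half_gt0.
split; last first.
  have [pi1 pi2] : 0 < pi :> R /\ pi < 2 * pi :> R by have := @pi_gt0 R; split; lra.
  by exists (x0 + pi); have := H pi; rewrite pi1 pi2 => /(_ isT); lra.
apply: (@fixed_all (fun u v => v <= u)) => // [h /H/ltW//|u v w].
by rewrite lerD2r.
Qed.

(* If [kap != 1] the fixed point is hyperbolic, so [P - id] changes sign. *)
Lemma fixed_parabolic : (forall x, x + 2 * pi * r%:~R <= P B A x) \/
  (forall x, P B A x <= x + 2 * pi * r%:~R) -> kap = 1.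
Proof.
move=> oneside; apply: contrapT => k1.
pose q := kap^-1 - kap.
have q0 : q != 0.
  apply: contra_notN k1; rewrite subr_eq0 => /eqP e.
  have : kap ^+ 2 == 1 by rewrite expr2 -{1}e mulVf// gt_eqF.
  by rewrite sqrf_eq1 => /orP[/eqP//|/eqP kN1]; move: kap0; rewrite kN1 ltr0N1.
(* Close to 0 the term with [q] dominates the shear. At [h = 2 y] and [h = 2 (pi - y)] the cosine
   takes opposite signs and the sine equal ones, so the displacement relative to [2 pi r] changes
   sign. *)
have [y /andP[y0 y1] yP] : exists2 y, 0 < y < pi / 2 & `|shear| * sin y < `|q| * cos y.
  have c : (fun y => `|q| * cos y - `|shear| * sin y) @ (0 : R) --> `|q| * cos 0 - `|shear| * sin 0.
    by apply: cvgB; apply: cvgMr; [exact: continuous_cos|exact: continuous_sin].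
  rewrite cos0 sin0 mulr1 mulr0 subr0 in c.
  have qpos : 0 < `|q| by rewrite normr_gt0.
  have [e /= e0 eP] := (nbhs_ballP _ _).1 (cvgr_gt _ c 0 qpos).
  have pih : 0 < pi / 2 :> R by rewrite divr_gt0// pi_gt0.
  pose y := Num.min (e / 2) (pi / 4).
  have y0 : 0 < y by rewrite lt_min !divr_gt0// pi_gt0.
  have ye : y <= e / 2 by rewrite ge_min lexx.
  have yp : y <= pi / 4 by rewrite ge_min lexx orbT.
  exists y; first by rewrite y0; lra.
  rewrite -subr_gt0; apply: eP; rewrite /ball/= sub0r normrN gtr0_norm//; lra.
have cs : 0 < cos y by apply: cos_gt0_pihalf; apply/andP; split; lra.
have sn : 0 < sin y by apply: sin_gt0_pi; apply/andP; split; lra.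
have h1 : 0 < 2 * y < 2 * pi by apply/andP; split; lra.
have h2 : 0 < 2 * (pi - y) < 2 * pi by apply/andP; split; lra.
have [+ + _] := fixed_sign h1; have [+ + _] := fixed_sign h2; rewrite -/q.
rewrite (_ : 2 * y / 2 = y); last by field.
rewrite (_ : 2 * (pi - y) / 2 = pi - y); last by move: pi => p; field.
rewrite [pi - y]addrC cosDpi sinDpi cosN sinN opprK => a1' a2' a3' a4'.
have sb : - (`|shear| * sin y) <= shear * sin y <= `|shear| * sin y.
  by rewrite -ler_norml normrM [`|sin y|]gtr0_norm.
have {sb} /andP[sb1 sb2] := sb.
have [qp|qn] : 0 < q \/ q < 0 by case: (ltgtP q 0) q0 => //; [right|left].
  have eq : `|q| * cos y = q * cos y by rewrite gtr0_norm.
  have pos1 : 0 < q * cos y - shear * sin y by lra.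
  have neg2 : q * - cos y - shear * sin y < 0 by lra.
  have := a3' pos1; have := a2' neg2.
  by case: oneside => h; [have := h (x0 + 2 * (- y + pi))|have := h (x0 + 2 * y)]; lra.
have eq : `|q| * cos y = - q * cos y by rewrite ltr0_norm.
have neg1 : q * cos y - shear * sin y < 0 by lra.
have pos2 : 0 < q * - cos y - shear * sin y by lra.
have := a4' neg1; have := a1' pos2.
by case: oneside => h; [have := h (x0 + 2 * y)|have := h (x0 + 2 * (- y + pi))]; lra.
Qed.

End FixedPoint.

End IntegerRotation.

(** * Connectedness of level sets *)

Section Joined.
Context {T : topologicalType}.
Implicit Types (X C : set T) (p q s : T).

Definition joined X p q := exists C, [/\ connected C, C `<=` X, C p & C q].

Lemma joined_sym X p q : joined X p q -> joined X q p.
Proof. by move=> [C [? ? ? ?]]; exists C. Qed.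

Lemma joined_trans X p q s : joined X p q -> joined X q s -> joined X p s.
Proof.
move=> [C [c1 s1 Cp Cq]] [D [c2 s2 Dq Ds]]; exists (C `|` D); split.
- by apply: connectedU => //; exists q.
- by move=> x [/s1|/s2].
- by left.
- by right.
Qed.

Lemma joined_connected X p : (forall q, X q -> joined X p q) -> connected X.
Proof.
move=> Xp; have /choice[C CP] : forall q, exists C, X q -> [/\ connected C, C `<=` X, C p & C q].
  move=> q; have [Xq|nXq] := pselect (X q); last by exists setT.
  by have [C ?] := Xp q Xq; exists C.
rewrite (_ : X = \bigcup_(q in X) C q).
  apply: bigcup_connected; last by move=> q /CP[].
  by exists p => q /CP[].
apply/seteqP; split => [q Xq|s [q /CP[_ + _ _]]]; first by exists q => //; case: (CP q Xq).
exact.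
Qed.

End Joined.

Lemma joined_image (T U : topologicalType) (I : set T) (f : T -> U) (X : set U) s t :
  connected I -> continuous f -> (forall x, I x -> X (f x)) -> I s -> I t ->
  joined X (f s) (f t).
Proof.
move=> cI cf IX Is It; exists (f @` I); split; [|by move=> _ [x /IX Xx <-]|by exists s|by exists t].
by apply: connected_continuous_connected => //; exact: continuous_subspaceT.
Qed.

Lemma continuous_pair (R : realType) (f g : R -> R) : continuous f -> continuous g ->
  continuous (fun x => (f x, g x)).
Proof.
move=> cf cg x.
exact: (@cvg_pair _ _ _ _ (nbhs (f x)) (nbhs (g x)) _ _ _ _ _ (cf x) (cg x)).
Qed.

Section PlaneRegion.
Context {R : realType}.
Implicit Types (X L : set (R * R)) (g : R -> R) (A B b c : R).

Lemma joined_segment X A b c : b <= c -> (forall x, b <= x <= c -> X (x, A)) ->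
  joined X (b, A) (c, A).
Proof.
move=> bc h; apply: (@joined_image _ _ `[b, c]%classic (fun x => (x, A))).
- exact: segment_connected.
- by apply: continuous_pair => x; [exact: cvg_id|exact: cvg_cst].
- by move=> x /=; rewrite in_itv/=; exact: h.
- by rewrite /= in_itv/= lexx.
- by rewrite /= in_itv/= lexx bc.
Qed.

Lemma joined_graph X g s t : continuous g -> (forall A, X (g A, A)) ->
  joined X (g s, s) (g t, t).
Proof.
move=> cg h; apply: (@joined_image _ _ setT (fun A => (g A, A))) => //.
- by apply/connected_intervalP => x y _ _ z _.
- by apply: continuous_pair => // x; exact: cvg_id.
Qed.

Variables gm gp : R -> R.
Hypotheses (cgm : continuous gm) (cgp : continuous gp).
Hypothesis gmp : forall A, gm A <= gp A.

Let L : set (R * R) := [set p | gm p.2 <= p.1 <= gp p.2].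

(** At least one of the two edge curves avoids the removed point and serves as a connected spine, to
    which the other points are joined along their rows. *)
Lemma region_minus_point_connected B0 A0 : gm A0 < gp A0 ->
  gm A0 <= B0 -> connected (L `\ (B0, A0)).
Proof.
move=> lt0 ge0; set X := L `\ (B0, A0).
have X1 B A : A != A0 -> gm A <= B <= gp A -> X (B, A).
  by move=> AA0 h; split => // -[_ /eqP]; rewrite (negPf AA0).
have X2 B A : B != B0 -> gm A <= B <= gp A -> X (B, A).
  by move=> BB0 h; split => // -[/eqP]; rewrite (negPf BB0).
have A1 : A0 + 1 != A0 by rewrite -subr_eq0 addrAC subrr add0r oner_eq0.
have Gm A : B0 != gm A0 -> X (gm A, A).
  move=> ne; have [->|ne'] := eqVneq A A0; first by apply: X2; [rewrite eq_sym|rewrite lexx gmp].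
  by apply: X1; rewrite ?lexx ?gmp.
have Gp A : B0 != gp A0 -> X (gp A, A).
  move=> ne; have [->|ne'] := eqVneq A A0.
    by apply: X2; [rewrite eq_sym|rewrite lexx gmp].
  by apply: X1; rewrite ?lexx ?gmp.
have [e|ne] := eqVneq B0 (gm A0).
  have ne : B0 != gp A0 by rewrite e lt_eqF.
  apply: (@joined_connected _ _ (gp 0, 0)) => -[B A] [/= /andP[h1 h2] h3].
  apply: joined_trans (@joined_graph X gp 0 A cgp (fun A => Gp A ne)) _.
  apply: joined_sym; apply: joined_segment => // x /andP[x1 x2].
  have [AA0|] := eqVneq A A0; last first.
    by move=> ?; apply: X1 => //; rewrite x2 andbT (le_trans h1).
  apply: X2; last by rewrite x2 andbT (le_trans h1).
  apply: contra_notN h3 => /eqP xB; rewrite AA0; congr (_, _).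
  by apply: le_anti; rewrite -{1}xB x1 e -AA0.
apply: (@joined_connected _ _ (gm (A0 + 1), A0 + 1)) => -[B A] [/= /andP[h1 h2] h3].
have jm s t := @joined_graph X gm s t cgm (fun A => Gm A ne).
have [AA0|AA0] := eqVneq A A0; last first.
  apply: joined_trans (jm _ A) _; apply: joined_segment => // x /andP[x1 x2].
  by apply: X1 => //; rewrite x1 (le_trans x2).
move: h1 h2 h3; rewrite AA0 => h1 h2 h3.
have [BB0|BB0|BB0] := ltgtP B B0.
- apply: joined_trans (jm _ A0) _; apply: joined_segment => // x /andP[x1 x2].
  by apply: X2; [rewrite lt_eqF// (le_lt_trans x2)|rewrite x1 (le_trans x2)].
(* Here the row to the left is cut by the removed point; the upper edge also avoids that point, and
   the row [A0 + 1] connects the two edges. *)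
- have ne' : B0 != gp A0 by rewrite lt_eqF// (lt_le_trans BB0).
  apply: (@joined_trans _ _ _ (gp (A0 + 1), A0 + 1)).
    by apply: joined_segment => // x; exact: X1.
  apply: joined_trans (@joined_graph X gp _ A0 cgp (fun A => Gp A ne')) _.
  apply: joined_sym; apply: joined_segment => // x /andP[x1 x2].
  by apply: X2; [rewrite gt_eqF// (lt_le_trans BB0)|rewrite x2 andbT (le_trans h1)].
- by case: h3; rewrite BB0.
Qed.

(** The projection to the [A]-axis would be an interval with points on both sides of [A0] but not
    [A0] itself. *)
Lemma pinched_not_connected X B0 A0 : (forall A, exists B, X (B, A)) ->
  (forall B, X (B, A0) -> B = B0) -> ~ connected (X `\ (B0, A0)).
Proof.
move=> Xne pinch cX.
have : connected (snd @` (X `\ (B0, A0))).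
  apply: connected_continuous_connected => //; apply: continuous_subspaceT => x.
  exact: cvg_snd.
move=> /connected_intervalP itv.
have side A : A != A0 -> (snd @` (X `\ (B0, A0))) A.
  move=> AA0; have [B XB] := Xne A; exists (B, A) => //; split => // -[_ /eqP].
  by rewrite (negPf AA0).
have [|||[B A] [XB nB] /= AA0] := itv (A0 - 1) (A0 + 1) _ _ A0.
- by apply: side; rewrite lt_eqF//; lra.
- by apply: side; rewrite gt_eqF//; lra.
- by apply/andP; split; lra.
by apply: nB; rewrite AA0 in XB *; rewrite (pinch _ XB).
Qed.

End PlaneRegion.

(** * Edge curves of functions monotone in one variable *)

Section Edge.
Context {R : realType}.
Variables (h : R -> R -> R) (r : R).
Hypothesis mono : forall A B B', B <= B' -> h B A <= h B' A.
Hypothesis up : forall A B B', r <= h B A -> B < B' -> exists2 d, 0 < d &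
  forall b a, `|B' - b| <= d -> `|A - a| <= d -> r <= h b a.
Hypothesis low_open : forall A B, h B A < r -> exists2 d, 0 < d &
  forall b a, `|B - b| <= d -> `|A - a| <= d -> h b a < r.
Hypothesis lo : forall A, exists B, h B A < r.
Hypothesis hi : forall A, exists B, r <= h B A.

(** By monotonicity each row of the superlevel set is a half-line, closed because of [low_open]; its
    endpoint is [g A]. In the continuity proof [up] bounds [g] from above near [A], and [low_open]
    from below. *)
Lemma edge_exists : exists2 g : R -> R, continuous g & forall A B, r <= h B A <-> g A <= B.
Proof.
pose S A := [set B | r <= h B A].
have lbS A : has_lbound (S A).
  have [B0 hB0] := lo A; exists B0 => B; rewrite /S/= => rB.
  by have [//|/ltW/(mono A)/le_lt_trans/(_ hB0)] := leP B0 B; rewrite ltNge rB.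
have S0 A : S A !=set0 by have [B] := hi A; exists B.
pose g A := inf (S A).
have gP A B : r <= h B A <-> g A <= B.
  split=> [rB|gB]; first by apply: ge_inf.
  rewrite leNgt; apply/negP => hr; have [d d0 dP] := low_open hr.
  have : B + d <= g A.
    apply: lb_le_inf => // B' rB'; rewrite leNgt; apply/negP => B'd.
    have : h (B + d) A < r.
      apply: dP; last by rewrite subrr normr0 ltW.
      by rewrite opprD addrA subrr add0r normrN gtr0_norm.
    by move/(le_lt_trans (mono A (ltW B'd))); rewrite ltNge rB'.
  by rewrite leNgt (le_lt_trans gB)// ltrDl.
exists g => // A; apply/cvgrPdist_lt => e e0.
have e2 : 0 < e / 2 by rewrite divr_gt0.
have h1 : r <= h (g A) A by apply/gP.
have [|d d0 dP] := up (B' := g A + e / 2) h1; first by rewrite ltrDl.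
have h2 : h (g A - e / 2) A < r.
  by rewrite ltNge; apply/negP => /gP; rewrite leNgt ltrBlDr ltrDl e2.
have [c c0 cP] := low_open h2.
near=> a.
have ad : `|A - a| <= Num.min d c.
  near: a; apply: cvgr_dist_le; first exact: cvg_id.
  by rewrite lt_min d0.
have {ad}[ad ac] : `|A - a| <= d /\ `|A - a| <= c by move: ad; rewrite le_min => /andP.
have /gP g1 : r <= h (g A + e / 2) a by apply: dP => //; rewrite subrr normr0 ltW.
have g2 : g A - e / 2 < g a.
  rewrite ltNge; apply/negP => /gP; apply/negP; rewrite -ltNge.
  by apply: cP => //; rewrite subrr normr0 ltW.
by rewrite ltr_norml; apply/andP; split; lra.
Unshelve. all: by end_near. Qed.

End Edge.

(** * Shape and boundary of phase-lock areas *)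

Section PhaseLockAreas.
Context {R : realType}.
Variable om : R.
Hypothesis om0 : 0 < om.
Implicit Types (A B x y : R) (r : int).

Notation sol := (is_solution om).
Notation P := (poincare om).
Let p2 : 0 < 2 * pi :> R := pi2_gt0.

Lemma rho_mono A B B' : B <= B' -> rho om B A <= rho om B' A.
Proof.
move=> BB'; rewrite -subr_le0; apply: (bounded_mul_nat0 (C := 8 * pi / (2 * pi))) => n.
have T0 : 0 <= 2 * pi * n%:R :> R by rewrite mulr_ge0// ltW.
have le0 : flow om B A 0 0 <= flow om B' A 0 0 by rewrite !flow0.
have := sol_le om0 BB' (flow_sol om0 B A 0) (flow_sol om0 B' A 0) le0 T0.
have := rho_bound om0 n (flow_sol om0 B A 0).
have := rho_bound om0 n (flow_sol om0 B' A 0).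
rewrite !flow0// !subr0 !ler_norml => /andP[? ?] /andP[? ?] ?.
by rewrite ler_pdivlMr//; lra.
Qed.

Lemma vfield_bound B A t y :
  `|vfield om B A t y - ell om B| <= om^-1 + `|2 * mu om A|.
Proof.
rewrite /vfield (_ : _ - _ = - (om^-1 * sin y) + 2 * mu om A * cos t); last by ring.
apply: le_trans (ler_normD _ _) _; rewrite normrN !normrM [`|om^-1|]gtr0_norm ?invr_gt0//.
apply: lerD; first by rewrite ler_piMr ?sin_max// invr_ge0 ltW.
by rewrite ler_piMr ?cos_max// mulr_ge0.
Qed.

Lemma rho_small A r : exists B, rho om B A < r%:~R.
Proof.
(* With this [B] the vector field is at most [r - 1] everywhere. *)
exists (om * (r%:~R - 1 - (om^-1 + `|2 * mu om A|))); set B := om * _.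
apply: (rho_lt_all om0) => x.
have [c _ e] := ddt_mvt ((sol_ddt _ _ _ _).1 (flow_sol om0 B A x)) (ltW p2).
move: e; rewrite /= flow0// subr0 -/(P B A x) => e.
have := vfield_bound B A c (flow om B A x c).
have -> : ell om B = r%:~R - 1 - (om^-1 + `|2 * mu om A|).
  by rewrite /ell /B mulrAC divff ?mul1r ?gt_eqF.
rewrite ler_norml => /andP[_ h].
have {h} h : vfield om B A c (flow om B A x c) <= r%:~R - 1 by lra.
have : vfield om B A c (flow om B A x c) * (2 * pi) <= (r%:~R - 1) * (2 * pi) by rewrite ler_pM2r.
by have := p2; lra.
Qed.

Lemma rho_large A r : exists B, r%:~R < rho om B A.
Proof.
exists (om * (r%:~R + 1 + (om^-1 + `|2 * mu om A|))); set B := om * _.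
apply: (rho_gt_all om0) => x.
have [c _ e] := ddt_mvt ((sol_ddt _ _ _ _).1 (flow_sol om0 B A x)) (ltW p2).
move: e; rewrite /= flow0// subr0 -/(P B A x) => e.
have := vfield_bound B A c (flow om B A x c).
have -> : ell om B = r%:~R + 1 + (om^-1 + `|2 * mu om A|).
  by rewrite /ell /B mulrAC divff ?mul1r ?gt_eqF.
rewrite ler_norml => /andP[h _].
have {h} h : r%:~R + 1 <= vfield om B A c (flow om B A x c) by lra.
have : (r%:~R + 1) * (2 * pi) <= vfield om B A c (flow om B A x c) * (2 * pi) by rewrite ler_pM2r.
by have := p2; lra.
Qed.

Lemma level_set_edges r : exists gm gp : R -> R, [/\ continuous gm, continuous gp,
  (forall A B, level_set om r%:~R (B, A) <-> gm A <= B <= gp A) &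
  (forall A, gm A <= gp A)].
Proof.
have [||||gm cgm gmP] := @edge_exists R (rho om) r%:~R _ (fun A B B' h => rho_ge_up om0 h).
- exact: rho_mono.
- move=> A B h; have e0 : 0 < r%:~R - rho om B A by rewrite subr_gt0.
  have [d d0 dP] := rho_continuous om0 B A e0; exists d => // b a hb ha.
  by have := dP b a hb ha; rewrite ltr_norml => /andP[]; lra.
- by move=> A; exact: rho_small.
- by move=> A; have [B /ltW] := rho_large A r; exists B.
(* Reflecting both [B] and [rho] turns the right edge into a left edge. *)
have [|||||gp cgp gpP] := @edge_exists R (fun B A => - rho om (- B) A) (- r%:~R).
- by move=> A B B' BB'; rewrite lerN2 rho_mono// lerN2.
- move=> A B B'; rewrite lerN2 => h BB'; have BB : - B' < - B by rewrite ltrN2.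
  have [d d0 dP] := rho_le_down om0 h BB; exists d => // b a hb ha.
  by rewrite lerN2; apply: dP => //; rewrite -opprD normrN.
- move=> A B; rewrite ltrN2 => h; have e0 : 0 < rho om (- B) A - r%:~R by rewrite subr_gt0.
  have [d d0 dP] := rho_continuous om0 (- B) A e0; exists d => // b a hb ha.
  have hb' : `|- B - - b| <= d by rewrite -opprD normrN.
  by have := dP (- b) a hb' ha; rewrite ltrN2 ltr_norml => /andP[]; lra.
- by move=> A; have [B] := rho_large A r; exists (- B); rewrite opprK ltrN2.
- by move=> A; have [B /ltW] := rho_small A r; exists (- B); rewrite opprK lerN2.
have LP A B : level_set om r%:~R (B, A) <-> gm A <= B <= - gp A.
  rewrite /level_set/=; split=> [e|/andP[/gmP h1 h2]].
    apply/andP; split; first by apply/gmP; rewrite e.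
    by rewrite lerNr; apply/gpP; rewrite opprK e.
  apply: le_anti; rewrite h1 andbT; move: h2; rewrite lerNr => /gpP.
  by rewrite opprK lerN2.
exists gm, (fun A => - gp A); split => //.
  by move=> A; apply: cvgN; exact: cgp.
move=> A; rewrite leNgt; apply/negP => lt0.
have [B /andP[B1 B2]] : exists B, - gp A < B < gm A by exists ((- gp A + gm A) / 2); apply/andP; split; lra.
have : rho om B A < r%:~R by rewrite ltNge; apply/negP => /gmP; rewrite leNgt B2.
have : ~~ (- r%:~R <= - rho om (- - B) A).
  by apply/negP => /gpP; rewrite lerNr leNgt B1.
by rewrite opprK lerN2 -ltNge => /lt_trans h /h; rewrite ltxx.
Qed.

(** If [P] is a translation, any change of [B] moves all points strictly to one side, so [rho] takes
    the value [r] only once in the row. *)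
Lemma adjacency_of_identity B A r : A != 0 -> phase_lock_area om (level_set om r%:~R) ->
  (forall x, P B A x = x + 2 * pi * r%:~R) -> adjacency om (B, A).
Proof.
move=> A0 pla Pid; split => //; exists (level_set om r%:~R) => //; split.
  by apply/(rho_eqP om0); exists 0.
have [gm [gp [cgm cgp LP gmp]]] := level_set_edges r.
apply: pinched_not_connected => [A'|B' LB'].
  by exists (gm A'); apply/LP; rewrite lexx gmp.
have [lt0|lt0|//] := ltgtP B' B.
  have dn x : P B A x <= x + 2 * pi * r%:~R by rewrite Pid.
  by have := rho_decreases om0 dn lt0; rewrite (LB' : rho _ _ _ = _) ltxx.
have up x : x + 2 * pi * r%:~R <= P B A x by rewrite Pid.
by have := rho_increases om0 up lt0; rewrite (LB' : rho _ _ _ = _) ltxx.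
Qed.

Lemma not_adjacency B A B' r : rho om B A = r%:~R -> rho om B' A = r%:~R -> B' != B ->
  ~ adjacency om (B, A).
Proof.
move=> e e' ne [_ [L [[r' ->] _] [Lp]]]; apply.
rewrite -[r']Lp /= e; have [gm [gp [cgm cgp LP gmp]]] := level_set_edges r.
have /LP/andP[h1 h2] : level_set om r%:~R (B, A) by [].
have /LP/andP[h3 h4] : level_set om r%:~R (B', A) by [].
rewrite (_ : level_set om r%:~R = [set p | gm p.2 <= p.1 <= gp p.2]); last first.
  by apply/seteqP; split => -[b a] /LP.
apply: region_minus_point_connected => //.
have [lt0|lt0|] := ltgtP B' B; [lra|lra|by move/eqP; rewrite (negPf ne)].
Qed.

Lemma not_interior_up B A r : (forall x, x + 2 * pi * r%:~R <= P B A x) ->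
  ~ interior (level_set om r%:~R) (B, A).
Proof.
move=> up /nbhs_pair[d d0 dP].
have lt1 : B < B + d / 2 by rewrite ltrDl divr_gt0.
have := rho_increases om0 up lt1.
rewrite (dP (B + d / 2) A) ?ltxx// ?subrr ?normr0//.
by rewrite opprD addrA subrr add0r normrN gtr0_norm ?divr_gt0//; lra.
Qed.

Lemma not_interior_down B A r : (forall x, P B A x <= x + 2 * pi * r%:~R) ->
  ~ interior (level_set om r%:~R) (B, A).
Proof.
move=> up /nbhs_pair[d d0 dP].
have lt1 : B - d / 2 < B by rewrite ltrBlDr ltrDl divr_gt0.
have := rho_decreases om0 up lt1.
rewrite (dP (B - d / 2) A) ?ltxx// ?subrr ?normr0//.
by rewrite opprD addrA subrr add0r opprK gtr0_norm ?divr_gt0//; lra.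
Qed.

(** Together with a fixed point, this is the case of multiplier 1 and nonzero shear; the two
    alternatives are the two signs of the shear. *)
Definition parabolic B A r :=
  ((forall x, x + 2 * pi * r%:~R <= P B A x) /\ exists x, x + 2 * pi * r%:~R < P B A x) \/
  ((forall x, P B A x <= x + 2 * pi * r%:~R) /\ exists x, P B A x < x + 2 * pi * r%:~R).

(** If [P] nowhere falls below the translation, a step to the right leaves the level set. A small
    step to the left keeps some point strictly above and puts the fixed point strictly below, hence
    lands in the interior. So the area has interior, and the row through the point contains a second
    point. *)
Lemma parabolic_boundary B A r : rho om B A = r%:~R -> parabolic B A r ->
  [/\ phase_lock_area om (level_set om r%:~R),
      boundary (level_set om r%:~R) (B, A) & ~ adjacency om (B, A)].
Proof.
move=> e par; have [x0 fx0] := (rho_eqP om0 B A r).1 e.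
suff [[B' BB' intB'] nint] : (exists2 B', B' != B & interior (level_set om r%:~R) (B', A)) /\
    ~ interior (level_set om r%:~R) (B, A).
  split.
  - by split; [exists r%:~R|exists (B', A)].
  - by split => //; apply: subset_closure.
  - by apply: (@not_adjacency B A B' r) => //; exact: (interior_subset intB').
case: par => [[up [x hx]]|[dn [x hx]]].
  split; last exact: not_interior_up.
  have e0 : 0 < P B A x - (x + 2 * pi * r%:~R) by lra.
  have [d d0 dP] := poincare_near om0 B A x e0.
  exists (B - d); first by rewrite lt_eqF// ltrBlDr ltrDl.
  apply: (rho_locally_constant om0).
    exists x; have := dP (B - d) A; rewrite subrr normr0 opprD addrA subrr add0r opprK.
    by rewrite (gtr0_norm d0) lexx (ltW d0) ltr_norml => /(_ isT isT) /andP[]; lra.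
  by exists x0; rewrite -fx0; apply: (poincare_ltB om0); rewrite ltrBlDr ltrDl.
split; last exact: not_interior_down.
have e0 : 0 < (x + 2 * pi * r%:~R) - P B A x by lra.
have [d d0 dP] := poincare_near om0 B A x e0.
exists (B + d); first by rewrite gt_eqF// ltrDl.
apply: (rho_locally_constant om0).
  by exists x0; rewrite -fx0; apply: (poincare_ltB om0); rewrite ltrDl.
exists x; have := dP (B + d) A; rewrite subrr normr0 opprD addrA subrr add0r normrN.
by rewrite (gtr0_norm d0) lexx (ltW d0) ltr_norml => /(_ isT isT) /andP[]; lra.
Qed.

Lemma closure_level_set (r : R) B A : closure (level_set om r) (B, A) -> rho om B A = r.
Proof.
move=> cl; apply: contrapT => /eqP ne.
have e0 : 0 < `|rho om B A - r| by rewrite normr_gt0 subr_eq0.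
have [d d0 dP] := rho_continuous om0 B A e0.
have : nbhs (B, A) [set p | rho om p.1 p.2 != r].
  apply/nbhs_pair; exists d => // b a hb ha; have := dP b a (ltW hb) (ltW ha).
  by apply: contraTneq => /= ->; rewrite ltxx.
by move=> /cl [p [/= h /eqP]]; rewrite h.
Qed.

(** The cases are decided by whether some point is moved by more, and some by less, than [2 pi r]:
    both give an interior point, neither gives a translation and hence an adjacency, and the two
    mixed cases are parabolic. Closedness of level sets identifies [L]. *)
Lemma boundary_parabolic B A r L : A != 0 -> rho om B A = r%:~R ->
  phase_lock_area om L -> boundary L (B, A) -> ~ adjacency om (B, A) -> parabolic B A r.
Proof.
move=> A0 e pla [cl nint] nadj; case: (pla) => -[r' Lr'] _.
have {}Lr' : L = level_set om r%:~R.
  by rewrite Lr' in cl *; have := closure_level_set cl; rewrite e => ->.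
rewrite {}Lr' in pla nint.
have [[up|/forallNP nup] [dn|/forallNP ndn]] :=
  (pselect (exists x, x + 2 * pi * r%:~R < P B A x), pselect (exists x, P B A x < x + 2 * pi * r%:~R)).
- by case: nint; apply: rho_locally_constant.
- by left; split => // x; rewrite leNgt; apply/negP/ndn.
- by right; split => // x; rewrite leNgt; apply/negP/nup.
- case: nadj; apply: (@adjacency_of_identity B A r) => // x; apply: le_anti.
  by rewrite !leNgt; apply/andP; split; apply/negP; [exact: nup|exact: ndn].
Qed.

End PhaseLockAreas.

(** * Complex-valued functions and Fourier coefficients *)

Section ComplexCalculus.
Context {R : realType}.
Local Open Scope complex_scope.
Implicit Types (f g : R -> R[i]) (w : R[i]) (t x M : R) (k : int).

Lemma ReD w1 w2 : Re (w1 + w2) = Re w1 + Re w2 :> R.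
Proof. by case: w1 w2 => ? ? [? ?]. Qed.
Lemma ImD w1 w2 : Im (w1 + w2) = Im w1 + Im w2 :> R.
Proof. by case: w1 w2 => ? ? [? ?]. Qed.
Lemma ReN w : Re (- w) = - Re w :> R. Proof. by case: w. Qed.
Lemma ImN w : Im (- w) = - Im w :> R. Proof. by case: w. Qed.
Lemma ReM w1 w2 : Re (w1 * w2) = Re w1 * Re w2 - Im w1 * Im w2 :> R.
Proof. by case: w1 w2 => ? ? [? ?]. Qed.
Lemma ImM w1 w2 : Im (w1 * w2) = Re w1 * Im w2 + Im w1 * Re w2 :> R.
Proof. by case: w1 w2 => ? ? [? ?]. Qed.
Lemma ReJ w : Re (conjc w) = Re w :> R. Proof. by case: w. Qed.
Lemma ImJ w : Im (conjc w) = - Im w :> R. Proof. by case: w. Qed.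
Lemma complex_eq w1 w2 : Re w1 = Re w2 -> Im w1 = Im w2 -> w1 = w2 :> R[i].
Proof. by case: w1 w2 => ? ? [? ?] /= -> ->. Qed.
Lemma iM : 'i * 'i = -1 :> R[i]. Proof. by rewrite -expr2 sqr_i. Qed.
Lemma conj_i : conjc 'i = - 'i :> R[i].
Proof. by apply: complex_eq => /=; rewrite ?oppr0. Qed.

Definition RI := (ReD, ImD, ReN, ImN, ReM, ImM, ReJ, ImJ).

Lemma conjM w1 w2 : conjc (w1 * w2) = conjc w1 * conjc w2 :> R[i].
Proof. by apply: complex_eq; rewrite !RI; ring. Qed.
Lemma conjB w1 w2 : conjc (w1 - w2) = conjc w1 - conjc w2 :> R[i].
Proof. by apply: complex_eq; rewrite !RI; ring. Qed.
Lemma conjD w1 w2 : conjc (w1 + w2) = conjc w1 + conjc w2 :> R[i].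
Proof. by apply: complex_eq; rewrite !RI; ring. Qed.

Lemma iC_neq0 : 'i != 0 :> R[i].
Proof. by apply/eqP => -[/eqP]; rewrite oner_eq0. Qed.

Lemma realC_eq0 x : (x%:C == 0 :> R[i]) = (x == 0).
Proof. by rewrite eq_complex /= eqxx andbT. Qed.

Definition cddt f f' :=
  ddt (fun t => Re (f t)) (fun t => Re (f' t)) /\
  ddt (fun t => Im (f t)) (fun t => Im (f' t)).

Definition ccont f := continuous (fun t => Re (f t)) /\ continuous (fun t => Im (f t)).

Lemma cddt_ccont f f' : cddt f f' -> ccont f.
Proof. by move=> [/ddt_cont ? /ddt_cont ?]. Qed.

Lemma cddt_eq f f' g g' : cddt f f' -> f =1 g -> f' =1 g' -> cddt g g'.
Proof. by move=> df /funext <- /funext <-. Qed.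
Lemma cddt_eqr f f' g' : cddt f f' -> f' =1 g' -> cddt f g'.
Proof. by move=> df /funext <-. Qed.

Lemma cddt_cst w : cddt (fun=> w) (fun=> 0).
Proof. by split; exact: ddt_cst. Qed.

Lemma cddtD f f' g g' : cddt f f' -> cddt g g' ->
  cddt (fun t => f t + g t) (fun t => f' t + g' t).
Proof.
move=> [a b] [c d]; split.
  by apply: ddt_eq (ddtD a c) _ _ => t; rewrite RI.
by apply: ddt_eq (ddtD b d) _ _ => t; rewrite RI.
Qed.

Lemma cddtN f f' : cddt f f' -> cddt (fun t => - f t) (fun t => - f' t).
Proof.
move=> [a b]; split.
  by apply: ddt_eq (ddtN a) _ _ => t; rewrite RI.
by apply: ddt_eq (ddtN b) _ _ => t; rewrite RI.
Qed.

Lemma cddtB f f' g g' : cddt f f' -> cddt g g' ->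
  cddt (fun t => f t - g t) (fun t => f' t - g' t).
Proof. by move=> df dg; apply: cddtD => //; exact: cddtN. Qed.

Lemma cddtM f f' g g' : cddt f f' -> cddt g g' ->
  cddt (fun t => f t * g t) (fun t => f' t * g t + f t * g' t).
Proof.
move=> [a b] [c d]; split.
  by apply: ddt_eq (ddtB (ddtM a c) (ddtM b d)) _ _ => t; rewrite !RI//; ring.
by apply: ddt_eq (ddtD (ddtM a d) (ddtM b c)) _ _ => t; rewrite !RI//; ring.
Qed.

Lemma cddtZ w f f' : cddt f f' -> cddt (fun t => w * f t) (fun t => w * f' t).
Proof.
by move=> df; apply: cddt_eqr (cddtM (cddt_cst w) df) _ => t; rewrite mul0r add0r.
Qed.

Lemma cddtJ f f' : cddt f f' -> cddt (fun t => conjc (f t)) (fun t => conjc (f' t)).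
Proof.
move=> [a b]; split; first by apply: ddt_eq a _ _ => t; rewrite RI.
by apply: ddt_eq (ddtN b) _ _ => t; rewrite RI.
Qed.

Lemma cddt_real (g g' : R -> R) : ddt g g' -> cddt (fun t => (g t)%:C) (fun t => (g' t)%:C).
Proof. by move=> dg; split => //; exact: ddt_cst. Qed.

Lemma cddt0_cst f : cddt f (fun=> 0) -> forall s t, f s = f t.
Proof.
move=> [a b] s t; apply: complex_eq; [exact: (ddt0_cst a)|exact: (ddt0_cst b)].
Qed.

Lemma ccontD f g : ccont f -> ccont g -> ccont (fun t => f t + g t).
Proof.
move=> [a b] [c d]; split.
  by rewrite (_ : (fun _ => _) = (fun t => Re (f t) + Re (g t)));
    [move=> t; apply: cvgD; [exact: a|exact: c]|apply/funext => t; rewrite RI].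
by rewrite (_ : (fun _ => _) = (fun t => Im (f t) + Im (g t)));
    [move=> t; apply: cvgD; [exact: b|exact: d]|apply/funext => t; rewrite RI].
Qed.

Lemma ccontM f g : ccont f -> ccont g -> ccont (fun t => f t * g t).
Proof.
move=> [a b] [c d]; split.
  rewrite (_ : (fun _ => _) = (fun t => Re (f t) * Re (g t) - Im (f t) * Im (g t)));
    last by apply/funext => t; rewrite RI.
  by move=> t; apply: cvgB; apply: cvgM; [exact: a|exact: c|exact: b|exact: d].
rewrite (_ : (fun _ => _) = (fun t => Re (f t) * Im (g t) + Im (f t) * Re (g t)));
    last by apply/funext => t; rewrite RI.
by move=> t; apply: cvgD; apply: cvgM; [exact: a|exact: d|exact: b|exact: c].
Qed.

Lemma ccont_cst w : ccont (fun=> w).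
Proof. exact: cddt_ccont (cddt_cst w). Qed.

Lemma ccontZ w f : ccont f -> ccont (fun t => w * f t).
Proof. by move=> cf; apply: ccontM => //; exact: ccont_cst. Qed.

Definition cexp w : R[i] := (expR (Re w) * cos (Im w)) +i* (expR (Re w) * sin (Im w)).

Lemma cexpD w1 w2 : cexp (w1 + w2) = cexp w1 * cexp w2.
Proof.
by rewrite /cexp ReD ImD expRD cosD sinD; apply: complex_eq; rewrite !RI/=; ring.
Qed.

Lemma cexp0 : cexp 0 = 1.
Proof. by rewrite /cexp/= expR0 cos0 sin0 mulr0 mulr1. Qed.

Lemma cexp_neq0 w : cexp w != 0.
Proof.
apply/eqP => e; have := cexpD w (- w).
by rewrite subrr cexp0 e mul0r => /eqP; rewrite oner_eq0.
Qed.

Lemma cexpN w : cexp (- w) = (cexp w)^-1.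
Proof.
apply: (mulfI (cexp_neq0 w)).
by rewrite -cexpD subrr cexp0 divff// cexp_neq0.
Qed.

Lemma cexpJ w : cexp (conjc w) = conjc (cexp w).
Proof. by apply: complex_eq; rewrite !RI/= !RI ?cosN ?sinN ?mulrN. Qed.

Lemma cddt_cexp f f' : cddt f f' -> cddt (fun t => cexp (f t)) (fun t => f' t * cexp (f t)).
Proof.
move=> [a b]; have dE := ddt_comp ddt_expR a; split.
  by apply: ddt_eqr (ddtM dE (ddt_comp ddt_cos b)) _ => t; rewrite RI/=; ring.
by apply: ddt_eqr (ddtM dE (ddt_comp ddt_sin b)) _ => t; rewrite RI/=; ring.
Qed.

Lemma ccont_cexp f : ccont f -> ccont (fun t => cexp (f t)).
Proof.
move=> [a b]; split => t; apply: cvgM.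
- by apply: continuous_comp; [exact: a|exact: continuous_expR].
- by apply: continuous_comp; [exact: b|exact: continuous_cos].
- by apply: continuous_comp; [exact: a|exact: continuous_expR].
- by apply: continuous_comp; [exact: b|exact: continuous_sin].
Qed.

Definition cabs w : R := Num.sqrt (Re w ^+ 2 + Im w ^+ 2).

Lemma cabsE w : cabs w = ComplexField.Normc.normc w. Proof. by case: w. Qed.
Lemma cabs_ge0 w : 0 <= cabs w. Proof. exact: sqrtr_ge0. Qed.
Lemma cabsM w1 w2 : cabs (w1 * w2) = cabs w1 * cabs w2.
Proof. by rewrite !cabsE ComplexField.Normc.normcM. Qed.
Lemma cabsD w1 w2 : cabs (w1 + w2) <= cabs w1 + cabs w2.
Proof. by rewrite !cabsE le_normcD. Qed.
Lemma cabs_Re w : `|Re w| <= cabs w.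
Proof. by rewrite /cabs -sqrtr_sqr ler_sqrt ?lerDl ?sqr_ge0// addr_ge0 ?sqr_ge0. Qed.
Lemma cabs_Im w : `|Im w| <= cabs w.
Proof. by rewrite /cabs -sqrtr_sqr ler_sqrt ?lerDr ?sqr_ge0// addr_ge0 ?sqr_ge0. Qed.
Lemma cabs_le w : cabs w <= `|Re w| + `|Im w|.
Proof.
have h : 0 <= `|Re w| + `|Im w| by rewrite addr_ge0.
rewrite -(ger0_norm h) -sqrtr_sqr /cabs ler_sqrt ?sqr_ge0//.
by rewrite -[Re w ^+ 2]real_normK ?num_real// -[Im w ^+ 2]real_normK ?num_real//
  sqrrD -addrA lerD2l lerDr mulrn_wge0// mulr_ge0.
Qed.
Lemma cabs0_eq0 w : cabs w <= 0 -> w = 0.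
Proof.
move=> h; apply: complex_eq; apply/eqP; rewrite -normr_le0.
  exact: le_trans (cabs_Re w) h.
exact: le_trans (cabs_Im w) h.
Qed.
Lemma cabs_cexp w : cabs (cexp w) = expR (Re w).
Proof.
by rewrite /cabs /= !exprMn -mulrDr cos2Dsin2 mulr1 sqrtr_sqr ger0_norm ?expR_ge0.
Qed.
Lemma cabs_real x : cabs (x%:C) = `|x|.
Proof. by rewrite /cabs/= expr0n/= addr0 sqrtr_sqr. Qed.
Lemma cabs_i : cabs 'i = 1. Proof. by rewrite /cabs/= expr0n expr1n add0r sqrtr1. Qed.
Lemma cabsN1 : cabs (-1) = 1.
Proof. by rewrite /cabs/= oppr0 expr0n/= addr0 sqrrN expr1n sqrtr1. Qed.

Definition zk k t := cexp ('i * (k%:~R * t)%:C).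

Lemma zkE k t : zk k t = cos (k%:~R * t) +i* sin (k%:~R * t).
Proof. by rewrite /zk /cexp !RI/= mul0r mul1r sub0r oppr0 expR0 !mul1r mulr0 add0r. Qed.

Lemma zkD k m t : zk (k + m) t = zk k t * zk m t.
Proof. by rewrite -cexpD -mulrDr -rmorphD -mulrDl -intrD. Qed.

Lemma zk0 t : zk 0 t = 1.
Proof. by rewrite /zk mul0r mulr0 cexp0. Qed.

Lemma zkJ k t : conjc (zk k t) = zk (- k) t.
Proof. by rewrite !zkE mulrNz mulNr cosN sinN. Qed.

Lemma zkn (n : nat) t : zk n t = zk 1 t ^+ n.
Proof. by elim: n => [|n IH]; rewrite ?zk0// exprS -IH -zkD -intS. Qed.

Lemma cabs_zk k t : cabs (zk k t) = 1.
Proof. by rewrite cabs_cexp !RI/= mul0r mul1r subr0 expR0. Qed.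

Lemma zk_end k : zk k (2 * pi) = 1.
Proof.
rewrite zkE mulrC -[2 * pi * _]add0r sinD2pi_int cosD2pi_int.
by rewrite cos0 sin0.
Qed.

Lemma zk_start k : zk k 0 = 1.
Proof. by rewrite /zk mulr0 mulr0 cexp0. Qed.

Lemma cddt_zk k : cddt (zk k) (fun t => 'i * (k%:~R)%:C * zk k t).
Proof.
apply: cddt_eqr (cddt_cexp (cddtZ 'i (cddt_real (ddtZ k%:~R ddt_id)))) _ => t.
by rewrite mulr1.
Qed.

Lemma ccont_zk k : ccont (zk k). Proof. exact: cddt_ccont (cddt_zk k). Qed.

Lemma ccont_bounded f : ccont f -> exists2 M, 0 <= M &
  forall t, 0 <= t <= 2 * pi -> cabs (f t) <= M.
Proof.
have H (g : R -> R) : continuous g -> exists2 M, 0 <= M &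
    forall t, 0 <= t <= 2 * pi -> `|g t| <= M.
  move=> cg; have [|x1 _ h1] := @EVT_max R (fun t => `|g t|) 0 (2 * pi) (ltW pi2_gt0).
    by apply: continuous_subspaceT => x; apply: cvg_norm; exact: cg.
  by exists `|g x1| => // t tin; apply: h1; rewrite in_itv.
move=> [/H[M M0 hM] /H[N N0 hN]]; exists (M + N); first exact: addr_ge0.
by move=> t tin; apply: le_trans (cabs_le _) _; apply: lerD; [exact: hM|exact: hN].
Qed.

Lemma cprimitive f : ccont f -> exists F, cddt F f.
Proof.
move=> [/primitive_exists[F dF _] /primitive_exists[G dG _]].
by exists (fun t => F t +i* G t).
Qed.

(** The integral over [[0, 2 pi]] as the increment of any primitive, with default 0 when none
    exists; most rules thereby reduce to rules for derivatives. *)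
Definition cint f : R[i] := xget 0 [set v | exists F, cddt F f /\ v = F (2 * pi) - F 0].

Lemma cintE F f : cddt F f -> cint f = F (2 * pi) - F 0.
Proof.
move=> dF; rewrite /cint.
have [G [dG ->]] := @xgetI _ 0 [set v | exists F, cddt F f /\ v = F (2 * pi) - F 0]
  (F (2 * pi) - F 0) (ex_intro _ F (conj dF erefl)).
have d0 : cddt (fun t => G t - F t) (fun=> 0).
  by apply: cddt_eqr (cddtB dG dF) _ => t; rewrite subrr.
have := cddt0_cst d0 (2 * pi) 0 => /eqP; rewrite -subr_eq0 => /eqP e.
by apply/eqP; rewrite -subr_eq0 -[X in _ == X]e; apply/eqP; ring.
Qed.

Lemma cintD f g : ccont f -> ccont g -> cint (fun t => f t + g t) = cint f + cint g.
Proof.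
move=> /cprimitive[F dF] /cprimitive[G dG].
by rewrite (cintE (cddtD dF dG)) (cintE dF) (cintE dG); ring.
Qed.

Lemma cintZ w f : ccont f -> cint (fun t => w * f t) = w * cint f.
Proof.
by move=> /cprimitive[F dF]; rewrite (cintE (cddtZ w dF)) (cintE dF); ring.
Qed.

Lemma cintJ f : ccont f -> cint (fun t => conjc (f t)) = conjc (cint f).
Proof.
by move=> /cprimitive[F dF]; rewrite (cintE (cddtJ dF)) (cintE dF) conjB.
Qed.

Lemma cint0 : cint (fun=> 0) = 0.
Proof. by rewrite (cintE (cddt_cst 0)) subrr. Qed.

Lemma cint_ext f g : f =1 g -> cint f = cint g.
Proof. by move=> /funext ->. Qed.

Lemma ccont_sum n (F : 'I_n -> R -> R[i]) : (forall i, ccont (F i)) ->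
  ccont (fun t => \sum_i F i t).
Proof.
elim: n F => [|n IH] F cF.
  rewrite (_ : (fun _ => _) = fun=> 0); first exact: ccont_cst.
  by apply/funext => t; rewrite big_ord0.
rewrite (_ : (fun _ => _) = fun t => F ord0 t + \sum_i F (lift ord0 i) t).
  by apply: ccontD => //; exact: IH.
by apply/funext => t; rewrite big_ord_recl.
Qed.

Lemma cint_sum n (F : 'I_n -> R -> R[i]) : (forall i, ccont (F i)) ->
  cint (fun t => \sum_i F i t) = \sum_i cint (F i).
Proof.
elim: n F => [|n IH] F cF.
  by rewrite big_ord0 (@cint_ext _ (fun=> 0)) ?cint0// => t; rewrite big_ord0.
rewrite big_ord_recl -IH// -cintD//; last exact: ccont_sum.
by apply: cint_ext => t; rewrite big_ord_recl.
Qed.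

Lemma Re_cint_le f g : ccont f -> ccont g ->
  (forall t, 0 <= t <= 2 * pi -> Re (f t) <= Re (g t)) -> Re (cint f) <= Re (cint g).
Proof.
move=> /cprimitive[F dF] /cprimitive[G dG] h; rewrite (cintE dF) (cintE dG).
have [d _] := cddtB dG dF.
rewrite -subr_ge0; have := ddt_le d (ltW pi2_gt0); rewrite !RI => hh.
suff : Re (G 0) - Re (F 0) <= Re (G (2 * pi)) - Re (F (2 * pi)) by lra.
by apply: hh => t tin; rewrite !RI subr_ge0; exact: h.
Qed.

(** The mean value theorem holds only for the real and imaginary parts separately, hence [4 pi] in
    place of [2 pi]. *)
Lemma cabs_increment (f f' : R -> R[i]) C s t : cddt f f' -> 0 <= s <= 2 * pi ->
  0 <= t <= 2 * pi -> (forall t, 0 <= t <= 2 * pi -> cabs (f' t) <= C) ->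
  cabs (f t - f s) <= 4 * pi * C.
Proof.
move=> [d1 d2] sin tin hC.
have H (g g' : R -> R) : ddt g g' -> (forall t, 0 <= t <= 2 * pi -> `|g' t| <= C) ->
    `|g t - g s| <= 2 * pi * C.
  move=> dg hg.
  have main x y : 0 <= x -> y <= 2 * pi -> x <= y -> `|g y - g x| <= 2 * pi * C.
    move=> x0 y2 xy; have [c /andP[xc cy] ->] := ddt_mvt dg xy.
    have cin : 0 <= c <= 2 * pi by rewrite (le_trans x0 xc) (le_trans cy).
    rewrite normrM mulrC; apply: ler_pM => //; last exact: hg.
    by rewrite ger0_norm ?subr_ge0//; lra.
  move: sin tin => /andP[s0' s2] /andP[t0 t2].
  by have [|/ltW] := leP s t; [exact: main|rewrite distrC; exact: main].
have h1 := H _ _ d1 (fun t tin => le_trans (cabs_Re _) (hC t tin)).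
have h2 := H _ _ d2 (fun t tin => le_trans (cabs_Im _) (hC t tin)).
apply: le_trans (cabs_le _) _; rewrite !RI; apply: le_trans (lerD h1 h2) _.
by rewrite le_eqVlt; apply/orP; left; apply/eqP; ring.
Qed.

Lemma cabs_cint_le f M : ccont f -> (forall t, 0 <= t <= 2 * pi -> cabs (f t) <= M) ->
  cabs (cint f) <= 4 * pi * M.
Proof.
move=> /cprimitive[F dF] h; rewrite (cintE dF).
by apply: (cabs_increment dF) h; rewrite lexx ltW// pi2_gt0.
Qed.

(** Not normalized: [2 pi] times the usual Fourier coefficient. *)
Definition fcoef k f := cint (fun t => f t * zk (- k) t).

Lemma fcoef_ext k f g : f =1 g -> fcoef k f = fcoef k g.
Proof. by move=> /funext ->. Qed.

Lemma fcoefD k f g : ccont f -> ccont g -> fcoef k (fun t => f t + g t) = fcoef k f + fcoef k g.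
Proof.
move=> cf cg; rewrite /fcoef -cintD.
- by apply: cint_ext => t; rewrite mulrDl.
- by apply: ccontM => //; exact: ccont_zk.
- by apply: ccontM => //; exact: ccont_zk.
Qed.

Lemma fcoefZ k w f : ccont f -> fcoef k (fun t => w * f t) = w * fcoef k f.
Proof.
move=> cf; rewrite /fcoef -cintZ; last by apply: ccontM => //; exact: ccont_zk.
by apply: cint_ext => t; rewrite mulrA.
Qed.

Lemma fcoef_sum k n (F : 'I_n -> R -> R[i]) : (forall i, ccont (F i)) ->
  fcoef k (fun t => \sum_i F i t) = \sum_i fcoef k (F i).
Proof.
move=> cF; rewrite /fcoef -cint_sum; last by move=> i; apply: ccontM => //; exact: ccont_zk.
by apply: cint_ext => t; rewrite mulr_suml.
Qed.

Lemma fcoef_zkM k m f : fcoef k (fun t => zk m t * f t) = fcoef (k - m) f.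
Proof.
by apply: cint_ext => t; rewrite opprB zkD mulrAC [RHS]mulrC.
Qed.

Lemma fcoefJ k f : ccont f -> fcoef k (fun t => conjc (f t)) = conjc (fcoef (- k) f).
Proof.
move=> cf; rewrite /fcoef -cintJ; last by apply: ccontM => //; exact: ccont_zk.
by apply: cint_ext => t; rewrite conjM zkJ !opprK.
Qed.

Lemma fcoef_ddt k f f' : cddt f f' -> ccont f' -> f (2 * pi) = f 0 ->
  fcoef k f' = 'i * (k%:~R)%:C * fcoef k f.
Proof.
move=> df cf' per; have d := cddtM df (cddt_zk (- k)).
have := cintE d; rewrite zk_end zk_start per subrr.
rewrite cintD; last 2 first.
- by apply: ccontM => //; exact: ccont_zk.
- apply: ccontM; first exact: cddt_ccont df.
  by apply: ccontM; [exact: ccont_cst|exact: ccont_zk].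
move=> /eqP; rewrite addr_eq0 => /eqP e; rewrite {1}/fcoef e.
rewrite /fcoef -cintZ; last first.
  by apply: ccontM; [exact: cddt_ccont df|exact: ccont_zk].
rewrite -mulN1r -cintZ; last first.
  apply: ccontM; first exact: cddt_ccont df.
  by apply: ccontM; [exact: ccont_cst|exact: ccont_zk].
by apply: cint_ext => t; rewrite mulrNz rmorphN; ring.
Qed.

Lemma fcoef_zk k m : fcoef k (zk m) = if k == m then (2 * pi)%:C else 0.
Proof.
rewrite /fcoef; have [->|km] := eqVneq k m.
  rewrite (@cint_ext _ (fun=> 1)); last by move=> t; rewrite -zkD subrr zk0.
  rewrite (cintE (cddt_real ddt_id)) /= -rmorphB subr0 //.
rewrite (@cint_ext _ (zk (m - k))); last by move=> t; rewrite -zkD.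
have mk0 : 'i * ((m - k)%:~R)%:C != 0 :> R[i].
  by rewrite mulf_neq0 ?iC_neq0// realC_eq0 intr_eq0 subr_eq0 eq_sym.
have := cintE (cddt_zk (m - k)); rewrite zk_end zk_start subrr cintZ; last exact: ccont_zk.
by move=> /eqP; rewrite mulf_eq0 (negPf mk0) => /eqP.
Qed.

Lemma cabs_fcoef_le k f M : ccont f -> (forall t, 0 <= t <= 2 * pi -> cabs (f t) <= M) ->
  cabs (fcoef k f) <= 4 * pi * M.
Proof.
move=> cf h; apply: cabs_cint_le; first by apply: ccontM => //; exact: ccont_zk.
by move=> t tin; rewrite cabsM cabs_zk mulr1; exact: h.
Qed.

End ComplexCalculus.

(** * Linear differential inequalities and quadratic remainders *)

Section Growth.
Context {R : realType}.
Implicit Types (x t s e C M X : R).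

Lemma ddtX n : ddt (fun t : R => t ^+ n.+1) (fun t => n.+1%:R * t ^+ n).
Proof.
elim: n => [|n IH]; first by apply: ddt_eqr ddt_id _ => t; rewrite expr0 mulr1.
apply: ddt_eq (ddtM ddt_id IH) _ _ => t; first by rewrite [RHS]exprS.
by rewrite exprS -[n.+2]addn1 natrD; ring.
Qed.

Lemma pow_fact_small x e : 0 < e -> exists n, `|x ^+ n / n`!%:R| < e.
Proof.
move=> e0; have := cvg_series_cvg_0 (is_cvg_series_exp_coeff x).
move=> /cvgr0Pnorm_lt/(_ e e0)[n _ /(_ n (leqnn n))] h.
by exists n; move: h; rewrite /exp_coeff.
Qed.

Lemma sign_ge (b : bool) (u v : R) : `|u| <= v -> - v <= (-1) ^+ b * u.
Proof. by rewrite -(normrMsign b u) ler_norml => /andP[]. Qed.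

(** Each integration improves the common lower bound, from [- C] to [- C (M s)^n / n!], which tends
    to 0. The index set may be infinite, so the lemma covers systems in which every derivative
    involves further unknowns; applied to both signs of the unknowns it shows that they vanish. *)
Lemma growth_pos (I : Type) (y y' : I -> R -> R) X C M : 0 <= M ->
  (forall i, ddt (y i) (y' i)) -> (forall i, 0 <= y i 0) ->
  (forall i s, 0 <= s <= X -> - C <= y i s) ->
  (forall i s b, 0 <= s <= X -> 0 <= b -> (forall j, - b <= y j s) -> - (M * b) <= y' i s) ->
  forall i s, 0 <= s <= X -> 0 <= y i s.
Proof.
move=> M0 dy y0 yC y'M.
have [[i0 [s0 s0X]]|none] := pselect (exists i : I, exists s, 0 <= s <= X); last first.
  by move=> i s h; exfalso; apply: none; exists i, s.
pose C' := Num.max C 0.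
have C'0 : 0 <= C' by rewrite le_max lexx orbT.
have step n i s : 0 <= s <= X -> - (C' * (M ^+ n * (s ^+ n / n`!%:R))) <= y i s.
  elim: n i s => [|n IH] i s /andP[sp sX].
    rewrite !expr0 fact0 divr1 !mulr1; apply: le_trans (yC i s _); last by rewrite sp.
    by rewrite lerN2 le_max lexx.
  pose c := C' * M ^+ n.+1 / n.+1`!%:R.
  have d := ddtD (dy i) (ddtZ c (ddtX n)).
  suff : y i 0 + c * 0 ^+ n.+1 <= y i s + c * s ^+ n.+1.
    rewrite expr0n mulr0 addr0 => h; have := le_trans (y0 i) h; rewrite /c.
    by rewrite -subr_ge0 => hh; rewrite -subr_ge0; move: hh; congr (_ <= _); ring.
  apply: (ddt_le d sp) => u /andP[u0 us].
  have uX : 0 <= u <= X by rewrite u0 (le_trans us).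
  have := y'M i u (C' * (M ^+ n * (u ^+ n / n`!%:R))) uX.
  have b0 : 0 <= C' * (M ^+ n * (u ^+ n / n`!%:R)).
    by rewrite mulr_ge0// mulr_ge0 ?exprn_ge0// divr_ge0// exprn_ge0.
  move=> /(_ b0 (fun j => IH j u uX)).
  rewrite -subr_ge0 => hh; move: hh; congr (_ <= _); rewrite opprK; congr (_ + _).
  have : n.+1%:R != 0 :> R by rewrite pnatr_eq0.
  have : n`!%:R != 0 :> R by rewrite pnatr_eq0 -lt0n fact_gt0.
  rewrite /c factS natrM exprS; move: (n.+1%:R : R) (n`!%:R : R) => p q q0 p0.
  by field; rewrite p0 q0.
move=> i s sX; rewrite leNgt; apply/negP => ylt0.
have [C'z|C'p] := eqVneq C' 0.
  by have := step 0%N i s sX; rewrite C'z mul0r oppr0 leNgt ylt0.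
have e0 : 0 < - y i s / C' by rewrite divr_gt0 ?oppr_gt0// lt_neqAle eq_sym C'p.
have [n] := pow_fact_small (M * s) e0.
rewrite ltr_pdivlMr; last by rewrite lt_neqAle eq_sym C'p.
have := step n i s sX.
have := ler_norm ((M * s) ^+ n / n`!%:R); rewrite exprMn -mulrA => h1 h2 h3.
have : M ^+ n * (s ^+ n / n`!%:R) * C' <= `|M ^+ n * (s ^+ n / n`!%:R)| * C'.
  by rewrite ler_wpM2r.
by move: h2 h3; rewrite [C' * _]mulrC; lra.
Qed.

Lemma taylor2 (f f1 f2 : R -> R) x h C : ddt f f1 -> ddt f1 f2 ->
  (forall s, `|s - x| <= `|h| -> `|f2 s| <= C) ->
  `|f (x + h) - f x - h * f1 x| <= C * h ^+ 2.
Proof.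
move=> d1 d2 hC.
have mvt (g g1 : R -> R) a b : ddt g g1 -> exists c, `|c - a| <= `|b - a| /\ g b - g a = g1 c * (b - a).
  move=> dg; have [ab|/ltW ba] := leP a b.
    have [c /andP[ac cb] e] := ddt_mvt dg ab; exists c; split => //.
    by rewrite !ger0_norm; lra.
  have [c /andP[ac cb] e] := ddt_mvt dg ba; exists c; split; last by lra.
  by rewrite !ler0_norm; lra.
have [c [ch e1]] := mvt f f1 x (x + h) d1.
have [c' [ch' e2]] := mvt f1 f2 x c d2.
move: ch e1; rewrite (_ : x + h - x = h); last by ring.
move=> ch e1; rewrite e1 (_ : _ - _ = (f1 c - f1 x) * h); last by ring.
rewrite e2 !normrM -mulrA -[h ^+ 2]real_normK ?num_real// expr2.
apply: ler_pM => //.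
  by apply: hC; exact: le_trans ch.
by rewrite ler_pM.
Qed.

Lemma is_derive_quadratic (f : R -> R) x d C :
  (forall h, `|h| <= 1 -> `|f (x + h) - f x - h * d| <= C * h ^+ 2) ->
  is_derive x (1 : R) f d.
Proof.
move=> fC.
have C0 : 0 <= C by have := le_trans (normr_ge0 _) (fC 1 _); rewrite normr1 lexx expr1n mulr1 => ->.
suff cv : (fun h => h^-1 *: (f (h *: (1 : R) + x) - f x)) @ 0^' --> d.
  apply: DeriveDef; first by apply/cvg_ex; exists d.
  exact: cvg_lim cv.
apply/cvgrPdist_le => e e0; near=> h.
have h0 : h != 0 by near: h; exact: nbhs_dnbhs_neq.
have hlt : `|h| <= Num.min 1 (e / (C + 1)).
  near: h; apply: nbhs_dnbhs; near=> h.
  rewrite -[h]subr0 -normrN opprB; near: h; apply: cvgr_dist_le; first exact: cvg_id.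
  by rewrite lt_min ltr01 divr_gt0// ltr_wpDl.
move: hlt; rewrite le_min => /andP[h1 he].
have := fC h h1; rewrite [x + h]addrC => hb.
rewrite {1}/GRing.scale/= {1}/GRing.scale/= mulr1.
rewrite (_ : d - _ = - (h^-1 * (f (h + x) - f x - h * d))); last by field.
rewrite normrN normrM normfV mulrC ler_pdivrMr ?normr_gt0//.
apply: le_trans hb _; rewrite -[h ^+ 2]real_normK ?num_real// expr2 mulrA.
rewrite ler_wpM2r//; apply: le_trans (_ : (C + 1) * `|h| <= _).
  by rewrite ler_wpM2r// lerDl.
by rewrite mulrC -ler_pdivlMr// ltr_wpDl.
Unshelve. all: by end_near. Qed.

End Growth.

(** * Integrals depending on a parameter *)

Section ParametricIntegral.
Context {R : realType}.
Local Open Scope complex_scope.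
Implicit Types (f q : R -> R[i]) (x t : R).

(** A locally uniform bound on the second parameter derivative makes the Taylor remainder quadratic
    uniformly in [t], so it remains quadratic after integration. *)
Lemma cddt_cint (G G1 G2 : R -> R -> R[i]) :
  (forall t, cddt (G ^~ t) (G1 ^~ t)) -> (forall t, cddt (G1 ^~ t) (G2 ^~ t)) ->
  (forall x, ccont (G x)) -> (forall x, ccont (G1 x)) ->
  (forall x0, exists C, forall x t, `|x - x0| <= 1 -> 0 <= t <= 2 * pi -> cabs (G2 x t) <= C) ->
  cddt (fun x => cint (G x)) (fun x => cint (G1 x)).
Proof.
move=> d1 d2 cG cG1 bd.
have main x : exists C, forall h, `|h| <= 1 ->
    cabs (cint (G (x + h)) - cint (G x) - h%:C * cint (G1 x)) <= C * h ^+ 2.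
  have [C hC] := bd x; exists (4 * pi * (2 * C)) => h h1.
  have -> : cint (G (x + h)) - cint (G x) - h%:C * cint (G1 x) =
      cint (fun t => G (x + h) t + (-1 * G x t + - h%:C * G1 x t)).
    rewrite cintD//; last by apply: ccontD; exact: ccontZ.
    rewrite cintD ?cintZ//; [|exact: ccontZ..].
    by rewrite mulN1r mulNr addrA.
  rewrite -mulrA; apply: cabs_cint_le.
    apply: ccontD => //; apply: ccontD; exact: ccontZ.
  move=> t tin; apply: le_trans (cabs_le _) _.
  have [a1 b1] := d1 t; have [a2 b2] := d2 t.
  have hb (s : R) : `|s - x| <= `|h| -> cabs (G2 s t) <= C.
    by move=> sx; apply: hC => //; exact: le_trans h1.
  have t1 := taylor2 a1 a2 (fun s sx => le_trans (cabs_Re _) (hb s sx)).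
  have t2 := taylor2 b1 b2 (fun s sx => le_trans (cabs_Im _) (hb s sx)).
  rewrite (_ : 2 * C * h ^+ 2 = C * h ^+ 2 + C * h ^+ 2); last by ring.
  apply: lerD; [move: t1|move: t2]; congr (`|_| <= _); rewrite !RI/=; ring.
have RC (h : R) (w : R[i]) : Re (h%:C * w) = h * Re w /\ Im (h%:C * w) = h * Im w.
  by rewrite !RI/= !mul0r subr0 addr0.
split => x; have [C hC] := main x; apply: (@is_derive_quadratic _ _ _ _ C) => h h1.
  apply: le_trans (hC h h1); apply: le_trans (cabs_Re _); rewrite 2!ReD 2!ReN.
  by have [-> _] := RC h (cint (G1 x)).
apply: le_trans (hC h h1); apply: le_trans (cabs_Im _); rewrite 2!ImD 2!ImN.
by have [_ ->] := RC h (cint (G1 x)).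
Qed.

Lemma cabs_cexp_le q M x X : (forall t, 0 <= t <= 2 * pi -> cabs (q t) <= M) -> `|x| <= X ->
  0 <= M -> forall t, 0 <= t <= 2 * pi -> cabs (cexp (x%:C * q t)) <= expR (X * M).
Proof.
move=> qM xX M0 t tin; rewrite cabs_cexp ler_expR; apply: le_trans (ler_norm _) _.
apply: le_trans (cabs_Re _) _; rewrite cabsM cabs_real ler_pM ?cabs_ge0//.
exact: qM.
Qed.

Lemma cddt_cint_cexp f q : ccont f -> ccont q ->
  cddt (fun x => cint (fun t => f t * cexp (x%:C * q t)))
       (fun x => cint (fun t => f t * q t * cexp (x%:C * q t))).
Proof.
move=> cf cq; have cE x : ccont (fun t => cexp (x%:C * q t)).
  by apply: ccont_cexp; exact: ccontZ.
have dE (w v : R[i]) : cddt (fun x => w * cexp (x%:C * v)) (fun x => w * v * cexp (x%:C * v)).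
  have dl := cddtM (cddt_real (@ddt_id R)) (cddt_cst v).
  by apply: cddt_eqr (cddtZ w (cddt_cexp dl)) _ => x; ring.
apply: (@cddt_cint _ _ (fun x t => f t * q t * q t * cexp (x%:C * q t))).
- by move=> t; exact: dE.
- by move=> t; exact: dE.
- by move=> x; exact: ccontM.
- by move=> x; apply: ccontM => //; exact: ccontM.
move=> x0; have [Mf Mf0 hf] := ccont_bounded cf; have [Mq Mq0 hq] := ccont_bounded cq.
exists (Mf * Mq * Mq * expR ((`|x0| + 1) * Mq)) => x t xx0 tin.
rewrite !cabsM; apply: ler_pM; rewrite ?mulr_ge0 ?cabs_ge0//.
  by apply: ler_pM; rewrite ?mulr_ge0 ?cabs_ge0 ?hq//; apply: ler_pM; rewrite ?cabs_ge0 ?hf ?hq.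
apply: (@cabs_cexp_le q) => //.
rewrite (_ : x = x0 + (x - x0)); last by ring.
by apply: le_trans (ler_normD _ _) _; rewrite lerD2l.
Qed.

(** This stands in for multiplying a Fourier series by an exponential series. Scale the exponent by
    [x]: the coefficients [H n] at the indices [k - s n] satisfy [H n' = c * H n.+1], vanish at
    [x = 0] and are uniformly bounded on [[0, 1]], so they vanish at [x = 1]. *)
Lemma fcoef_cexp_mul (c : R[i]) (s k : int) f : ccont f ->
  (forall n : nat, fcoef (k - s * n%:Z) f = 0) ->
  fcoef k (fun t => cexp (c * zk s t) * f t) = 0.
Proof.
move=> cf f0.
pose q t := c * zk s t.
have cq : ccont q by apply: ccontM; [exact: ccont_cst|exact: ccont_zk].
pose H (n : nat) x := cint (fun t => f t * zk (- (k - s * n%:Z)) t * cexp (x%:C * q t)).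
have cfz n : ccont (fun t => f t * zk (- (k - s * n%:Z)) t).
  by apply: ccontM => //; exact: ccont_zk.
have cE x : ccont (fun t => cexp (x%:C * q t)).
  by apply: ccont_cexp; exact: ccontZ.
have dH n : cddt (H n) (fun x => c * H n.+1 x).
  apply: cddt_eqr (cddt_cint_cexp (cfz n) cq) _ => x.
  rewrite -cintZ; last exact: ccontM.
  apply: cint_ext => t; rewrite /q.
  have -> : - (k - s * n.+1%:Z) = - (k - s * n%:Z) + s by rewrite intS; ring.
  by rewrite zkD; ring.
have H0 n : H n 0 = 0.
  rewrite -[RHS](f0 n); apply: cint_ext => t.
  by rewrite mul0r cexp0 mulr1.
have [Mf Mf0 hf] := ccont_bounded cf; have [Mq Mq0 hq] := ccont_bounded cq.
pose C := 4 * pi * (Mf * expR (1 * Mq)).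
have HC n x : 0 <= x <= 1 -> cabs (H n x) <= C.
  move=> /andP[x0 x1]; apply: cabs_cint_le; first exact: ccontM.
  move=> t tin; rewrite !cabsM cabs_zk mulr1; apply: ler_pM; rewrite ?cabs_ge0 ?hf//.
  by apply: (@cabs_cexp_le q) => //; rewrite ger0_norm.
(* The two booleans select a sign and the real or imaginary part, so nonnegativity of the whole
   family means that every [H n] vanishes. *)
pose y (i : nat * (bool * bool)) x :=
  (-1) ^+ i.2.1 * (if i.2.2 then Re (H i.1 x) else Im (H i.1 x)).
pose y' (i : nat * (bool * bool)) x :=
  (-1) ^+ i.2.1 * (if i.2.2 then Re (c * H i.1.+1 x) else Im (c * H i.1.+1 x)).
pose M := `|Re c| + `|Im c|.
have ypos : forall i x, 0 <= x <= 1 -> 0 <= y i x.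
  apply: (@growth_pos R _ y y' 1 C M); first by rewrite addr_ge0.
  - move=> [n [b1 b2]]; rewrite /y /y' /=; have [d1 d2] := dH n.
    by case: b2; apply: ddtZ.
  - by move=> [n [b1 b2]]; rewrite /y/= H0 if_same mulr0.
  - move=> [n [b1 b2]] x xin; rewrite /y/=; apply: sign_ge.
    by case: b2; apply: le_trans (HC n x xin); [exact: cabs_Re|exact: cabs_Im].
  move=> [n [b1 b2]] x b xin b0 hb; rewrite /y'/=; apply: sign_ge.
  have hR : `|Re (H n.+1 x)| <= b.
    have := hb (n.+1, (false, true)); have := hb (n.+1, (true, true)).
    by rewrite /y/= expr0 expr1 mul1r mulN1r ler_norml => ? ?; apply/andP; split; lra.
  have hI : `|Im (H n.+1 x)| <= b.
    have := hb (n.+1, (false, false)); have := hb (n.+1, (true, false)).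
    by rewrite /y/= expr0 expr1 mul1r mulN1r ler_norml => ? ?; apply/andP; split; lra.
  case: b2; rewrite !RI.
    apply: le_trans (ler_normB _ _) _; rewrite !normrM mulrDl.
    by apply: lerD; rewrite ler_wpM2l.
  apply: le_trans (ler_normD _ _) _; rewrite !normrM mulrDl.
  by apply: lerD; rewrite ler_wpM2l.
have one : 0 <= (1 : R) <= 1 by rewrite ler01 lexx.
have -> : fcoef k (fun t => cexp (c * zk s t) * f t) = H 0%N 1.
  by apply: cint_ext => t; rewrite mulr0 subr0 mul1r /q; ring.
have p1 := ypos (0%N, (false, true)) 1 one; have p2 := ypos (0%N, (true, true)) 1 one.
have p3 := ypos (0%N, (false, false)) 1 one; have p4 := ypos (0%N, (true, false)) 1 one.
rewrite /y/= expr0 expr1 ?mul1r ?mulN1r in p1 p2 p3 p4.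
by apply: complex_eq => /=; apply/eqP; rewrite eq_le; apply/andP; split; lra.
Qed.

End ParametricIntegral.

(** * Completeness of Fourier coefficients *)

Section Completeness.
Context {R : realType}.
Local Open Scope complex_scope.
Implicit Types (f : R -> R[i]) (t e : R).

(** Near [t0] continuity gives [e]; elsewhere in the period [1 - cos (t - t0)] is bounded below by a
    positive constant, because [t0] is interior and the distance to [t0] stays away from [2 pi]. *)
Lemma peak_bound (g : R -> R) t0 e : continuous g -> 0 < t0 < 2 * pi -> 0 < e ->
  exists2 M, 0 <= M & forall t, 0 <= t <= 2 * pi -> `|g t - g t0| <= e + M * (1 - cos (t - t0)).
Proof.
move=> cg /andP[t00 t02] e0.
have [d1 d10 d1P] : exists2 d, 0 < d & forall t, `|t0 - t| < d -> `|g t - g t0| <= e.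
  have /cvgrPdist_le/(_ e e0) : g @ t0 --> g t0 by exact: cg.
  move=> /nbhs_ballP[d /= d0 dP]; exists d => // t td; rewrite distrC.
  exact: dP.
pose d := Num.min d1 (Num.min t0 (Num.min (2 * pi - t0) pi)).
have d0 : 0 < d by rewrite !lt_min d10 t00 subr_gt0 t02 pi_gt0.
have dd1 : d <= d1 by rewrite ge_min lexx.
have dt0 : d <= t0 by rewrite !ge_min lexx orbT.
have dt2 : d <= 2 * pi - t0 by rewrite !ge_min lexx !orbT.
have dpi : d <= pi by rewrite !ge_min lexx !orbT.
have m0 : 0 < 1 - cos d.
  rewrite subr_gt0 -[ltRHS](@cos0 R) ltr_cos ?in_itv/= ?lexx ?pi_ge0//.
  by rewrite ltW.
have far t : 0 <= t <= 2 * pi -> d <= `|t - t0| -> cos (t - t0) <= cos d.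
  move=> /andP[tp t2] dt.
  have t2d : `|t - t0| <= 2 * pi - d by rewrite ler_norml; apply/andP; split; lra.
  rewrite -cos_norm; move: (`|t - t0|) dt t2d => s ds s2.
  have le_cos a : d <= a <= pi -> cos a <= cos d.
    move=> /andP[da api]; move: da; rewrite le_eqVlt => /predU1P[->//|da].
    have ain : a \in `[0, pi]%R by rewrite in_itv/= api andbT; lra.
    have din : d \in `[0, pi]%R by rewrite in_itv/= dpi ltW.
    by apply/ltW; rewrite ltr_cos.
  have [spi|/ltW pis] := leP s pi; first by apply: le_cos; rewrite ds.
  have -> : cos s = cos (2 * pi - s).
    by rewrite -[RHS]cosN opprB -(cosD2pi_int s (-1)); congr cos; rewrite mulrNz mulr1z; ring.
  by apply: le_cos; apply/andP; split; lra.
have [|x1 _ h1] := @EVT_max R (fun t => `|g t - g t0|) 0 (2 * pi) (ltW pi2_gt0).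
  apply: continuous_subspaceT => x; apply: cvg_norm; apply: cvgB; first exact: cg.
  exact: cvg_cst.
exists (`|g x1 - g t0| / (1 - cos d)); first by rewrite divr_ge0// ltW.
move=> t tin; have c1 : 0 <= 1 - cos (t - t0) by rewrite subr_ge0 cos_le1.
have [td|td] := ltP `|t - t0| d.
  apply: le_trans (d1P t _) _; first by rewrite distrC (lt_le_trans td).
  by rewrite lerDl mulr_ge0// divr_ge0// ltW.
apply: ler_wpDl; first exact: ltW.
apply: le_trans (h1 t _) _; first by rewrite in_itv.
rewrite -mulrA ler_peMr// ler_pdivlMl// mulr1.
by have := far t tin td; lra.
Qed.

Section Kernel.
Variable t0 : R.
Hypothesis t0in : 0 < t0 < 2 * pi.

(** Trigonometric polynomials that concentrate at [t0] as [n] grows; multiplication by one factor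
    only shifts frequencies by 0 and 1 in either direction. *)
Let K (n : nat) t := (1 + cos (t - t0)) ^+ n.

Let K0 n t : 0 <= K n t.
Proof. by rewrite exprn_ge0//; have := cos_geN1 (t - t0); lra. Qed.

Let cosE t : ((1 + cos (t - t0))%:C : R[i]) =
  1 + (zk (-1) t0 / 2 * zk 1 t + zk 1 t0 / 2 * zk (-1) t).
Proof.
rewrite !zkE !mulr1z !mulrNz !mulN1r ?mul1r ?mulN1r !cosN !sinN cosB.
have -> : (2 : R[i]) ^-1 = (2^-1)%:C by rewrite fmorphV rmorphMn.
by apply: complex_eq; rewrite !RI/=; field.
Qed.

Let dcos : ddt (fun t => cos (t - t0)) (fun t => - sin (t - t0)).
Proof.
apply: ddt_eqr (ddt_comp ddt_cos (ddtD ddt_id (ddt_cst (- t0)))) _ => t.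
by rewrite addr0 mul1r.
Qed.

Let dK n : ddt (K n.+1) (fun t => - sin (t - t0) * (n.+1%:R * K n t)).
Proof.
apply: ddt_eqr (ddt_comp (ddtX n) (ddtD (ddt_cst 1) dcos)) _ => t.
by rewrite add0r.
Qed.

Let cK n : ccont (fun t => (K n t)%:C).
Proof.
case: n => [|n]; last exact: cddt_ccont (cddt_real (dK n)).
rewrite (_ : (fun t => _) = fun=> 1); first exact: ccont_cst.
by apply/funext => t; rewrite /K expr0.
Qed.

Let cK' n : ccont (fun t => ((1 - cos (t - t0)) * K n.+1 t)%:C).
Proof. exact: cddt_ccont (cddt_real (ddtM (ddtB (ddt_cst 1) dcos) (dK n))). Qed.

Let kernel_orth n f k : ccont f -> (forall k, fcoef k f = 0) ->
  fcoef k (fun t => (K n t)%:C * f t) = 0.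
Proof.
move=> cf f0; elim: n k => [|n IH] k.
  by rewrite -[RHS](f0 k); apply: fcoef_ext => t; rewrite /K expr0 mul1r.
have cg : ccont (fun t => (K n t)%:C * f t) by exact: ccontM.
set g := (fun t => _) in cg IH.
rewrite (@fcoef_ext _ _ _ (fun t => g t + (zk (-1) t0 / 2 * (zk 1 t * g t) +
    zk 1 t0 / 2 * (zk (-1) t * g t)))); last first.
  by move=> t; rewrite /K exprS rmorphM/= cosE -/(K n t) /g; ring.
have czg m : ccont (fun t => zk m t * g t) by apply: ccontM => //; exact: ccont_zk.
rewrite fcoefD//; last by apply: ccontD; exact: ccontZ.
rewrite fcoefD//; [|exact: ccontZ..].
by rewrite !fcoefZ// !fcoef_zkM !IH !mulr0 !addr0.
Qed.

Let J n := Re (cint (fun t => (K n t)%:C)) : R.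

Let J_gt0 n : 0 < J n.
Proof.
have [F dF] := cprimitive (cK n); rewrite /J (cintE dF) !RI.
have [d _] := dF; have p0 : 0 < pi :> R := @pi_gt0 R; have [h1 h2] := andP t0in.
pose t1 := Num.min (2 * pi) (t0 + pi / 4).
have t01 : t0 < t1 by rewrite lt_min h2 ltrDl divr_gt0.
have t12 : t1 <= 2 * pi by rewrite ge_min lexx.
have t14 : t1 <= t0 + pi / 4 by rewrite ge_min lexx orbT.
have le1 : Re (F 0) <= Re (F t0) by apply: (ddt_le d (ltW h1)) => t _; exact: K0.
have le2 : Re (F t0) < Re (F t1).
  apply: (ddt_lt d t01) => t /andP[tt0 tt1]; rewrite exprn_gt0//.
  have : 0 < cos (t - t0) by apply: cos_gt0_pihalf; apply/andP; split; lra.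
  lra.
have le3 : Re (F t1) <= Re (F (2 * pi)) by apply: (ddt_le d t12) => t _; exact: K0.
lra.
Qed.

(** The derivative of [sin (t - t0) * K n.+1 t] is [cos (t - t0) * K n.+1 t - n.+1 * (1 - cos (t -
    t0)) * K n.+1 t] and has integral 0, so the mass away from [t0] is of relative size
    [1 / n.+1]. *)
Let mass n : n.+1%:R * Re (cint (fun t => ((1 - cos (t - t0)) * K n.+1 t)%:C)) <= J n.+1.
Proof.
have ds : ddt (fun t => sin (t - t0)) (fun t => cos (t - t0)).
  apply: ddt_eqr (ddt_comp ddt_sin (ddtD ddt_id (ddt_cst (- t0)))) _ => t.
  by rewrite addr0 mul1r.
have d := ddtM ds (dK n).
have e : cint (fun t => (cos (t - t0) * K n.+1 t -
    n.+1%:R * ((1 - cos (t - t0)) * K n.+1 t))%:C) = 0.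
  have d' : cddt (fun t => (sin (t - t0) * K n.+1 t)%:C)
      (fun t => (cos (t - t0) * K n.+1 t - n.+1%:R * ((1 - cos (t - t0)) * K n.+1 t))%:C).
    apply: cddt_real; apply: ddt_eqr d _ => t; rewrite /K exprS.
    have : sin (t - t0) ^+ 2 = (1 - cos (t - t0)) * (1 + cos (t - t0)).
      by rewrite sin2cos2; ring.
    move: (n.+1%:R : R) ((1 + cos (t - t0)) ^+ n) => p q s2.
    transitivity (cos (t - t0) * ((1 + cos (t - t0)) * q) - sin (t - t0) ^+ 2 * (p * q)).
      by ring.
    by rewrite s2; ring.
  rewrite (cintE d') -rmorphB /K (_ : 2 * pi - t0 = - t0 + 2 * pi * 1%:~R).
    by rewrite sinD2pi_int cosD2pi_int sub0r subrr.
  by rewrite mulr1z mulr1 addrC.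
have cA : ccont (fun t => (cos (t - t0) * K n.+1 t)%:C).
  exact: cddt_ccont (cddt_real (ddtM dcos (dK n))).
have cB := cK' n.
have {}e : cint (fun t => (cos (t - t0) * K n.+1 t)%:C) =
    (n.+1%:R)%:C * cint (fun t => ((1 - cos (t - t0)) * K n.+1 t)%:C).
  apply/eqP; rewrite -subr_eq0 -mulNr -cintZ// -cintD//; last first.
    exact: ccontZ.
  apply/eqP; rewrite -[RHS]e; apply: cint_ext => t.
  by apply: complex_eq; rewrite !RI/=; ring.
have : Re (cint (fun t => (cos (t - t0) * K n.+1 t)%:C)) <= J n.+1.
  by apply: Re_cint_le => // t _ /=; rewrite ler_piMl ?cos_le1.
by rewrite e !RI/= mul0r subr0.
Qed.

(** Against the kernel [f] integrates to 0, while by [peak_bound] its real part lies below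
    [Re (f t0)] by at most [e / 2 + M (1 - cos (t - t0))]; for large [n] the lemma [mass] makes the
    second term contribute at most [e / 2]. *)
Let one_sided f : ccont f -> (forall k, fcoef k f = 0) -> Re (f t0) <= 0.
Proof.
move=> cf f0; apply/ler_addgt0Pr => e e0; rewrite add0r.
have e2 : 0 < e / 2 by rewrite divr_gt0.
have [M M0 hM] := peak_bound cf.1 t0in e2.
have [n nM] : exists n, M < n.+1%:R * (e / 2).
  exists (Num.truncn (M / (e / 2))); rewrite -ltr_pdivrMr//; exact: truncnS_gt.
have h0 := J_gt0 n.+1; have hm := mass n.
set m := Re _ in hm.
have cKf : ccont (fun t => (K n.+1 t)%:C * f t) by exact: ccontM.
have orth : cint (fun t => (K n.+1 t)%:C * f t) = 0.
  rewrite -[RHS](kernel_orth n.+1 0 cf f0); apply: cint_ext => t.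
  by rewrite oppr0 zk0 mulr1.
have c1 := cK' n.
have : Re (cint (fun t => (Re (f t0))%:C * (K n.+1 t)%:C + -1 * ((K n.+1 t)%:C * f t))) <=
    Re (cint (fun t => (e / 2)%:C * (K n.+1 t)%:C + M%:C * ((1 - cos (t - t0)) * K n.+1 t)%:C)).
  apply: Re_cint_le.
  - by apply: ccontD; exact: ccontZ.
  - by apply: ccontD; exact: ccontZ.
  move=> t tin; rewrite !RI/= !mul0r !subr0.
  have := hM t tin; rewrite ler_norml => /andP[hh _].
  have : 0 <= K n.+1 t * (Re (f t) - Re (f t0) + (e / 2 + M * (1 - cos (t - t0)))).
    by rewrite mulr_ge0//; move: hh; lra.
  lra.
rewrite !cintD ?cintZ//; try exact: ccontZ.
rewrite orth !RI/= !mul0r ?mulr0 !subr0 -/(J n.+1) -/m => hh.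
have m0 : 0 <= m.
  rewrite /m -[leLHS](_ : Re (cint (fun=> 0)) = 0); last by rewrite cint0.
  apply: Re_cint_le => //; first exact: ccont_cst.
  by move=> t _ /=; rewrite mulr_ge0// subr_ge0 cos_le1.
have {}hm : M * m <= e / 2 * J n.+1.
  apply: (@le_trans _ _ (n.+1%:R * (e / 2) * m)); first by rewrite ler_wpM2r// ltW.
  by rewrite mulrAC mulrC ler_pM2l.
rewrite -(ler_pM2r h0); move: hh hm; lra.
Qed.

Lemma fourier_complete f : ccont f -> (forall k, fcoef k f = 0) -> f t0 = 0.
Proof.
move=> cf f0.
have H (w : R[i]) : Re (w * f t0) <= 0.
  apply: (@one_sided (fun t => w * f t)); first exact: ccontZ.
  by move=> k; rewrite fcoefZ// f0 mulr0.
have := H 1; have := H (-1); have := H 'i; have := H (- 'i).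
by rewrite !RI/= => *; apply: complex_eq => /=; apply/eqP; rewrite eq_le; apply/andP; split; lra.
Qed.

End Kernel.

End Completeness.

(** * Bessel determinants *)

Section DdtBig.
Context {R : realType}.

Lemma ddt_bigsum (I : Type) (r : seq I) (F F' : I -> R -> R) : (forall i, ddt (F i) (F' i)) ->
  ddt (fun t => \sum_(i <- r) F i t) (fun t => \sum_(i <- r) F' i t).
Proof.
move=> dF; elim: r => [|i r IH].
  by apply: ddt_eq (ddt_cst 0) _ _ => t; rewrite big_nil.
by apply: ddt_eq (ddtD (dF i) IH) _ _ => t; rewrite big_cons.
Qed.

Lemma ddt_bigprod n (g g' : 'I_n -> R -> R) : (forall i, ddt (g i) (g' i)) ->
  ddt (fun t => \prod_i g i t)
      (fun t => \sum_i \prod_j (if j == i then g' j t else g j t)).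
Proof.
elim: n g g' => [|n IH] g g' dg.
  by apply: ddt_eq (ddt_cst 1) _ _ => t; rewrite !big_ord0.
apply: ddt_eq (ddtM (dg ord0) (IH _ _ (fun i => dg (lift ord0 i)))) _ _ => t.
  by rewrite big_ord_recl.
rewrite big_ord_recl big_ord_recl eqxx; congr (_ * _ + _).
rewrite mulr_sumr; apply: eq_bigr => i _; rewrite big_ord_recl /=; congr (_ * _).
Qed.

End DdtBig.

Section IncreasingTuples.
Variable l : nat.
Implicit Types (K : 'I_l -> int) (i j : 'I_l) (s : int).

Definition incr K := forall i j, (i < j)%N -> (K i < K j)%R.
Definition bump_at K i s : 'I_l -> int := fun j => if j == i then K j + s else K j.

Lemma incr_gap K i j : incr K -> (i <= j)%N -> K i + (j%:Z - i%:Z) <= K j.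
Proof.
move=> Kincr; case: j => [m]; elim: m i => [|m IH] [p pl] ml /=.
  by rewrite leqn0 => /eqP p0; subst p; rewrite subrr addr0 (_ : Ordinal pl = Ordinal ml)//; exact: val_inj.
rewrite leq_eqVlt => /predU1P[pm|pm].
  by subst p; rewrite subrr addr0 (_ : Ordinal pl = Ordinal ml)//; exact: val_inj.
have ml' : (m < l)%N by exact: ltn_trans ml.
have h1 := IH (Ordinal pl) ml' pm.
have h2 : K (Ordinal ml') < K (Ordinal ml) by exact: Kincr.
by move: h1 h2 => /=; lia.
Qed.

Lemma incr_id K : incr K -> (forall i, 0 <= K i < l%:Z) -> forall i, K i = i%:Z.
Proof.
move=> Kincr Kin i.
have l0 : (0 < l)%N by case: i => m; case: l.
have h1 := incr_gap (i := Ordinal l0) (j := i) Kincr (leq0n _).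
have lp : (l.-1 < l)%N by rewrite prednK.
have il : (i <= Ordinal lp)%N by rewrite /= -ltnS prednK.
have h2 := incr_gap Kincr il.
have := Kin (Ordinal l0); have := Kin (Ordinal lp).
by move: h1 h2 => /=; lia.
Qed.

(** A shift by one can at worst make an entry equal to its neighbour, and then the determinant has
    two equal rows. The increasing tuples thus form a closed system under differentiation. *)
Lemma bump_at_incr_or K i s : incr K -> s = 1 \/ s = - 1 ->
  incr (bump_at K i s) \/ exists j1 j2, j1 != j2 /\ bump_at K i s j1 = bump_at K i s j2.
Proof.
move=> Kincr s1.
have [[j1 [j2 h]]|none] := pselect (exists j1 j2, j1 != j2 /\ bump_at K i s j1 = bump_at K i s j2).
  by right; exists j1, j2.
left => j1 j2 j12.
have ne : bump_at K i s j1 <> bump_at K i s j2.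
  by move=> e; apply: none; exists j1, j2; split => //; rewrite neq_ltn j12.
have := Kincr _ _ j12; move: ne; rewrite /bump_at.
have [e1|n1] := eqVneq j1 i; have [e2|n2] := eqVneq j2 i.
- by move: j12; rewrite e1 e2 ltnn.
- by case: s1 => ->; lia.
- by case: s1 => ->; lia.
- by [].
Qed.

End IncreasingTuples.

Section BesselDeterminant.
Context {R : realType}.
Local Open Scope complex_scope.

Let q (t : R) : R[i] := zk 1 t + zk (-1) t.
Let cq : ccont q. Proof. by apply: ccontD; exact: ccont_zk. Qed.

(* [cbessel m x] is [2 pi] times the modified Bessel function [I_m (2 x)]. *)
Definition cbessel (m : int) (x : R) : R[i] :=
  cint (fun t => zk (- m) t * cexp (x%:C * (zk 1 t + zk (-1) t))).

Definition bessel m x : R := Re (cbessel m x).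

Let cE x : ccont (fun t => cexp (x%:C * q t)).
Proof. by apply: ccont_cexp; exact: ccontZ. Qed.

Lemma cddt_cbessel m : cddt (cbessel m) (fun x => cbessel (m - 1) x + cbessel (m + 1) x).
Proof.
apply: cddt_eqr (cddt_cint_cexp (ccont_zk (- m)) cq) _ => x.
rewrite -cintD; try by apply: ccontM => //; exact: ccont_zk.
apply: cint_ext => t; rewrite opprB opprD /q.
by rewrite [1 - m]addrC !zkD; ring.
Qed.

Lemma cbessel0 m : cbessel m 0 = if m == 0 then (2 * pi)%:C else 0.
Proof.
rewrite /cbessel (@cint_ext _ _ (fun t => zk 0 t * zk (- m) t)).
  by rewrite -/(fcoef m (zk 0)) fcoef_zk.
by move=> t; rewrite mul0r cexp0 mulr1 zk0 mul1r.
Qed.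

Lemma cabs_cbessel m x X : 0 <= x <= X -> cabs (cbessel m x) <= 4 * pi * expR (X * 2).
Proof.
move=> /andP[x0 xX]; apply: cabs_cint_le; first by apply: ccontM => //; exact: ccont_zk.
move=> t tin; rewrite cabsM cabs_zk mul1r.
apply: (@cabs_cexp_le _ q) => //; last by rewrite ger0_norm.
by move=> u _; apply: le_trans (cabsD _ _) _; rewrite !cabs_zk.
Qed.

(** The imaginary parts obey the same recurrence for derivatives, with zero initial values;
    [growth_pos] applies to both of their signs. *)
Lemma cbessel_real m x : 0 <= x -> cbessel m x = (bessel m x)%:C.
Proof.
move=> x0.
pose y (i : int * bool) x := (-1) ^+ i.2 * Im (cbessel i.1 x).
pose y' (i : int * bool) x := (-1) ^+ i.2 * Im (cbessel (i.1 - 1) x + cbessel (i.1 + 1) x).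
have ypos : forall i s, 0 <= s <= x -> 0 <= y i s.
  apply: (@growth_pos R _ y y' x (4 * pi * expR (x * 2)) 2) => //.
  - by move=> [k b]; apply: ddtZ; case: (cddt_cbessel k).
  - by move=> [k b]; rewrite /y/= cbessel0; case: ifP; rewrite /= mulr0.
  - by move=> [k b] s sx; apply: sign_ge; apply: le_trans (cabs_Im _) (cabs_cbessel _ sx).
  move=> [k b] s c sx c0 hc; apply: sign_ge; rewrite /= ImD.
  have hI j : `|Im (cbessel j s)| <= c.
    have := hc (j, false); have := hc (j, true).
    by rewrite /y/= expr0 expr1 mul1r mulN1r ler_norml => ? ?; apply/andP; split; lra.
  by apply: le_trans (ler_normD _ _) _; have := hI (k - 1); have := hI (k + 1); lra.
have xx : 0 <= x <= x by rewrite x0 lexx.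
have p1 := ypos (m, false) x xx; have p2 := ypos (m, true) x xx.
rewrite /y/= expr0 expr1 mul1r mulN1r in p1 p2.
by apply: complex_eq => //=; apply/eqP; rewrite eq_le; apply/andP; split; lra.
Qed.

Lemma ddt_bessel m : ddt (bessel m) (fun x => bessel (m - 1) x + bessel (m + 1) x).
Proof. by have [d _] := cddt_cbessel m; apply: ddt_eqr d _ => x; rewrite ReD. Qed.

Lemma bessel0 m : bessel m 0 = if m == 0 then 2 * pi else 0.
Proof. by rewrite /bessel cbessel0; case: ifP. Qed.

Variable l : nat.
Implicit Types K : 'I_l -> int.

Definition bessel_mx K x : 'M[R]_l := \matrix_(i, j) bessel (K i - j%:Z) x.
Definition bessel_det K x := \det (bessel_mx K x).

Lemma ddt_bessel_det K : ddt (bessel_det K) (fun x =>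
  \sum_i (bessel_det (bump_at K i (-1)) x + bessel_det (bump_at K i 1) x)).
Proof.
pose b' m x := bessel (m - 1) x + bessel (m + 1) x.
have d (s : 'S_l) : ddt (fun x => (-1) ^+ s * \prod_i bessel (K i - (s i)%:Z) x)
    (fun x => (-1) ^+ s * \sum_i \prod_j (if j == i then b' (K j - (s j)%:Z) x
      else bessel (K j - (s j)%:Z) x)).
  by apply: ddtZ; apply: ddt_bigprod => i; exact: ddt_bessel.
apply: ddt_eq (ddt_bigsum (index_enum _) d) _ _ => x.
  apply: eq_bigr => s _; congr (_ * _); apply: eq_bigr => i _.
  by rewrite mxE.
under eq_bigr do rewrite mulr_sumr.
rewrite exchange_big /=; apply: eq_bigr => i _.
rewrite /bessel_det /determinant -big_split/=; apply: eq_bigr => s _.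
rewrite -mulrDr; congr (_ * _).
rewrite [LHS](bigD1 i)//= [X in _ = X + _](bigD1 i)//= [X in _ = _ + X](bigD1 i)//= eqxx.
have rest (c : int) : \prod_(j | j != i) (bessel_mx (bump_at K i c) x) j (s j) =
    \prod_(j | j != i) bessel (K j - (s j)%:Z) x.
  by apply: eq_bigr => j /negPf ji; rewrite mxE /bump_at ji.
rewrite !rest !mxE /bump_at eqxx -mulrDl; congr (_ * _).
  by rewrite /b' (addrAC (K i) (-1)) (addrAC (K i) 1).
by apply: eq_bigr => j /negPf ->.
Qed.

Lemma bessel_det_alternate K x i j : i != j -> K i = K j -> bessel_det K x = 0.
Proof.
move=> ij e; apply: (determinant_alternate ij) => k.
by rewrite !mxE e.
Qed.

(** At 0 only the Bessel function of index 0 survives: an increasing tuple within [[0, l)] is the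
    identity and gives a scalar matrix, and any other one gives a zero row. *)
Lemma bessel_det_at0 K : incr K -> 0 <= bessel_det K 0.
Proof.
move=> Kincr; have [Kin|] := pselect (forall i, 0 <= K i < l%:Z).
  have Kid := incr_id Kincr Kin.
  rewrite /bessel_det (_ : bessel_mx K 0 = (2 * pi)%:M).
    by rewrite det_scalar exprn_ge0// ltW// pi2_gt0.
  by apply/matrixP => i j; rewrite !mxE Kid bessel0 subr_eq0 eqz_nat -[i == j]val_eqE/=; case: (_ == _).
move=> /existsNP[i /negP out].
rewrite /bessel_det (expand_det_row _ i) big1// => j _.
rewrite mxE bessel0 ifF ?mul0r//; apply: contraNF out; rewrite subr_eq0 => /eqP ->.
by have := ltn_ord j; lia.
Qed.

Lemma bessel_det_bound X : exists C, forall K x, 0 <= x <= X -> - C <= bessel_det K x.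
Proof.
pose c : R := 4 * pi * expR (X * 2).
exists (\sum_(s : 'S_l) c ^+ l) => K x xX.
have : `|bessel_det K x| <= \sum_(s : 'S_l) c ^+ l.
  apply: le_trans (ler_norm_sum _ _ _) _; apply: ler_sum => s _.
  rewrite normrMsign normr_prod.
  rewrite -[l in leRHS]card_ord -prodr_const; apply: ler_prod => i _.
  rewrite normr_ge0 mxE/=; apply: le_trans (cabs_Re _) _.
  exact: cabs_cbessel.
by rewrite ler_norml => /andP[].
Qed.

Lemma bessel_det_ge0 K x : incr K -> 0 <= x -> 0 <= bessel_det K x.
Proof.
move=> Kincr x0.
pose y (i : {K | incr K}) := bessel_det (sval i).
pose y' (i : {K | incr K}) x := \sum_j (bessel_det (bump_at (sval i) j (-1)) x +
  bessel_det (bump_at (sval i) j 1) x).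
have [C hC] := bessel_det_bound x.
have xx : 0 <= x <= x by rewrite x0 lexx.
apply: (@growth_pos R _ y y' x C (l%:R * 2) _ _ _ _ _ (exist _ K Kincr)) xx.
- by rewrite mulr_ge0.
- by move=> i; exact: ddt_bessel_det.
- by move=> [k ki]; exact: bessel_det_at0.
- by move=> i s; exact: hC.
move=> [k ki] s b sx b0 hb; rewrite /y'/=.
have term j c : c = 1 \/ c = -1 -> - b <= bessel_det (bump_at k j c) s.
  move=> c1; have [ki'|[j1 [j2 [j12 e]]]] := bump_at_incr_or j ki c1.
    exact: (hb (exist _ _ ki')).
  by rewrite (bessel_det_alternate _ j12 e) oppr_le0.
rewrite (_ : - (l%:R * 2 * b) = \sum_(j < l) (- b - b)).
  by apply: ler_sum => j _; apply: lerD; apply: term; [right|left].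
by rewrite sumr_const card_ord -mulr_natl; ring.
Qed.

(** The last [m] entries of [0, ..., l - 1] are raised by one; this interpolates between the tuple
    whose determinant is positive at 0 and the tuple [1, ..., l] that is wanted. *)
Let chain (m : nat) : 'I_l -> int := fun i => i%:Z + ((l - m <= i)%N : nat)%:Z.

Let chain_incr m : incr (chain m).
Proof. by move=> i j ij; rewrite /chain; lia. Qed.

Let bessel_det_chain m x : (m <= l)%N -> 0 < x -> 0 < bessel_det (chain m) x.
Proof.
have nonneg k s j c : incr k -> 0 <= s -> c = 1 \/ c = -1 -> 0 <= bessel_det (bump_at k j c) s.
  move=> ki s0 c1; have [ki'|[j1 [j2 [j12 e]]]] := bump_at_incr_or j ki c1.
    exact: bessel_det_ge0.
  by rewrite (bessel_det_alternate _ j12 e).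
elim: m x => [|m IH] x ml x0.
  have : bessel_det (chain 0) 0 <= bessel_det (chain 0) x.
    apply: (ddt_le (ddt_bessel_det (chain 0)) (ltW x0)) => s /andP[s0 _].
    by apply: sumr_ge0 => j _; apply: addr_ge0; apply: nonneg => //; [right|left].
  apply: lt_le_trans; rewrite /bessel_det (_ : bessel_mx (chain 0) 0 = (2 * pi)%:M).
    by rewrite det_scalar exprn_gt0// pi2_gt0.
  apply/matrixP => i j; rewrite !mxE bessel0 /chain subn0 leqNgt ltn_ord/= addr0.
  by rewrite subr_eq0 eqz_nat -[i == j]val_eqE/=; case: (_ == _).
(* The open mean value theorem gives [c > 0], where the induction hypothesis is available: lowering
   the first raised entry of [chain m.+1] produces [chain m], a positive term in a sum of
   nonnegative ones. *)
have [c /andP[c0 cx] e] := ddt_mvt_oo (ddt_bessel_det (chain m.+1)) x0.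
have h0 : 0 <= bessel_det (chain m.+1) 0 by exact: bessel_det_ge0.
suff : 0 < bessel_det (chain m.+1) x - bessel_det (chain m.+1) 0 by lra.
rewrite {}e mulr_gt0 ?subr_gt0//.
have pl : (l - m.+1 < l)%N by rewrite ltn_subrL/= (leq_trans _ ml).
rewrite (bigD1 (Ordinal pl))//=; apply: ltr_pwDl; last first.
  by apply: sumr_ge0 => j _; apply: addr_ge0; apply: nonneg; rewrite ?ltW//; [right|left].
apply: ltr_pwDl; last by apply: nonneg; rewrite ?ltW//; left.
rewrite (_ : bump_at _ _ _ = chain m); first by apply: IH => //; exact: ltnW.
apply/funext => j; rewrite /bump_at /chain -val_eqE/=.
by case: ifP; lia.
Qed.

(* The derivative in [x] moves one row index by one, so the minors with increasing rows form
   a linear system with nonnegative coefficients. *)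
Theorem bessel_det_gt0 x : 0 < x -> 0 < bessel_det (fun i => (i.+1)%:Z) x.
Proof.
move=> x0; rewrite (_ : (fun i : 'I_l => _) = chain l); first exact: bessel_det_chain.
by apply/funext => i; rewrite /chain subnn leq0n -addn1 PoszD.
Qed.

End BesselDeterminant.

(** * The linear system *)

Section LinearSystem.
Context {R : realType}.
Local Open Scope complex_scope.
Implicit Types (u v : R -> R[i]) (t : R) (k : int).
Variables a m L : R.

Definition phase t := L * t + 2 * m * sin t.
Definition dphase t := L + 2 * m * cos t.
Definition ephase t : R[i] := cexp ('i * (phase t)%:C).

(* In the variable [z = exp (i t)] this system is the linearization of the Riccati equation
   satisfied by [exp (i phi) = v / u]. *)
Definition lsol u v := cddt u (fun t => a%:C * v t) /\
  cddt v (fun t => 'i * (dphase t)%:C * v t + a%:C * u t).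

Lemma ddt_phase : ddt phase dphase.
Proof.
apply: ddt_eqr (ddtD (ddtZ L ddt_id) (ddtZ (2 * m) ddt_sin)) _ => t.
by rewrite mulr1.
Qed.

Lemma cddt_ephase : cddt ephase (fun t => 'i * (dphase t)%:C * ephase t).
Proof. exact: cddt_cexp (cddtZ 'i (cddt_real ddt_phase)). Qed.

Lemma cddt_conj_ephase : cddt (fun t => conjc (ephase t))
  (fun t => - ('i * (dphase t)%:C) * conjc (ephase t)).
Proof.
apply: cddt_eqr (cddtJ cddt_ephase) _ => t.
by rewrite !conjM conj_i conjc_real; ring.
Qed.

Lemma ephase0 : ephase 0 = 1.
Proof. by rewrite /ephase /phase sin0 !mulr0 addr0 mulr0 cexp0. Qed.

Lemma ephase_neq0 t : ephase t != 0. Proof. exact: cexp_neq0. Qed.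

Lemma conj_ephase t : conjc (ephase t) = (ephase t)^-1.
Proof.
rewrite -cexpJ -cexpN; congr cexp.
by apply: complex_eq; rewrite !RI/=; ring.
Qed.

Lemma cabs_ephase t : cabs (ephase t) = 1.
Proof. by rewrite cabs_cexp !RI/= mul0r mul1r subr0 expR0. Qed.

Lemma lsolD u1 v1 u2 v2 : lsol u1 v1 -> lsol u2 v2 ->
  lsol (fun t => u1 t + u2 t) (fun t => v1 t + v2 t).
Proof.
move=> [a1 b1] [a2 b2]; split.
  by apply: cddt_eqr (cddtD a1 a2) _ => t; rewrite mulrDr.
by apply: cddt_eqr (cddtD b1 b2) _ => t; ring.
Qed.

Lemma lsolZ c u v : lsol u v -> lsol (fun t => c * u t) (fun t => c * v t).
Proof.
move=> [a1 b1]; split.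
  by apply: cddt_eqr (cddtZ c a1) _ => t; rewrite mulrCA.
by apply: cddt_eqr (cddtZ c b1) _ => t; ring.
Qed.

Lemma lsol_hat u v : lsol u v ->
  lsol (fun t => ephase t * conjc (v t)) (fun t => ephase t * conjc (u t)).
Proof.
move=> [du dv]; split.
  apply: cddt_eqr (cddtM cddt_ephase (cddtJ dv)) _ => t.
  by rewrite conjD !conjM conj_i !conjc_real; ring.
apply: cddt_eqr (cddtM cddt_ephase (cddtJ du)) _ => t.
by rewrite conjM conjc_real; ring.
Qed.

Definition wronskian u1 v1 u2 v2 t : R[i] := u1 t * v2 t - u2 t * v1 t.

Lemma cddt_wronskian u1 v1 u2 v2 : lsol u1 v1 -> lsol u2 v2 ->
  cddt (wronskian u1 v1 u2 v2) (fun t => 'i * (dphase t)%:C * wronskian u1 v1 u2 v2 t).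
Proof.
move=> [a1 b1] [a2 b2].
by apply: cddt_eqr (cddtB (cddtM a1 b2) (cddtM a2 b1)) _ => t; rewrite /wronskian; ring.
Qed.

Lemma wronskianE u1 v1 u2 v2 t : lsol u1 v1 -> lsol u2 v2 ->
  wronskian u1 v1 u2 v2 t = ephase t * wronskian u1 v1 u2 v2 0.
Proof.
move=> s1 s2; have dW := cddt_wronskian s1 s2.
have d0 : cddt (fun t => conjc (ephase t) * wronskian u1 v1 u2 v2 t) (fun=> 0).
  by apply: cddt_eqr (cddtM cddt_conj_ephase dW) _ => s; ring.
have := cddt0_cst d0 t 0; rewrite !conj_ephase ephase0 invr1 mul1r => <-.
by rewrite mulVKf// ephase_neq0.
Qed.

Section Basis.
Variables u0 v0 u1 v1 : R -> R[i].
Hypotheses (s0 : lsol u0 v0) (s1 : lsol u1 v1).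
Let w := wronskian u0 v0 u1 v1 0.
Hypothesis w0 : w != 0.

(** Cramer's rule: all Wronskians are constant multiples of [ephase], so their quotients are
    constant. Uniqueness for the linear system follows from one independent pair of solutions. *)
Lemma lsol_span u v t : lsol u v ->
  w * u t = wronskian u v u1 v1 0 * u0 t + wronskian u0 v0 u v 0 * u1 t /\
  w * v t = wronskian u v u1 v1 0 * v0 t + wronskian u0 v0 u v 0 * v1 t.
Proof.
move=> s; have e01 := wronskianE t s0 s1; have e1 := wronskianE t s s1.
have e0 := wronskianE t s0 s; rewrite -/w in e01.
by split; apply: (mulfI (ephase_neq0 t)); rewrite mulrDr !mulrA -e01 -e1 -e0 /wronskian; ring.
Qed.

Lemma lsol0 u v : lsol u v -> u 0 = 0 -> v 0 = 0 -> forall t, u t = 0 /\ v t = 0.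
Proof.
move=> s e e' t; have [] := lsol_span t s.
rewrite {1 2 3 4}/wronskian e e' !mul0r !mulr0 subrr !mul0r addr0.
by split; apply: (mulfI w0); rewrite mulr0.
Qed.

Lemma lsol_uniq u v u' v' : lsol u v -> lsol u' v' -> u 0 = u' 0 -> v 0 = v' 0 ->
  forall t, u t = u' t /\ v t = v' t.
Proof.
move=> s s' eu ev t.
have [|| /eqP + /eqP] := lsol0 (lsolD s (lsolZ (-1) s')) _ _ t; rewrite ?mulN1r ?eu ?ev ?subrr//.
by rewrite !subr_eq0 => /eqP -> /eqP ->.
Qed.

Lemma lsol_zero u v t : lsol u v -> u t = 0 -> v t = 0 -> u 0 = 0 /\ v 0 = 0.
Proof.
move=> s e e'; have [h1 h2] := lsol_span 0 s.
have : wronskian u v u1 v1 t = 0 by rewrite /wronskian e e' mul0r mulr0 subrr.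
rewrite (wronskianE t s s1) => /eqP; rewrite mulf_eq0 (negPf (ephase_neq0 t))/= => /eqP z1.
have : wronskian u0 v0 u v t = 0 by rewrite /wronskian e e' mul0r mulr0 subrr.
rewrite (wronskianE t s0 s) => /eqP; rewrite mulf_eq0 (negPf (ephase_neq0 t))/= => /eqP z2.
rewrite z1 z2 !mul0r addr0 in h1 h2.
by split; apply: (mulfI w0); rewrite mulr0.
Qed.

End Basis.

Section Periodic.
Hypothesis a0 : a != 0.

Definition periodic_sol u v := [/\ lsol u v, u (2 * pi) = u 0 & v (2 * pi) = v 0].

Lemma periodic_solD u1 v1 u2 v2 : periodic_sol u1 v1 -> periodic_sol u2 v2 ->
  periodic_sol (fun t => u1 t + u2 t) (fun t => v1 t + v2 t).
Proof. by move=> [? e1 e2] [? e3 e4]; split; [exact: lsolD|rewrite e1 e3|rewrite e2 e4]. Qed.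

Lemma periodic_solZ c u v : periodic_sol u v -> periodic_sol (fun t => c * u t) (fun t => c * v t).
Proof. by move=> [? e1 e2]; split; [exact: lsolZ|rewrite e1|rewrite e2]. Qed.

Section Coefficients.
Variables u v : R -> R[i].
Hypothesis per : periodic_sol u v.

Let cu : ccont u. Proof. by case: per => -[/cddt_ccont]. Qed.
Let cv : ccont v. Proof. by case: per => -[_ /cddt_ccont]. Qed.

Lemma dphaseE t : (dphase t)%:C = L%:C + m%:C * (zk 1 t + zk (-1) t) :> R[i].
Proof.
rewrite !zkE /dphase !mulr1z mulrN1z mulN1r mul1r cosN sinN.
by apply: complex_eq; rewrite !RI/=; ring.
Qed.

Lemma lsol_coef_u k : 'i * (k%:~R)%:C * fcoef k u = a%:C * fcoef k v.
Proof.
have [[du _] eu _] := per.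
rewrite -fcoefZ// -(fcoef_ddt k du)//.
exact: ccontZ.
Qed.

Let v'E t : 'i * (dphase t)%:C * v t + a%:C * u t = 'i * L%:C * v t +
  ('i * m%:C * (zk 1 t * v t) + ('i * m%:C * (zk (-1) t * v t) + a%:C * u t)).
Proof. by rewrite dphaseE; ring. Qed.

Let cz k w : ccont w -> ccont (fun t => zk k t * w t).
Proof. by move=> cw; apply: ccontM => //; exact: ccont_zk. Qed.
Let cc (c : R[i]) w : ccont w -> ccont (fun t => c * w t).
Proof. by move=> cw; exact: ccontZ. Qed.

Lemma lsol_coef_v k : 'i * (k%:~R)%:C * fcoef k v = 'i * L%:C * fcoef k v +
  'i * m%:C * (fcoef (k - 1) v + fcoef (k + 1) v) + a%:C * fcoef k u.
Proof.
have [[_ dv] _ ev] := per; have {}dv := cddt_eqr dv v'E.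
rewrite -(fcoef_ddt k dv)//; last first.
  by apply: ccontD; [exact: cc|apply: ccontD; [exact/cc/cz|apply: ccontD; [exact/cc/cz|exact: cc]]].
rewrite fcoefD; [|exact: cc|apply: ccontD; [exact/cc/cz|apply: ccontD; [exact/cc/cz|exact: cc]]].
rewrite fcoefD; [|exact/cc/cz|apply: ccontD; [exact/cc/cz|exact: cc]].
rewrite fcoefD; [|exact/cc/cz|exact: cc].
rewrite (fcoefZ _ _ cv) (fcoefZ _ _ (cz 1 cv)) (fcoefZ _ _ (cz (-1) cv)) (fcoefZ _ _ cu).
by rewrite !fcoef_zkM opprK; ring.
Qed.

Lemma coef_v_decay : exists C, forall k, `|k%:~R| * cabs (fcoef k v) <= C.
Proof.
have [[_ dv] _ ev] := per; have {}dv := cddt_eqr dv v'E.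
have cdv : ccont (fun t => 'i * L%:C * v t + ('i * m%:C * (zk 1 t * v t) +
    ('i * m%:C * (zk (-1) t * v t) + a%:C * u t))).
  by apply: ccontD; [exact: cc|apply: ccontD; [exact/cc/cz|apply: ccontD; [exact/cc/cz|exact: cc]]].
have [M M0 hM] := ccont_bounded cdv.
exists (4 * pi * M) => k; have := cabs_fcoef_le k cdv hM.
rewrite (fcoef_ddt k dv)// !cabsM cabs_real.
by rewrite cabs_i mul1r.
Qed.

Let aC0 : (a%:C : R[i]) != 0. Proof. by rewrite realC_eq0. Qed.

Lemma coef_v0 : fcoef 0 v = 0.
Proof.
have := lsol_coef_u 0; rewrite mulr0 mul0r => /esym/eqP.
by rewrite mulf_eq0 (negPf aC0) => /eqP.
Qed.

Lemma coef_vE k : fcoef k u = 0 -> fcoef k v = 0.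
Proof. by move=> e; have := lsol_coef_u k; rewrite e mulr0 => /esym/eqP; rewrite mulf_eq0 (negPf aC0) => /eqP. Qed.

Lemma coef_uE k : k != 0 -> fcoef k v = 0 -> fcoef k u = 0.
Proof.
move=> k0 e; have := lsol_coef_u k; rewrite e mulr0 => /eqP.
by rewrite !mulf_eq0 (negPf iC_neq0) realC_eq0 intr_eq0 (negPf k0) => /eqP.
Qed.

(** The mean of [v] is 0 since [a v] is the derivative of a periodic function. If the next
    coefficient is 0 as well, the three-term recurrence propagates zeros upwards; the division by
    [m] is what requires [m != 0]. *)
Lemma coef_recurrence_pos : m != 0 -> fcoef 1 v = 0 ->
  forall n : nat, fcoef n v = 0 /\ (fcoef n.+1 u = 0).
Proof.
move=> m0 d1.
have H (n : nat) : fcoef n v = 0 /\ fcoef n.+1 v = 0.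
  elim: n => [|n [IH1 IH2]]; first by rewrite coef_v0.
  split=> //; have := lsol_coef_v n.+1; rewrite IH2 (coef_uE _ IH2)// !mulr0 add0r addr0.
  rewrite (_ : n.+1%:Z - 1 = n%:Z); last by lia.
  rewrite (_ : n.+1%:Z + 1 = n.+2%:Z); last by lia.
  rewrite IH1 add0r => /esym/eqP; rewrite !mulf_eq0 (negPf iC_neq0) realC_eq0 (negPf m0).
  by move=> /eqP.
by move=> n; have [h1 h2] := H n; split => //; exact: coef_uE.
Qed.

End Coefficients.

Variable n : int.
Hypothesis Ln : L = n%:~R.

Lemma ephaseE t : ephase t = zk n t * (cexp (m%:C * zk 1 t) * cexp (- m%:C * zk (-1) t)).
Proof.
rewrite -!cexpD; congr cexp; rewrite /phase Ln !zkE !mulr1z mulrN1z mulN1r mul1r cosN sinN.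
by apply: complex_eq; rewrite !RI/=; ring.
Qed.

Lemma ephase_end : ephase (2 * pi) = 1.
Proof.
rewrite /ephase /phase Ln -[2 * pi](_ : 0 + 2 * pi * 1%:~R = _); last first.
  by rewrite mulr1z mulr1 add0r.
rewrite sinD2pi_int sin0 mulr0 addr0 mulr1z mulr1 add0r -/(zk n (2 * pi)).
exact: zk_end.
Qed.

Lemma periodic_hat u v : periodic_sol u v ->
  periodic_sol (fun t => ephase t * conjc (v t)) (fun t => ephase t * conjc (u t)).
Proof.
move=> [s eu ev]; split; first exact: lsol_hat.
  by rewrite ephase_end ephase0 ev.
by rewrite ephase_end ephase0 eu.
Qed.

(** If [v] has only negative frequencies, [conjc v] has only positive ones. The factor
    [cexp (m z^-1)] cancels the antiholomorphic part of [ephase], leaving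
    [z^n * cexp (m z) * conjc v] with frequencies above [n] only. *)
Lemma hat_coef u v k : periodic_sol u v -> (forall j : nat, fcoef j v = 0) -> (k <= n)%R ->
  fcoef k (fun t => cexp (m%:C * zk (-1) t) * (ephase t * conjc (v t))) = 0.
Proof.
move=> [[_ dv] _ _] dz kn; have cv := cddt_ccont dv.
have cJ : ccont (fun t => conjc (v t)) by exact: cddt_ccont (cddtJ dv).
rewrite (@fcoef_ext _ _ _ (fun t => zk n t * (cexp (m%:C * zk 1 t) * conjc (v t)))); last first.
  move=> t; rewrite ephaseE.
  set x := cexp (m%:C * zk (-1) t); set y := cexp (m%:C * zk 1 t).
  set z := cexp (- m%:C * zk (-1) t).
  have xz : x * z = 1 by rewrite /x /z -cexpD mulNr subrr cexp0.
  transitivity (x * z * (zk n t * (y * conjc (v t)))); first by ring.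
  by rewrite xz mul1r.
rewrite fcoef_zkM fcoef_cexp_mul// => j; rewrite mul1r fcoefJ//.
have -> : - (k - n - j%:Z) = (`|n - k|%N + j)%N by lia.
by rewrite dz conjc0.
Qed.

(** Multiplied by [cexp (m z^-1)], the function [u] has no positive frequencies; being proportional
    to its image under the symmetry, it also has none up to [n >= 0]. Completeness then makes it
    zero. *)
Lemma no_antiholomorphic u v b : (0 <= n)%R -> periodic_sol u v -> b != 0 ->
  (forall t, ephase t * conjc (v t) = b * u t) ->
  (forall j : nat, fcoef j v = 0) -> (forall j : nat, fcoef j.+1 u = 0) ->
  forall t, 0 < t < 2 * pi -> u t = 0 /\ v t = 0.
Proof.
move=> n0 per b0 hb dz uz t tin.
have [[du dv] _ _] := per; have cu := cddt_ccont du.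
have cg : ccont (fun t => cexp (m%:C * zk (-1) t) * u t).
  apply: ccontM => //; apply: ccont_cexp; apply: ccontM; [exact: ccont_cst|exact: ccont_zk].
have gz k : fcoef k (fun t => cexp (m%:C * zk (-1) t) * u t) = 0.
  have [k0|k0] := leP k 0; last first.
    apply: fcoef_cexp_mul => // j.
    by rewrite (_ : k - _ = (`|k|.-1 + j).+1%:Z)//; lia.
  have := hat_coef per dz (le_trans k0 n0).
  rewrite (@fcoef_ext _ _ _ (fun t => b * (cexp (m%:C * zk (-1) t) * u t))).
    by rewrite fcoefZ// => /eqP; rewrite mulf_eq0 (negPf b0) => /eqP.
  by move=> s; rewrite hb mulrCA.
have := fourier_complete tin cg gz => /eqP.
rewrite mulf_eq0 (negPf (cexp_neq0 _))/= => /eqP u0; split => //.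
have := hb t; rewrite u0 mulr0 => /eqP; rewrite mulf_eq0 (negPf (ephase_neq0 t))/= => /eqP h.
by rewrite -[v t]conjcK h conjc0.
Qed.

End Periodic.

End LinearSystem.

(** * Frequency supports of periodic solutions *)

Section PolynomialSolutions.
Context {R : realType}.
Local Open Scope complex_scope.
Implicit Types (u v : R -> R[i]) (t : R) (k : int).
Variables a m : R.
Hypotheses (a0 : a != 0) (m0 : 0 < m).
Variable l : nat.
Notation L := (l%:Z%:~R : R).
Notation lsol := (lsol a m L).
Notation periodic_sol := (periodic_sol a m L).
Notation ephase := (ephase m L).

Let mn0 : m != 0. Proof. by rewrite gt_eqF. Qed.

Variables u0 v0 u1 v1 : R -> R[i].
Hypotheses (s0 : lsol u0 v0) (s1 : lsol u1 v1).
Let w := wronskian u0 v0 u1 v1 0.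
Hypothesis w0 : w != 0.

Definition trig_poly (f : 'I_l -> R[i]) t := \sum_j f j * zk j t.

Lemma ccont_trig_poly f : ccont (trig_poly f).
Proof. by apply: ccont_sum => j; apply: ccontM; [exact: ccont_cst|exact: ccont_zk]. Qed.

(** The [l] vanishing coefficients are a homogeneous linear system for the [l] numbers [f j], whose
    matrix has entries [bessel (i + 1 - j) m] and is invertible. *)
Lemma trig_poly_gap (f : 'I_l -> R[i]) : (forall i : 'I_l,
    fcoef i.+1 (fun t => cexp (m%:C * zk (-1) t) * (cexp (m%:C * zk 1 t) * trig_poly f t)) = 0) ->
  forall j, f j = 0.
Proof.
move=> gap.
have cE : ccont (fun t => cexp (m%:C * (zk 1 t + zk (-1) t)) : R[i]).
  by apply: ccont_cexp; apply: ccontM; [exact: ccont_cst|apply: ccontD; exact: ccont_zk].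
pose B : 'M[R[i]]_l := map_mx (real_complex R) (bessel_mx (fun i : 'I_l => (i.+1)%:Z) m).
pose F : 'cV[R[i]]_l := \col_j f j.
have BF : B *m F = 0.
  apply/matrixP => i j; rewrite !mxE -[RHS](gap i).
  rewrite (@fcoef_ext _ _ _ (fun t => \sum_j f j *
      (zk j t * cexp (m%:C * (zk 1 t + zk (-1) t))))); last first.
    move=> t; rewrite mulrA -cexpD -mulrDr [zk (-1) t + _]addrC mulr_sumr.
    by apply: eq_bigr => k _; ring.
  rewrite fcoef_sum; last first.
    by move=> k; apply: ccontM; [exact: ccont_cst|apply: ccontM => //; exact: ccont_zk].
  apply: eq_bigr => k _; rewrite fcoefZ; last by apply: ccontM => //; exact: ccont_zk.
  rewrite fcoef_zkM !mxE -cbessel_real; last exact: ltW.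
  by rewrite mulrC; congr (_ * _); apply: cint_ext => t; rewrite mulrC.
have Bu : B \in unitmx.
  rewrite unitmxE det_map_mx unitfE realC_eq0 gt_eqF//.
  exact: bessel_det_gt0.
have : F = 0 by rewrite -[F]mul1mx -(mulVmx Bu) -mulmxA BF mulmx0.
by move=> /matrixP F0 j; have := F0 j 0; rewrite !mxE.
Qed.

Lemma ccont_expM (c : R[i]) k u : ccont u -> ccont (fun t => cexp (c * zk k t) * u t).
Proof.
move=> cu; apply: ccontM => //; apply: ccont_cexp; apply: ccontM; [exact: ccont_cst|exact: ccont_zk].
Qed.

Lemma not_all_periodic f u v : periodic_sol u0 v0 -> periodic_sol u1 v1 -> lsol u v ->
  (forall t, u t = cexp (m%:C * zk 1 t) * trig_poly f t) -> forall j, f j = 0.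
Proof.
move=> p0 p1 s uf.
(* In a two-dimensional space of periodic solutions some nonzero one satisfies the single linear
   condition that starts the recurrence, and so loses all its positive frequencies. *)
have [y0 [y1 [yne yd]]] : exists y0 y1 : R[i], (y0 != 0 \/ y1 != 0) /\
    y0 * fcoef 1 v0 + y1 * fcoef 1 v1 = 0.
  have [e|e] := eqVneq (fcoef 1 v1) 0; first by exists 0, 1; rewrite e oner_eq0 mul0r mulr0 addr0; split; [right|].
  by exists (fcoef 1 v1), (- fcoef 1 v0); split; [left|ring].
pose x t := y0 * u0 t + y1 * u1 t; pose y t := y0 * v0 t + y1 * v1 t.
have pxy : periodic_sol x y by apply: periodic_solD; apply: periodic_solZ.
have cv0 : ccont v0 by case: s0 => _ /cddt_ccont.
have cv1 : ccont v1 by case: s1 => _ /cddt_ccont.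
have d1 : fcoef 1 y = 0.
  rewrite fcoefD; [|exact: ccontZ..].
  by rewrite !fcoefZ.
have rec := coef_recurrence_pos a0 pxy mn0 d1.
have dz (j : nat) : fcoef j y = 0 by have [] := rec j.
have uz (j : nat) : fcoef j.+1 x = 0 by have [] := rec j.
have pi_in : 0 < (pi : R) < 2 * pi by have := @pi_gt0 R; move: (pi) => p p0'; apply/andP; split; lra.
have sxy : lsol x y by case: pxy.
have x0y0 : ~ (x 0 = 0 /\ y 0 = 0).
  move=> [ex ey]; rewrite /x /y in ex ey.
  have : y0 * w = 0.
    by rewrite /w /wronskian; transitivity ((y0 * u0 0 + y1 * u1 0) * v1 0 - u1 0 * (y0 * v0 0 + y1 * v1 0)); [ring|rewrite ex ey; ring].
  have : y1 * w = 0.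
    by rewrite /w /wronskian; transitivity (u0 0 * (y0 * v0 0 + y1 * v1 0) - (y0 * u0 0 + y1 * u1 0) * v0 0); [ring|rewrite ex ey; ring].
  by move=> /eqP + /eqP; rewrite !mulf_eq0 (negPf w0) !orbF; case: yne => /negPf ->.
pose xh t := ephase t * conjc (y t); pose yh t := ephase t * conjc (x t).
have sh : lsol xh yh by exact: lsol_hat.
pose W := wronskian x y xh yh 0.
(* A solution proportional to its symmetric image is excluded by [no_antiholomorphic]. Otherwise the
   two span everything, and after multiplication by [cexp (m z^-1)] one has frequencies at most 0
   and the other above [l]: the gap is [1, ..., l]. *)
have [W0|W0] := eqVneq W 0.
  have x0 : x 0 != 0.
    apply/eqP => x00; apply: x0y0; split => //; move: W0; rewrite /W /wronskian /xh /yh x00.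
    rewrite mul0r sub0r ephase0 mul1r => /eqP; rewrite oppr_eq0 mulf_eq0 conjc_eq0 orbb.
    by move=> /eqP.
  have y00 : y 0 != 0.
    apply/eqP => y00; move: W0; rewrite /W /wronskian /xh /yh y00 mulr0 subr0 ephase0 mul1r.
    by move=> /eqP; rewrite mulf_eq0 conjc_eq0 orbb (negPf x0).
  pose b := xh 0 / x 0.
  have b0 : b != 0.
    by rewrite mulf_neq0 ?invr_neq0// /xh ephase0 mul1r conjc_eq0.
  have hb t : ephase t * conjc (y t) = b * x t.
    have [] := lsol_uniq s0 s1 w0 sh (lsolZ b sxy) _ _ t => //; first by rewrite divfK.
    apply: (mulfI x0); rewrite [RHS]mulrA [x 0 * b]mulrC divfK//.
    by move: W0; rewrite /W /wronskian => /eqP; rewrite subr_eq0 => /eqP.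
  have [ex ey] := no_antiholomorphic a0 (n := l) erefl isT pxy b0 hb dz uz pi_in.
  by case: x0y0; exact: (lsol_zero s0 s1 w0 sxy ex ey).
apply: trig_poly_gap => i.
have cx : ccont x by case: sxy => /cddt_ccont.
have cxh : ccont xh by case: sh => /cddt_ccont.
have kx : fcoef i.+1 (fun t => cexp (m%:C * zk (-1) t) * x t) = 0.
  by apply: fcoef_cexp_mul => // j; rewrite (_ : _ - _ = (i + j).+1%:Z)//; lia.
have kxh : fcoef i.+1 (fun t => cexp (m%:C * zk (-1) t) * xh t) = 0.
  have il : (i.+1%:Z <= l%:Z)%R by rewrite lez_nat.
  exact: (hat_coef a0 (n := l) erefl pxy dz il).
pose A1 := wronskian u v xh yh 0; pose A2 := wronskian x y u v 0.
have span t : W * u t = A1 * x t + A2 * xh t by have [] := lsol_span sxy sh t s.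
apply: (mulfI W0); rewrite mulr0 -fcoefZ; last first.
  by apply: ccont_expM; apply: ccont_expM; exact: ccont_trig_poly.
rewrite (@fcoef_ext _ _ _ (fun t => A1 * (cexp (m%:C * zk (-1) t) * x t) +
    A2 * (cexp (m%:C * zk (-1) t) * xh t))); last first.
  by move=> t; rewrite -uf mulrCA span; ring.
have cex := ccont_expM (m%:C) (-1) cx; have cexh := ccont_expM (m%:C) (-1) cxh.
rewrite fcoefD; [|exact: ccontZ..].
by rewrite !fcoefZ// kx kxh !mulr0 addr0.
Qed.

Section Shear.
Hypothesis p0 : periodic_sol u0 v0.
Variable al : R[i].
Hypothesis al0 : al != 0.
Hypothesis shear_u : u1 (2 * pi) = u1 0 + al * u0 0.
Hypothesis shear_v : v1 (2 * pi) = v1 0 + al * v0 0.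

Let c k := fcoef k u0.
Let d k := fcoef k v0.

Let c0' : R[i] := - ('i * m%:C * d 1) / a%:C.

(* Truncations of the nonnegative half of the Fourier series of [(u0, v0)]; the constant
   term [c0'] is chosen so that they solve the system up to [defect], which is O(1/N). *)
Fixpoint half_u N t : R[i] :=
  if N is N'.+1 then half_u N' t + c N * zk N t else c0'.
Fixpoint half_v N t : R[i] :=
  if N is N'.+1 then half_v N' t + d N * zk N t else 0.

Let defect N t : R[i] := 'i * m%:C * (d N.+1 * zk N t - d N * zk N.+1 t).

Let aC0 : (a%:C : R[i]) != 0. Proof. by rewrite realC_eq0. Qed.

Let half_du N : cddt (half_u N) (fun t => a%:C * half_v N t).
Proof.
elim: N => [|N IH]; first by apply: cddt_eqr (cddt_cst c0') _ => t /=; rewrite mulr0.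
apply: cddt_eqr (cddtD IH (cddtZ (c N.+1) (cddt_zk N.+1))) _ => t /=.
rewrite mulrDr; congr (_ + _); rewrite mulrA -(lsol_coef_u p0 N.+1) /c; ring.
Qed.

Let half_dv N : cddt (half_v N) (fun t => 'i * (dphase m L t)%:C * half_v N t +
  a%:C * half_u N t + defect N t).
Proof.
elim: N => [|N IH].
  apply: cddt_eqr (cddt_cst 0) _ => t /=.
  rewrite /defect (_ : d 0 = 0); last exact: (coef_v0 a0 p0).
  rewrite mulr0 add0r mul0r subr0 zk0 mulr1 /c0' mulrC divfK// addrC subrr //.
apply: cddt_eqr (cddtD IH (cddtZ (d N.+1) (cddt_zk N.+1))) _ => t /=.
have := lsol_coef_v p0 N.+1; rewrite -/(c N.+1).
rewrite (_ : N.+1%:Z - 1 = N%:Z); last by lia.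
rewrite (_ : N.+1%:Z + 1 = N.+2%:Z); last by lia.
rewrite -/(d N) -/(d N.+1) -/(d N.+2) => e.
rewrite /defect dphaseE.
have z2 : zk N.+2 t = zk 1 t * zk N.+1 t by rewrite -zkD.
have z1 : zk N t = zk (-1) t * zk N.+1 t.
  by rewrite -zkD (_ : -1 + N.+1%:Z = N%:Z)//; lia.
rewrite z2 z1.
transitivity ('i * (L%:C + m%:C * (zk 1 t + zk (-1) t)) * half_v N t + a%:C * half_u N t +
  'i * m%:C * (d N.+1 * (zk (-1) t * zk N.+1 t) - d N * zk N.+1 t) +
  'i * N.+1%:~R%:C * d N.+1 * zk N.+1 t); first by ring.
by rewrite e; ring.
Qed.

Let half_end N : half_u N (2 * pi) = half_u N 0 /\ half_v N (2 * pi) = half_v N 0.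
Proof.
elim: N => [//|N [IH1 IH2]]; rewrite /= IH1 IH2 !zk_end.
by rewrite !zk_start.
Qed.

Let Y N t := conjc (ephase t) * (half_u N t * v0 t - u0 t * half_v N t).
Let X N t := conjc (ephase t) * (half_u N t * v1 t - u1 t * half_v N t).

Let conjE t : conjc (ephase t) * ephase t = 1.
Proof. by rewrite conj_ephase mulVf// ephase_neq0. Qed.

Let d_pair N u v : lsol u v ->
  cddt (fun t => conjc (ephase t) * (half_u N t * v t - u t * half_v N t))
       (fun t => - (conjc (ephase t) * u t * defect N t)).
Proof.
move=> [du dv].
have h1 := cddtM (half_du N) dv; have h2 := cddtM du (half_dv N).
by apply: cddt_eqr (cddtM (cddt_conj_ephase m L) (cddtB h1 h2)) _ => t; ring.
Qed.

Let defect_small : exists2 K, 0 <= K & forall N t, (0 < N)%N -> N%:R * cabs (defect N t) <= K.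
Proof.
have [C hC] := coef_v_decay p0.
have C0 : 0 <= C by apply: le_trans (hC 0); rewrite mulr_ge0 ?cabs_ge0.
exists (m * (2 * C)); first by rewrite mulr_ge0 ?mulr_ge0// ltW.
move=> N t N0; rewrite /defect !cabsM cabs_real gtr0_norm//.
rewrite cabs_i mul1r mulrCA ler_pM2l//.
have n0 : 0 <= N%:R :> R by [].
apply: le_trans (ler_wpM2l n0 (cabsD _ _)) _.
rewrite -[- (d N * _)]mulN1r !cabsM !cabs_zk.
rewrite cabsN1 mulr1 mul1r mulr1 mulrDr mulr_natl mulr2n; apply: lerD; last first.
  by have := hC N; rewrite ger0_norm// ler0z.
apply: le_trans (hC N.+1); rewrite ler_wpM2r ?cabs_ge0// ger0_norm ?ler0z//.
by rewrite ler_nat.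
Qed.

(** The Wronskian-type pairings [X] and [Y] of the truncation with the two solutions vary by O(1/N)
    over the period. Since the truncation is periodic and the second solution gains [al] times the
    first, the increment of [X] is [al * Y N 0]; as [al != 0], [Y] itself is O(1/N), and Cramer's
    rule leaves only the multiple [X N 0] of [u0]. *)
Let half_close : exists K, forall N t, (0 < N)%N -> 0 <= t <= 2 * pi ->
  N%:R * cabs (w * half_u N t - X N 0 * u0 t) <= K.
Proof.
have [K K0 hK] := defect_small.
have cu0 : ccont u0 by case: s0 => /cddt_ccont.
have cu1 : ccont u1 by case: s1 => /cddt_ccont.
have [M0 M00 hM0] := ccont_bounded cu0; have [M1 M10 hM1] := ccont_bounded cu1.
pose CY := 4 * pi * (M0 * K); pose CX := 4 * pi * (M1 * K).
have CY0 : 0 <= CY by rewrite !mulr_ge0// pi_ge0.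
have absJ t : cabs (conjc (ephase t)) = 1.
  by rewrite /cabs !RI sqrrN -/(cabs (ephase t)) cabs_ephase.
have abs3 (x y z : R[i]) : cabs (- (x * y * z)) = cabs x * cabs y * cabs z.
  by rewrite -!cabsM /cabs !ReN !ImN !sqrrN.
have bd N M u v : (0 < N)%N -> 0 <= M -> lsol u v ->
    (forall t, 0 <= t <= 2 * pi -> cabs (u t) <= M) ->
    forall s t, 0 <= s <= 2 * pi -> 0 <= t <= 2 * pi ->
    N%:R * cabs (conjc (ephase t) * (half_u N t * v t - u t * half_v N t) -
      conjc (ephase s) * (half_u N s * v s - u s * half_v N s)) <= 4 * pi * (M * K).
  move=> N0 M0' suv hM s t sin tin; have NR : 0 < N%:R :> R by rewrite ltr0n.
  rewrite (_ : 4 * pi * (M * K) = N%:R * (4 * pi * (M * K / N%:R))); last first.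
    by move: (4 * pi) NR => q NR; field; rewrite gt_eqF.
  rewrite ler_pM2l//; apply: (cabs_increment (d_pair N suv) sin tin).
  move=> r rin; rewrite abs3 absJ mul1r -[leRHS]mulrA.
  apply: ler_pM; rewrite ?hM ?ler_pdivlMr//; [exact: cabs_ge0|exact: cabs_ge0|].
  by rewrite mulrC; exact: hK.
have start : 0 <= (0 : R) <= 2 * pi by rewrite lexx ltW// pi2_gt0.
have stop : 0 <= (2 * pi : R) <= 2 * pi by rewrite lexx ltW// pi2_gt0.
pose A := cabs al; have A0 : 0 < A.
  rewrite lt_neqAle cabs_ge0 andbT eq_sym; apply: contra_neq al0 => e.
  by apply: cabs0_eq0; rewrite -/A e.
have Ystart N : (0 < N)%N -> N%:R * cabs (Y N 0) <= CX / A.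
  move=> N0; rewrite ler_pdivlMr// -mulrA -cabsM.
  have := bd N M1 u1 v1 N0 M10 s1 hM1 0 (2 * pi) start stop.
  have [-> ->] := half_end N.
  rewrite (ephase_end m (n := l) erefl) shear_u shear_v ephase0.
  congr (_ * cabs _ <= _); rewrite /Y ephase0; ring.
exists (M0 * CX + M1 * (CY + CX / A)) => N t N0 tin.
have NR : 0 <= N%:R :> R by [].
have WE : w * half_u N t - X N 0 * u0 t = u0 t * (X N t - X N 0) +
    -1 * (u1 t * ((Y N t - Y N 0) + Y N 0)).
  rewrite (_ : w = conjc (ephase t) * (u0 t * v1 t - u1 t * v0 t)); last first.
    by rewrite -/(wronskian u0 v0 u1 v1 t) (wronskianE t s0 s1) mulrA conjE mul1r.
  by rewrite /X /Y; ring.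
rewrite WE; apply: le_trans (ler_wpM2l NR (cabsD _ _)) _; rewrite mulrDr.
apply: lerD.
  rewrite cabsM mulrCA; apply: ler_pM; rewrite ?mulr_ge0 ?cabs_ge0 ?hM0//.
  exact: (bd N M1 u1 v1 N0 M10 s1 hM1 0 t start tin).
rewrite !cabsM cabsN1 mul1r mulrCA; apply: ler_pM; rewrite ?mulr_ge0 ?cabs_ge0 ?hM1//.
apply: le_trans (ler_wpM2l NR (cabsD _ _)) _; rewrite mulrDr; apply: lerD; last exact: Ystart.
exact: (bd N M0 u0 v0 N0 M00 s0 hM0 0 t start tin).
Qed.

Let ccont_half N : ccont (half_u N). Proof. exact: cddt_ccont (half_du N). Qed.

Let coef_half N k : fcoef k (half_u N) =
  if (1 <= k <= N%:Z)%R then (2 * pi)%:C * c k else if k == 0 then (2 * pi)%:C * c0' else 0.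
Proof.
elim: N => [|N IH].
  rewrite (@fcoef_ext _ _ _ (fun t => c0' * zk 0 t)); last by move=> t; rewrite zk0 mulr1.
  rewrite fcoefZ ?fcoef_zk; last exact: ccont_zk.
  rewrite [RHS]ifF; last by lia.
  by case: ifP; rewrite ?mulr0// mulrC.
rewrite /= fcoefD//; last by apply: ccontM; [exact: ccont_cst|exact: ccont_zk].
rewrite fcoefZ ?fcoef_zk ?IH; last exact: ccont_zk.
have [->|kN] := eqVneq k N.+1%:Z.
  rewrite ?eqxx [X in X + _]ifF; last by lia.
  by rewrite [RHS]ifT ?add0r 1?mulrC//; lia.
rewrite mulr0 addr0; congr (if _ then _ else _); move: kN => /eqP; lia.
Qed.

(** Compare coefficients in [half_close]: a nonzero one at a negative index forces [X N 0] to tend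
    to 0, a nonzero one at a positive index forces it to tend to [2 pi w], which is not 0. *)
Lemma one_sided_coefs : (forall k, (0 < k)%R -> c k = 0) \/ (forall k, (k < 0)%R -> c k = 0).
Proof.
have [h|/existsNP[j1 /not_implyP[j10 /eqP c1]]] := pselect (forall k, (0 < k)%R -> c k = 0); first by left.
have [h|/existsNP[j2 /not_implyP[j20 /eqP c2]]] := pselect (forall k, (k < 0)%R -> c k = 0); first by right.
exfalso.
have cpos (z : R[i]) : z != 0 -> 0 < cabs z.
  move=> z0; rewrite lt_neqAle cabs_ge0 andbT eq_sym; apply: contra_neq z0 => e.
  by apply: cabs0_eq0; rewrite e.
have [K hK] := half_close.
have cu0 : ccont u0 by case: s0 => /cddt_ccont.
pose K' := 4 * pi * K.
have coefs N k : (0 < N)%N -> N%:R * cabs (w * fcoef k (half_u N) - X N 0 * c k) <= K'.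
  move=> N0; have NR : 0 < N%:R :> R by rewrite ltr0n.
  have cf : ccont (fun t => w * half_u N t + - X N 0 * u0 t).
    by apply: ccontD; exact: ccontZ.
  have := @cabs_fcoef_le _ k _ (K / N%:R) cf.
  rewrite fcoefD; [|exact: ccontZ..].
  rewrite !fcoefZ// mulNr => h.
  rewrite (_ : K' = N%:R * (4 * pi * (K / N%:R))); last first.
    by rewrite /K'; move: (4 * pi) NR => q NR; field; rewrite gt_eqF.
  rewrite ler_pM2l//; apply: h => t tin.
  by rewrite ler_pdivlMr// mulrC mulNr hK.
pose P := cabs (w * (2 * pi)%:C); have P0 : 0 < P.
  by apply: cpos; rewrite mulf_neq0// realC_eq0 gt_eqF// pi2_gt0.
pose q1 := cabs (c j1); pose q2 := cabs (c j2).
have q10 : 0 < q1 by exact: cpos.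
have q20 : 0 < q2 by exact: cpos.
(* Besides defeating the error bounds, [N] must be at least [j1], so that the truncation already
   contains that frequency. *)
have [N [N0 N1 NK]] : exists N : nat, [/\ (0 < N)%N, j1 <= N%:Z & K' * q2 + K' * q1 < N%:R * (P * q1 * q2)].
  exists (maxn `|j1|.+1 (Num.truncn ((K' * q2 + K' * q1) / (P * q1 * q2))).+1); split.
  - by rewrite leq_max.
  - by apply: le_trans (lez_abs _) _; rewrite lez_nat leq_max leqnSn.
  - rewrite -ltr_pdivrMr ?mulr_gt0//; apply: lt_le_trans (truncnS_gt _) _.
    by rewrite ler_nat leq_max leqnn orbT.
have h1 := coefs N j1 N0; have h2 := coefs N j2 N0.
have e1 : (1 <= j1 <= N%:Z)%R by rewrite N1 andbT -gtz0_ge1.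
have e2 : (1 <= j2 <= N%:Z)%R = false by rewrite -gtz0_ge1 ltNge (ltW j20).
have e3 : (j2 == 0) = false by rewrite lt_eqF.
rewrite coef_half e1 in h1; rewrite coef_half e2 e3 in h2.
rewrite mulr0 sub0r -mulN1r (cabsM (-1)) (cabsM (X N 0)) in h2.
have m1 := @cabsN1 R.
rewrite m1 mul1r -/q2 in h2.
have : P * q1 <= cabs (w * ((2 * pi)%:C * c j1) - X N 0 * c j1) + cabs (X N 0) * q1.
  rewrite /P /q1 -!cabsM; apply: le_trans (cabsD _ _).
  by rewrite le_eqVlt; apply/orP; left; apply/eqP; congr cabs; ring.
move=> h3; move: NK; apply/negP; rewrite -leNgt.
have NR : 0 <= N%:R :> R by [].
have h4 := ler_wpM2l NR (ler_wpM2r (ltW q20) h3).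
have h5 := ler_wpM2r (ltW q20) h1; have h6 := ler_wpM2r (ltW q10) h2.
by move: h4 h5 h6; lra.
Qed.

Hypothesis hat0 : forall t, ephase t * conjc (v0 t) = u0 t.

Lemma polynomial_of_shear : exists2 f : 'I_l -> R[i], (exists j, f j != 0) &
  forall t, 0 < t < 2 * pi -> u0 t = cexp (m%:C * zk 1 t) * trig_poly f t.
Proof.
have pi_in : 0 < (pi : R) < 2 * pi by have := @pi_gt0 R; move: (pi) => p p0'; apply/andP; split; lra.
have nz : ~ (u0 pi = 0 /\ v0 pi = 0).
  move=> [e1 e2]; have := wronskianE pi s0 s1; rewrite {1}/wronskian e1 e2 mul0r mulr0 subrr.
  by move=> /esym/eqP; rewrite mulf_eq0 (negPf (ephase_neq0 _ _ _)) -/w (negPf w0).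
have cu0 : ccont u0 by case: s0 => /cddt_ccont.
have cv0 : ccont v0 by case: s0 => _ /cddt_ccont.
case: one_sided_coefs => hc.
  have dz (j : nat) : d j = 0.
    case: j => [|j]; first exact: (coef_v0 a0 p0).
    by apply: (coef_vE a0 p0); apply: hc.
  case: nz; apply: (no_antiholomorphic a0 (n := l) erefl isT p0 (oner_neq0 _)) => //.
  - by move=> t; rewrite hat0 mul1r.
  - by move=> j; apply: hc.
have dz k : (k <= 0)%R -> d k = 0.
  rewrite le_eqVlt => /predU1P[->|k0]; first exact: (coef_v0 a0 p0).
  by apply: (coef_vE a0 p0); apply: hc.
(* [h] has no negative frequencies, since [u0] has none and [cexp (- m z)] adds only nonnegative
   ones. By the symmetry it equals [z^l * cexp (- m z^-1) * conjc v0], whose frequencies are below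
   [l]. *)
pose h t := cexp (- m%:C * zk 1 t) * u0 t.
have ch : ccont h by exact: ccont_expM.
have hneg k : (k < 0)%R -> fcoef k h = 0.
  by move=> k0; apply: fcoef_cexp_mul => // j; apply: hc; lia.
have cJ : ccont (fun t => conjc (v0 t)) by case: s0 => _ /cddtJ/cddt_ccont.
have hpos k : (l%:Z <= k)%R -> fcoef k h = 0.
  move=> kl; rewrite (@fcoef_ext _ _ _ (fun t => zk l t * (cexp (- m%:C * zk (-1) t) * conjc (v0 t)))).
    rewrite fcoef_zkM fcoef_cexp_mul// => j; rewrite fcoefJ// -/(d _) dz ?conjc0//; lia.
  move=> t; rewrite /h -hat0 (ephaseE _ (n := l) erefl).
  set x := cexp (- m%:C * zk 1 t); set y := cexp (m%:C * zk 1 t).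
  set z := cexp (- m%:C * zk (-1) t).
  have xy : x * y = 1 by rewrite /x /y -cexpD mulNr addrC subrr cexp0.
  transitivity (x * y * (zk l t * (z * conjc (v0 t)))); first by ring.
  by rewrite xy mul1r.
pose f (j : 'I_l) := fcoef j h / (2 * pi)%:C.
have pC : (2 * pi)%:C != 0 :> R[i] by rewrite realC_eq0 gt_eqF// pi2_gt0.
have hE t : 0 < t < 2 * pi -> h t = trig_poly f t.
  move=> tin; apply/eqP; rewrite -subr_eq0 -[_ - _](_ : h t + -1 * trig_poly f t = _); last by rewrite mulN1r.
  apply/eqP; apply: (fourier_complete (f := fun t => h t + -1 * trig_poly f t) tin).
    by apply: ccontD => //; apply: ccontM; [exact: ccont_cst|exact: ccont_trig_poly].
  move=> k; rewrite fcoefD//; last by apply: ccontM; [exact: ccont_cst|exact: ccont_trig_poly].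
  rewrite fcoefZ; last exact: ccont_trig_poly.
  rewrite fcoef_sum; last by move=> j; apply: ccontM; [exact: ccont_cst|exact: ccont_zk].
  rewrite (eq_bigr (fun j : 'I_l => f j * (if k == j%:Z then (2 * pi)%:C else 0))); last first.
    by move=> j _; rewrite fcoefZ ?fcoef_zk//; exact: ccont_zk.
  have [k0|k0] := ltP k 0.
    rewrite hneg// big1 ?mulr0 ?addr0// => j _.
    by rewrite [k == _](_ : _ = false) ?mulr0//; apply: contraTF k0 => /eqP ->; rewrite -leNgt.
  have [kl|kl] := leP l%:Z k.
    rewrite hpos// big1 ?mulr0 ?addr0// => j _.
    rewrite [k == _](_ : _ = false) ?mulr0//; apply: contraTF kl => /eqP ->.
    by rewrite -ltNge ltz_nat.
  have kE : (`|k|%N)%:Z = k by rewrite gez0_abs.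
  have kl' : (`|k| < l)%N by rewrite -ltz_nat kE.
  rewrite (bigD1 (Ordinal kl'))//= big1; last first.
    move=> j jk; rewrite [k == _](_ : _ = false) ?mulr0//; apply: contraNF jk => /eqP e.
    by apply/eqP/val_inj; rewrite /= e.
  rewrite addr0 kE eqxx /f divfK//= kE.
  by rewrite mulN1r subrr.
exists f; last first.
  move=> t tin; rewrite -hE// /h mulrA -cexpD mulNr subrr cexp0 mul1r //.
apply: contrapT => /forallNP fz.
have tz : trig_poly f pi = 0.
  by rewrite /trig_poly big1// => j _; have /negP := fz j; rewrite negbK => /eqP ->; rewrite mul0r.
have := hE pi pi_in; rewrite tz /h => /eqP; rewrite mulf_eq0 (negPf (cexp_neq0 _))/= => /eqP e.
apply: nz; split => //; have := hat0 pi; rewrite e => /eqP.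
rewrite mulf_eq0 (negPf (ephase_neq0 _ _ _))/= => /eqP hv.
by rewrite -[v0 pi]conjcK hv conjc0.
Qed.

End Shear.

End PolynomialSolutions.

(** * The Heun equation *)

Section HeunOperator.
Context {R : realType}.
Local Open Scope complex_scope.
Implicit Types (p E : {poly R[i]}) (t : R).

Lemma cddt_horner p (g g' : R -> R[i]) : cddt g g' ->
  cddt (fun t => p.[g t]) (fun t => g' t * p^`().[g t]).
Proof.
move=> dg; elim/poly_ind: p => [|p c IH].
  by apply: cddt_eq (cddt_cst 0) _ _ => t; rewrite ?deriv0 !horner0// mulr0.
apply: cddt_eq (cddtD (cddtM IH dg) (cddt_cst c)) _ _ => t; first by rewrite hornerMXaddC.
by rewrite derivD derivM derivX derivC !hornerE; ring.
Qed.

Variables a m L : R.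
Hypothesis a0 : a != 0.
Hypothesis m0 : m != 0.

Definition heun_u E t := cexp (m%:C * zk 1 t) * E.[- zk 1 t].
Definition heun_v E t :=
  'i / a%:C * (zk 1 t * (cexp (m%:C * zk 1 t) * (m%:C *: E - E^`()).[- zk 1 t])).

Let aC0 : (a%:C : R[i]) != 0. Proof. by rewrite realC_eq0. Qed.

Let dz : cddt (zk 1) (fun t : R => 'i * zk 1 t).
Proof. by apply: cddt_eqr (cddt_zk 1) _ => t; rewrite mulr1z mulr1. Qed.

Let dexp : cddt (fun t : R => cexp (m%:C * zk 1 t)) (fun t => m%:C * ('i * zk 1 t) * cexp (m%:C * zk 1 t)).
Proof. exact: cddt_cexp (cddtZ _ dz). Qed.

Lemma cddt_heun_u E : cddt (heun_u E) (fun t => a%:C * heun_v E t).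
Proof.
apply: cddt_eqr (cddtM dexp (cddt_horner E (cddtN dz))) _ => t.
by rewrite /heun_v [RHS]mulrA (mulrC a%:C) divfK// hornerD hornerN hornerZ; ring.
Qed.

(** For an arbitrary polynomial the defect in the second equation is the Heun operator up to a
    nonvanishing factor; this serves both directions of the correspondence. *)
Lemma cddt_heun_v E : cddt (heun_v E) (fun t => 'i * (dphase m L t)%:C * heun_v E t +
  a%:C * heun_u E t - cexp (m%:C * zk 1 t) * (heun L (a ^+ 2 - m ^+ 2) m E).[- zk 1 t] / a%:C).
Proof.
have := cddtZ ('i / a%:C) (cddtM dz (cddtM dexp (cddt_horner (m%:C *: E - E^`()) (cddtN dz)))).
move=> d; apply: cddt_eqr d _ => t; apply: (mulfI aC0).
rewrite /heun_v /heun_u /heun dphaseE derivB derivZ !(hornerD, hornerN, hornerM, hornerZ, hornerXn, hornerX, hornerC).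
rewrite (_ : E^`(2) = E^`()^`()); last by rewrite derivSn derivn1.
set e0 := E.[_]; set e1 := E^`().[_]; set e2 := E^`()^`().[_].
set X := cexp _.
have zz : zk 1 t * zk (-1) t = 1 :> R[i] by rewrite -zkD subrr zk0.
set z := zk 1 t in zz *; set y := zk (-1) t in zz *.
rewrite (_ : real_complex R (a ^+ 2 - m ^+ 2) = a%:C ^+ 2 - m%:C ^+ 2); last by rewrite rmorphB !rmorphXn.
rewrite (_ : real_complex R (- L + 1) = - L%:C + 1); last by rewrite rmorphD rmorphN rmorph1.
rewrite (_ : real_complex R (m * (L - 1)) = m%:C * (L%:C - 1)); last by rewrite rmorphM rmorphB rmorph1.
set aC := a%:C; set mC := m%:C; set LC := L%:C.
have ii := @iM R; set I := ('i%R : R[i]) in ii *.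
(* The intermediate forms isolate the only two relations that are not polynomial identities:
   [i^2 = -1] and [z * z^-1 = 1]. *)
transitivity (I * I * (X * (z * (mC * e0 - e1) + mC * z * z * (mC * e0 - e1) - z * z * (mC * e1 - e2)))).

  by field.
transitivity (I * I * (X * ((LC * z + mC * (z * z + z * y)) * (mC * e0 - e1))) + aC * aC * X * e0
  - X * (z * z * e2 + (- (- LC + 1) * z + mC * (1 - z * z)) * e1 + (aC ^+ 2 - mC ^+ 2 - mC * (LC - 1) * z) * e0)).
  by rewrite ii zz; ring.
by field.
Qed.

Lemma heun_lsol E : heun L (a ^+ 2 - m ^+ 2) m E = 0 -> lsol a m L (heun_u E) (heun_v E).
Proof.
move=> h; split; first exact: cddt_heun_u.
by apply: cddt_eqr (cddt_heun_v E) _ => t; rewrite h horner0 mulr0 mul0r subr0.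
Qed.

Lemma zk1_inj_inv (j k : nat) :
  zk 1 (j.+1%:R^-1 : R) = zk 1 (k.+1%:R^-1 : R) -> j = k.
Proof.
rewrite !zkE !mulr1z !mul1r => -[e _].
have mem i : (i.+1%:R^-1 : R) \in `[0, pi]%R.
  rewrite in_itv/= invr_ge0 ler0n/=; apply: le_trans (@pi_ge2 R).
  by apply: (@le_trans _ _ 1); rewrite ?invf_le1 ?ler1n.
by have /invr_inj/eqP := cos_inj (mem j) (mem k) e; rewrite eqr_nat => /eqP[].
Qed.

Lemma inv_in_period (k : nat) : 0 < (k.+1%:R^-1 : R) < 2 * pi.
Proof.
rewrite invr_gt0 ltr0n/=; apply: (@le_lt_trans _ _ 1); first by rewrite invf_le1 ?ler1n.
by have := @pi_ge2 R; lra.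
Qed.

(** The parameters [1 / (k + 1)] lie in [(0, pi)], where the cosine is injective, and provide as
    many distinct roots as wanted. *)
Lemma poly_zero_on_circle (c : R[i]) p : c != 0 ->
  (forall t, 0 < t < 2 * pi -> p.[c * zk 1 t] = 0) -> p = 0.
Proof.
move=> c0 pz; apply/eqP; apply: contraT => p0.
pose rs := mkseq (fun k : nat => c * zk 1 (k.+1%:R^-1)) (size p).
have : (size rs < size p)%N.
  apply: max_poly_roots => //.
    by apply/allP => _ /mapP[k _ ->]; apply/eqP/pz/inv_in_period.
  by apply: mkseq_uniq => j k /(mulfI c0)/zk1_inj_inv.
by rewrite size_mkseq ltnn.
Qed.

Lemma ddt_local (f f' g g' : R -> R) (b c : R) : ddt f f' -> ddt g g' ->
  (forall t, b < t < c -> f t = g t) -> forall t, b < t < c -> f' t = g' t.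
Proof.
move=> df dg fg t /andP[bt tc].
have near_fg : \near t, f t = g t.
  near=> s; apply: fg; apply/andP; split; near: s.
    exact: lt_nbhsr.
  exact: lt_nbhsl.
have [_ <-] := near_eq_is_derive near_fg (df t); by have [_ <-] := dg t.
Unshelve. all: by end_near. Qed.

Lemma cddt_local (f f' g g' : R -> R[i]) (b c : R) : cddt f f' -> cddt g g' ->
  (forall t, b < t < c -> f t = g t) -> forall t, b < t < c -> f' t = g' t.
Proof.
move=> [d1 d2] [d3 d4] fg t tin; apply: complex_eq.
  by apply: (ddt_local d1 d3) tin => s sin; rewrite fg.
by apply: (ddt_local d2 d4) tin => s sin; rewrite fg.
Qed.

Lemma lsol_heun u v E : lsol a m L u v -> (forall t, 0 < t < 2 * pi -> u t = heun_u E t) ->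
  heun L (a ^+ 2 - m ^+ 2) m E = 0.
Proof.
move=> [du dv] uE.
have vE t : 0 < t < 2 * pi -> v t = heun_v E t.
  by move=> tin; apply: (mulfI aC0); exact: (cddt_local du (cddt_heun_u E) uE tin).
apply: (@poly_zero_on_circle (-1)); first by rewrite oppr_eq0 oner_eq0.
move=> t tin; rewrite mulN1r.
have := cddt_local dv (cddt_heun_v E) vE tin; rewrite uE// vE// => /esym/eqP.
rewrite -subr_eq0 addrAC subrr add0r oppr_eq0 !mulf_eq0 invr_eq0 (negPf aC0) orbF.
by rewrite (negPf (cexp_neq0 _)) => /eqP.
Qed.

(** With [d] the degree, the coefficient of [X^(d + 1)] comes only from [- m X^2 E'] and
    [m (L - 1) X E] and equals [m (L - 1 - d)] times the leading coefficient. *)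
Lemma heun_degree lam E : E != 0 -> heun L lam m E = 0 -> L = (size E)%:Z%:~R.
Proof.
move=> E0 h; pose d := (size E).-1.
have sd : size E = d.+1 by rewrite prednK// size_poly_gt0.
have E1 k : (d < k)%N -> E`_k = 0 by move=> dk; rewrite nth_default// sd.
have lead : E`_d != 0 by rewrite -[E`_d]/(lead_coef E) lead_coef_eq0.
have := congr1 (fun p : {poly R[i]} => p`_d.+1) h; rewrite coef0 /heun.
rewrite (_ : E^`(2) = E^`()^`()); last by rewrite derivSn derivn1.
rewrite !mulrDl -!scalerAl !mulrDl !mulNr !mul1r !(coefD, coefZ, coefN).
rewrite !coefXnM !coefXM coefCM !coef_deriv.
have conclude (x : R) k : x%:C * E`_d = 0 -> x = m * (L - 1 - k%:R) -> L = k.+1%:Z%:~R.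
  move=> /eqP + xE; rewrite mulf_eq0 (negPf lead) orbF realC_eq0 xE mulf_eq0 (negPf m0)/=.
  by rewrite subr_eq0 subr_eq => /eqP ->; rewrite -[k.+1]addn1 PoszD intrD.
rewrite sd; clearbody d; case: d sd E1 lead conclude => [|d] sd E1 lead conclude.
  rewrite /= (E1 1%N)// (E1 2%N)// ?mul0rn ?mulr0 ?subr0 ?mulr0 ?add0r => e.
  by rewrite (conclude _ 0%N e) ?subr0.
rewrite /= !subSS subn0 (E1 d.+2)// (E1 d.+3)// ?mul0rn ?mulr0 ?add0r ?sub0r => e.
apply: (conclude (m * (L - 1 - d.+1%:R)) d.+1) => //; rewrite -[RHS]e.
rewrite !(rmorphM (real_complex R)) !(rmorphB (real_complex R)) (rmorph1 (real_complex R)).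
by rewrite (rmorph_nat (real_complex R)) -[_ *+ d.+1]mulr_natr; ring.
Qed.

End HeunOperator.

(** * Winding numbers *)

Section UnitCircle.
Context {R : realType}.
Local Open Scope complex_scope.
Implicit Types (x t : R) (z : R[i]).

Definition ei x : R[i] := cexp ('i * x%:C).

Lemma eiE x : ei x = cos x +i* sin x.
Proof. by rewrite /ei /cexp !RI/= mul0r mul1r sub0r oppr0 expR0 !mul1r mulr0 add0r. Qed.

Lemma eiD x y : ei (x + y) = ei x * ei y.
Proof. by rewrite /ei -cexpD -mulrDr -rmorphD. Qed.

Lemma ei_neq0 x : ei x != 0. Proof. exact: cexp_neq0. Qed.

Lemma ei0 : ei 0 = 1. Proof. by rewrite /ei mulr0 cexp0. Qed.

Lemma eiJ x : conjc (ei x) = ei (- x).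
Proof. by rewrite !eiE cosN sinN. Qed.

Lemma cabs_ei x : cabs (ei x) = 1.
Proof. by rewrite cabs_cexp !RI/= mul0r mul1r subr0 expR0. Qed.

Lemma ei_2pi x (k : int) : ei (x + 2 * pi * k%:~R) = ei x.
Proof. by rewrite !eiE cosD2pi_int sinD2pi_int. Qed.

Lemma zk_ei t : zk 1 t = ei t. Proof. by rewrite /zk /ei mul1r. Qed.

Lemma cddt_ei (g g' : R -> R) : ddt g g' ->
  cddt (fun t => ei (g t)) (fun t => 'i * (g' t)%:C * ei (g t)).
Proof. by move=> dg; exact: cddt_cexp (cddtZ 'i (cddt_real dg)). Qed.

Lemma polar_form z : z != 0 -> exists x, z = (cabs z)%:C * ei x.
Proof.
move=> z0; have c0 : 0 < cabs z.
  rewrite lt_neqAle cabs_ge0 andbT eq_sym; apply: contra_neq z0 => e.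
  by apply: cabs0_eq0; rewrite e.
have cn : cabs z != 0 by rewrite gt_eqF.
have sq : cabs z ^+ 2 = Re z ^+ 2 + Im z ^+ 2 by rewrite sqr_sqrtr// addr_ge0 ?sqr_ge0.
pose c := Re z / cabs z; pose s := Im z / cabs z.
have cs : c ^+ 2 + s ^+ 2 = 1.
  by rewrite /c /s !exprMn -mulrDl -sq -exprMn divff// expr1n.
have c1 : -1 <= c <= 1.
  by rewrite -ler_norml -(ler_sqr (y := 1)) ?nnegrE// expr1n real_normK ?num_real// -cs lerDl sqr_ge0.
have cosa : cos (acos c) = c by rewrite acosK// in_itv.
have sina : sin (acos c) ^+ 2 = s ^+ 2.
  by rewrite sin2cos2 cosa -cs addrAC subrr add0r.
have zE x : cos x = c -> sin x = s -> z = (cabs z)%:C * ei x.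
  move=> ex es; rewrite eiE ex es; apply: complex_eq; rewrite !RI/= mul0r ?subr0 ?addr0 /c /s.
    by rewrite mulrC divfK.
  by rewrite mulrC divfK.
have : sin (acos c) == s \/ sin (acos c) == - s by apply/orP; rewrite -eqf_sqr sina.
case=> /eqP e; first by exists (acos c); exact: zE.
by exists (- acos c); apply: zE; rewrite ?cosN// sinN e opprK.
Qed.

Lemma ei_eq1 x : ei x = 1 -> exists k : int, x = 2 * pi * k%:~R.
Proof.
move=> e; have [k /andP[k1 k2]] := floor_2pi x 0.
pose y := x - 2 * pi * k%:~R.
have ey : cos y = 1.
  have : ei y = 1 by rewrite /y -mulrN -mulrNz ei_2pi.
  by rewrite eiE => -[].
have y0 : 0 <= y by rewrite /y; lra.
have y2 : y < 2 * pi by rewrite /y; move: k2; rewrite intrD mulr1z; lra.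
suff : y = 0 by rewrite /y => h; exists k; lra.
have p0 := @pi_ge0 R.
have z0 : (0 : R) \in `[0, pi]%R by rewrite in_itv/= lexx p0.
have [yp|/ltW py] := leP y pi.
  by apply: (cos_inj _ z0); rewrite ?cos0// in_itv/= y0.
have : 2 * pi - y = 0.
  apply: (cos_inj _ z0); first by rewrite in_itv/=; apply/andP; split; lra.
  rewrite cos0 -[RHS]ey -[LHS]cosN opprB -[RHS](cosD2pi_int y (-1)); congr cos.
  by rewrite mulrNz mulr1z; ring.
lra.
Qed.

(** The sine of [psi t - psi 0] vanishes identically. A decrease of [psi] would, by intermediate
    values, produce a difference [- d] with [0 < d <= 1 < pi]. *)
Lemma ei_direction_cst (psi g : R -> R) z : continuous psi -> (forall t, 0 < g t) ->
  (forall t, z * (g t)%:C * ei (psi t) = 1) -> psi 0 <= psi (2 * pi).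
Proof.
move=> cpsi g0 h.
have sin0 t : sin (psi t - psi 0) = 0.
  have : ei (psi t - psi 0) = (g 0 / g t)%:C.
    have gt0 : (g t)%:C != 0 :> R[i] by rewrite realC_eq0 gt_eqF.
    have z0 : z != 0 by apply/eqP => ez; have := h 0; rewrite ez !mul0r => /eqP; rewrite eq_sym oner_eq0.
    apply: (mulfI (ei_neq0 (psi 0))); rewrite -eiD [psi 0 + _]addrC subrK.
    apply: (mulfI (mulf_neq0 z0 gt0)); rewrite h.
    rewrite (rmorphM (real_complex R)) (fmorphV (real_complex R)) -[LHS](h 0).
    by field.
  by rewrite eiE => -[].
rewrite leNgt; apply/negP => lt0.
pose d := Num.min (psi 0 - psi (2 * pi)) 1.
have d0 : 0 < d by rewrite lt_min subr_gt0 lt0 ltr01.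
have d1 : d <= 1 by rewrite ge_min lexx orbT.
have dd : d <= psi 0 - psi (2 * pi) by rewrite ge_min lexx.
have cw : {within `[0, 2 * pi], continuous psi} by exact: continuous_subspaceT.
have [|t _ et] := IVT (ltW pi2_gt0) cw (v := psi 0 - d).
  by rewrite ge_min le_max; apply/andP; split; apply/orP; [right|left]; lra.
have := sin0 t; rewrite et addrAC subrr add0r sinN => /eqP; rewrite oppr_eq0.
by rewrite gt_eqF// sin_gt0_pi// d0 (le_lt_trans d1)// (lt_le_trans _ (@pi_ge2 R))// ltr1n.
Qed.

(** The arctangent gives an argument that is a function of the value [w t], so it returns to its
    start whenever [w] does. *)
Lemma right_half_plane (w : R -> R[i]) : ccont w -> (forall t, 0 < Re (w t)) ->
  exists g psi : R -> R, [/\ continuous psi, forall t, 0 < g t,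
    forall t, w t = (g t)%:C * ei (psi t) & forall s t, w s = w t -> psi s = psi t].
Proof.
move=> [cr ci] w0; pose q t := Im (w t) / Re (w t).
have qE t : Im (w t) = q t * Re (w t) by rewrite /q divfK// gt_eqF.
pose S t := Num.sqrt (1 + q t ^+ 2).
have S0 t : 0 < S t by rewrite sqrtr_gt0 ltr_pwDl// sqr_ge0.
exists (fun t => Re (w t) * S t), (fun t => atan (q t)); split.
- move=> t; apply: continuous_comp; last exact: continuous_atan.
  apply: cvgM; first exact: ci.
  by apply: cvgV; [rewrite gt_eqF|exact: cr].
- by move=> t; rewrite mulr_gt0.
- move=> t; have ca := cos_atan (q t); rewrite -/(S t) in ca.
  have sa : sin (atan (q t)) = q t * (S t)^-1.
    have := atanK (q t); rewrite /tan ca invrK => e.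
    by apply: (mulIf (lt0r_neq0 (S0 t))); rewrite e divfK// gt_eqF.
  rewrite eiE ca sa; apply: complex_eq; rewrite !RI/= mul0r ?subr0 ?addr0.
    by rewrite mulfK// gt_eqF.
  by rewrite qE; field; rewrite gt_eqF.
- by move=> s t e; rewrite /q e.
Qed.

Lemma factor_winding z : (forall t, zk 1 t != z) -> exists c, exists g psi : R -> R,
  [/\ c != 0, continuous psi, forall t, 0 < g t,
      forall t, zk 1 t - z = c * (g t)%:C * ei (psi t) & psi 0 <= psi (2 * pi)].
Proof.
move=> zne.
have absz : cabs z != 1.
  apply/eqP => z1; have z0 : z != 0.
    by apply/eqP => ez; move: z1; rewrite ez /cabs/= expr0n/= addr0 sqrtr0 => /eqP; rewrite eq_sym oner_eq0.
  have [x e] := polar_form z0; have := zne x; rewrite zk_ei.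
  by rewrite z1 mul1r in e; rewrite -e eqxx.
have Re_lt (v : R[i]) t k : cabs v < 1 -> 0 < Re (1 - v * zk k t).
  move=> v1; rewrite !RI/=; have := cabs_Re (v * zk k t).
  by rewrite cabsM cabs_zk mulr1 !RI/= ler_norml => /andP[]; lra.
have cw v k : ccont (fun t => 1 - v * zk k t).
  have := ccontD (ccont_cst 1) (ccontM (ccont_cst (- v)) (ccont_zk k)).
  by congr ccont; apply/funext => t; rewrite mulNr.
(* For an inner root factor out [zk 1 t], which contributes one full turn; for an outer root factor
   out the constant [- z]. The remaining factor stays in the right half-plane. *)
have [lt1|gt1] : cabs z < 1 \/ 1 < cabs z by case: (ltgtP (cabs z) 1) absz; [left|right|].
  have [g [psi [cpsi g0 e per]]] := right_half_plane (cw z (-1)) (fun t => Re_lt z t (-1) lt1).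
  exists 1, g, (fun t => t + psi t); split => //.

  - by move=> t; apply: cvgD; [exact: cvg_id|exact: cpsi].
  - move=> t; rewrite mul1r eiD mulrCA -e -zk_ei mulrBr mulr1 mulrCA -zkD subrr zk0 mulr1 //.
  - rewrite (per (2 * pi) 0); last by rewrite zk_end zk_start.
    by rewrite lerD2r ltW// pi2_gt0.
have z0 : z != 0.
  by apply/eqP => ez; move: gt1; rewrite ez /cabs/= expr0n/= addr0 sqrtr0 ltr10.
have v1 : cabs z^-1 < 1.
  have : cabs z * cabs z^-1 = 1 by rewrite -cabsM divff// /cabs/= expr0n/= addr0 expr1n sqrtr1.
  move=> e; have cz : 0 < cabs z by rewrite (lt_trans _ gt1).
  by rewrite -(ltr_pM2l cz) e mulr1.
have [g [psi [cpsi g0 e per]]] := right_half_plane (cw z^-1 1) (fun t => Re_lt z^-1 t 1 v1).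
exists (- z), g, psi; split => //.
- by rewrite oppr_eq0.
- by move=> t; rewrite -mulrA -e mulrBr mulr1 mulNr opprK mulrA divff// mul1r addrC.
- by rewrite (per (2 * pi) 0)// zk_end zk_start.
Qed.

(* Winding numbers add up over the linear factors, and [z - w] winds 0 or 1 times. *)
Lemma poly_winding (p : {poly R[i]}) c (g psi : R -> R) : c != 0 -> continuous psi ->
  (forall t, 0 < g t) -> (forall t, p.[zk 1 t] = c * (g t)%:C * ei (psi t)) ->
  psi 0 <= psi (2 * pi).
Proof.
have [rs ->] := closed_field_poly_normal p; set b := lead_coef p.
elim: rs b c g psi => [|z rs IH] b c g psi c0 cpsi g0 h.
  apply: (@ei_direction_cst psi g (c / b)) => // t.
  have := h t; rewrite big_nil hornerZ hornerC mulr1 => e.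
  have b0 : b != 0.
    by rewrite e !mulf_neq0 ?ei_neq0// realC_eq0 gt_eqF.
  transitivity (c * (g t)%:C * ei (psi t) / b); first by ring.
  by rewrite -e divff.
have zne t : zk 1 t != z.
  apply/eqP => e; have := h t; rewrite big_cons hornerZ hornerM hornerXsubC e subrr mul0r mulr0.
  by move=> /esym/eqP; rewrite !mulf_eq0 (negPf c0) (negPf (ei_neq0 _)) realC_eq0 gt_eqF.
have [c' [g' [psi' [c'0 cpsi' g'0 e le']]]] := factor_winding zne.
suff : psi 0 - psi' 0 <= psi (2 * pi) - psi' (2 * pi) by lra.
apply: (IH b (c / c') (fun t => g t / g' t) (fun t => psi t - psi' t)).
- by rewrite mulf_neq0// invr_neq0.
- by move=> t; apply: cvgB; [exact: cpsi|exact: cpsi'].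
- by move=> t; rewrite divr_gt0.
move=> t; have := h t; rewrite big_cons !hornerZ hornerM hornerXsubC e.
have g't : (g' t)%:C != 0 :> R[i] by rewrite realC_eq0 gt_eqF.
have ->: psi t = (psi t - psi' t) + psi' t by rewrite subrK.
rewrite eiD addrK (rmorphM (real_complex R)) (fmorphV (real_complex R)) => hh.
apply: (mulfI (mulf_neq0 (mulf_neq0 c'0 g't) (ei_neq0 (psi' t)))).
transitivity (b * (c' * (g' t)%:C * ei (psi' t) * (\prod_(j <- rs) ('X - j%:P)).[zk 1 t])); first by ring.
by rewrite hh; field; rewrite c'0 g't.
Qed.

End UnitCircle.

(** * Monodromy and polynomial solutions *)

Section PolarSolutions.
Context {R : realType}.
Local Open Scope complex_scope.
Variable om : R.
Hypothesis om0 : 0 < om.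
Implicit Types (phi rad : R -> R) (A B t x : R).

Notation sol := (is_solution om).
Notation P := (poincare om).
Let a := (2 * om)^-1.

(** The symmetry [sol_antisym] gives [- rho B <= rho (- B)], and monotonicity gives
    [rho (- B) <= rho B]; [C] bounds the drift over the half-period by which the symmetry shifts
    time. *)
Lemma rho_ge0 B A : 0 <= B -> 0 <= rho om B A.
Proof.
move=> B0; pose phi := flow om B A 0; have s : sol B A phi := flow_sol om0 B A 0.
pose C := `|ell om B| + (om^-1 + `|2 * mu om A|).
have step t : phi (t + pi) - phi t <= pi * C.
  have tp : t <= t + pi by rewrite lerDl pi_ge0.
  have [c _ /= ->] := ddt_mvt ((sol_ddt _ _ _ _).1 s) tp.
  rewrite addrAC subrr add0r mulrC ler_pM2l ?pi_gt0//.
  have := vfield_bound om0 B A c (phi c); rewrite ler_norml => /andP[_ h].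
  by have := ler_norm (ell om B); rewrite /C; lra.
have hN : - rho om B A <= rho om (- B) A.
  apply: (rho_ge om0 (c := 4 * pi + pi * C - phi (0 + pi) + phi 0) (sol_antisym s)) => n.
  have := rho_bound om0 n s; rewrite ler_norml => /andP[_ h].
  by have := step (2 * pi * n%:R); lra.
have : rho om (- B) A <= rho om B A by apply: rho_mono => //; lra.
by move: hN; lra.
Qed.

Section Polar.
Variables (B A : R).
Notation m := (mu om A).
Notation L := (ell om B).

Definition polar_u phi rad t : R[i] := (rad t)%:C * ei ((phase m L t - phi t) / 2).
Definition polar_v phi rad t : R[i] := (rad t)%:C * ei ((phase m L t + phi t) / 2).

Lemma polar_lsol phi rad : sol B A phi -> amplitude om phi rad ->
  lsol a m L (polar_u phi rad) (polar_v phi rad).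
Proof.
move=> /sol_ddt dphi [drad _ _].
have dth := ddt_phase m L; have dC := cddt_real drad.
have du := cddtM dC (cddt_ei (ddtM (ddtB dth dphi) (ddt_cst 2^-1))).
have dv := cddtM dC (cddt_ei (ddtM (ddtD dth dphi) (ddt_cst 2^-1))).
have omn : om != 0 by rewrite gt_eqF.
have csE x : cos x +i* sin x = (cos x)%:C + 'i * (sin x)%:C :> R[i].
  by apply: complex_eq; rewrite !RI/=; ring.
split.
  apply: cddt_eqr du _ => t; rewrite /polar_v.
  have -> : (phase m L t + phi t) / 2 = (phase m L t - phi t) / 2 + phi t by field.
  rewrite eiD; set e := ei (_ / 2); rewrite eiE csE -/a.
  have -> : (dphase m L t - vfield om B A t (phi t)) / 2 + (phase m L t - phi t) * 0 = a * sin (phi t).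
    by rewrite /dphase /vfield /a; field.
  by rewrite !(rmorphM (real_complex R)); ring.
apply: cddt_eqr dv _ => t; rewrite /polar_u /polar_v.
have -> : (phase m L t - phi t) / 2 = (phase m L t + phi t) / 2 + - phi t by field.
rewrite eiD; set e := ei (_ / 2); rewrite eiE csE cosN sinN -/a.
have -> : (dphase m L t + vfield om B A t (phi t)) / 2 + (phase m L t + phi t) * 0 = dphase m L t - a * sin (phi t).
  by rewrite /dphase /vfield /a; field.
by rewrite (rmorphB (real_complex R)) (rmorphN (real_complex R)) !(rmorphM (real_complex R)); ring.
Qed.

Lemma polar_hat phi rad t :
  ephase m L t * conjc (polar_v phi rad t) = polar_u phi rad t.
Proof.
by rewrite /ephase -/(ei _) /polar_v conjM eiJ conjc_real mulrCA -eiD; congr (_ * ei _); field.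
Qed.

End Polar.
End PolarSolutions.

Section Monodromy.
Context {R : realType}.
Local Open Scope complex_scope.
Variable om : R.
Hypothesis om0 : 0 < om.
Variables B A x0 : R.
Notation P := (poincare om B A).
Let a := (2 * om)^-1.
Notation m := (mu om A).
Notation L := (ell om B).
Variables a0 a1 : R -> R.
Hypothesis amp0 : amplitude om (flow om B A x0) a0.
Hypothesis amp1 : amplitude om (flow om B A (x0 + pi)) a1.
Notation u0 := (polar_u om B A (flow om B A x0) a0).
Notation v0 := (polar_v om B A (flow om B A x0) a0).
Notation u1 := (polar_u om B A (flow om B A (x0 + pi)) a1).
Notation v1 := (polar_v om B A (flow om B A (x0 + pi)) a1).

Lemma ei_pihalf : ei (pi / 2) = 'i :> R[i].
Proof. by rewrite eiE cos_pihalf sin_pihalf. Qed.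

Lemma ei_Npihalf : ei (- (pi / 2)) = - 'i :> R[i].
Proof. by rewrite -eiJ ei_pihalf; apply: complex_eq; rewrite !RI/= ?oppr0. Qed.

Lemma phase0 m' L' : phase m' L' 0 = 0 :> R.
Proof. by rewrite /phase sin0 !mulr0 addr0. Qed.

Lemma polar_u0 : u0 0 = ei (- (x0 / 2)).
Proof.
have [_ e _] := amp0; rewrite /polar_u e flow0// phase0 rmorph1 mul1r sub0r mulNr.
by [].
Qed.

Lemma polar_v0 : v0 0 = ei (x0 / 2).
Proof. by have [_ e _] := amp0; rewrite /polar_v e flow0// phase0 rmorph1 mul1r add0r. Qed.

Lemma polar_u1 : u1 0 = - 'i * ei (- (x0 / 2)).
Proof.
have [_ e _] := amp1; rewrite /polar_u e flow0// phase0 rmorph1 mul1r sub0r.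
by rewrite mulNr mulrDl opprD eiD ei_Npihalf mulrC.
Qed.

Lemma polar_v1 : v1 0 = 'i * ei (x0 / 2).
Proof.
have [_ e _] := amp1; rewrite /polar_v e flow0// phase0 rmorph1 mul1r add0r.
by rewrite mulrDl eiD ei_pihalf mulrC.
Qed.

Lemma polar_wronskian : wronskian u0 v0 u1 v1 0 != 0.
Proof.
rewrite /wronskian polar_u0 polar_v0 polar_u1 polar_v1.
have e : ei (- (x0 / 2)) * ei (x0 / 2) = 1 :> R[i] by rewrite -eiD addNr ei0.
have -> : ei (- (x0 / 2)) * ('i * ei (x0 / 2)) - - 'i * ei (- (x0 / 2)) * ei (x0 / 2)
   = 2%:R * 'i * (ei (- (x0 / 2)) * ei (x0 / 2)) :> R[i] by ring.
by rewrite e mulr1 mulf_neq0 ?pnatr_eq0// neq0Ci.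
Qed.

Section Period.
Variables (n r k : int).
Hypothesis Ln : L = n%:~R.
Hypothesis nrk : n = r + 2 * k.
Hypothesis fixed : P x0 = x0 + 2 * pi * r%:~R.

Lemma phase_end : phase m L (2 * pi) = 2 * pi * (r%:~R + 2 * k%:~R).
Proof.
rewrite /phase Ln nrk intrD intrM.
have -> : sin (2 * pi) = 0 :> R.
  by rewrite -[2 * pi]add0r mulr_natl sinD2pi sin0.
by rewrite mulr0 addr0 mulrC.
Qed.

(** The parity condition enters here: [(theta - phi) / 2] changes by [2 pi k], a whole number of
    turns, so no sign appears. *)
Lemma polar_u0_end : u0 (2 * pi) = (a0 (2 * pi))%:C * u0 0.
Proof.
rewrite polar_u0 /polar_u phase_end -/(P x0) fixed; congr (_ * _).
rewrite -[RHS](ei_2pi _ k); congr ei; move: pi => p; by field.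
Qed.

Lemma polar_v0_end : v0 (2 * pi) = (a0 (2 * pi))%:C * v0 0.
Proof.
rewrite polar_v0 /polar_v phase_end -/(P x0) fixed; congr (_ * _).
by rewrite -[RHS](ei_2pi _ (r + k)) intrD; congr ei; move: pi => p; by field.
Qed.

Hypothesis kap1 : a0 (2 * pi) = 1.
Notation s := (shear om B A x0 r a1).

(** With [kap = 1] the image of the second basis vector has coordinates [(s, 1)] in the real
    half-angle plane. *)
Lemma shear_ei : (a1 (2 * pi))%:C * ei ((P (x0 + pi) - x0 - 2 * pi * r%:~R) / 2) = s%:C + 'i.
Proof.
have := fixed_sin1 om0 fixed amp0 amp1; rewrite kap1 mul1r => e.
rewrite eiE; apply: complex_eq; rewrite !RI/=; first by rewrite /shear; ring.
by rewrite e; ring.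
Qed.

Lemma polar_u1_end : u1 (2 * pi) = u1 0 + s%:C * u0 0.
Proof.
rewrite polar_u0 polar_u1 /polar_u phase_end -/(P (x0 + pi)).
set D := (P (x0 + pi) - x0 - 2 * pi * r%:~R) / 2.
have -> : (2 * pi * (r%:~R + 2 * k%:~R) - P (x0 + pi)) / 2 = - (x0 / 2) + - D + 2 * pi * k%:~R.
  by rewrite /D; move: (P _) => q; move: pi => p; field.
rewrite ei_2pi eiD -(eiJ D) [_ * conjc _]mulrC mulrA.
have -> : (a1 (2 * pi))%:C * conjc (ei D) = s%:C - 'i.
  have <- : conjc ((a1 (2 * pi))%:C * ei D) = (a1 (2 * pi))%:C * conjc (ei D).
    by rewrite conjM conjc_real.
  by rewrite shear_ei; apply: complex_eq; rewrite !RI/= ?oppr0; ring.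
by ring.
Qed.

Lemma polar_v1_end : v1 (2 * pi) = v1 0 + s%:C * v0 0.
Proof.
rewrite polar_v0 polar_v1 /polar_v phase_end -/(P (x0 + pi)).
set D := (P (x0 + pi) - x0 - 2 * pi * r%:~R) / 2.
have -> : (2 * pi * (r%:~R + 2 * k%:~R) + P (x0 + pi)) / 2 = (x0 / 2) + D + 2 * pi * (r + k)%:~R.
  by rewrite /D intrD; move: (P _) => q; move: pi => p; field.
by rewrite ei_2pi eiD [_ * ei D]mulrC mulrA shear_ei; ring.
Qed.

Lemma polar_sol0 : lsol a m L u0 v0.
Proof. exact: (polar_lsol om0 (flow_sol om0 B A x0) amp0). Qed.

Lemma polar_sol1 : lsol a m L u1 v1.
Proof. exact: (polar_lsol om0 (flow_sol om0 B A (x0 + pi)) amp1). Qed.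

Lemma polar_periodic : periodic_sol a m L u0 v0.
Proof.
by split; [exact: polar_sol0|rewrite polar_u0_end|rewrite polar_v0_end];
  rewrite kap1 rmorph1 mul1r.
Qed.

End Period.
End Monodromy.

(** * From a nontrivial shear to a polynomial *)

Section PolynomialOfParabolic.
Context {R : realType}.
Local Open Scope complex_scope.
Variable om : R.
Hypothesis om0 : 0 < om.
Variables B A : R.
Notation P := (poincare om B A).
Let a := (2 * om)^-1.

Lemma lambdaE : lambda om A = a ^+ 2 - mu om A ^+ 2.
Proof.
have omn : om != 0 by rewrite gt_eqF.
by rewrite /lambda /a; congr (_ - _); field.
Qed.

Lemma scale_neq0 : a != 0.
Proof. by rewrite invr_neq0// mulf_neq0 ?pnatr_eq0// gt_eqF. Qed.

Lemma mu_gt0 : 0 < A -> 0 < mu om A.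
Proof. by move=> A0; rewrite divr_gt0// mulr_gt0. Qed.

Lemma polynomial_of_parabolic (l : nat) (r k : int) :
  0 < A -> ell om B = l%:Z%:~R -> l%:Z = r + 2 * k -> rho om B A = r%:~R ->
  parabolic om B A r -> has_polynomial_solution om B A.
Proof.
move=> A0 Ll lrk rhor par.
have [x0 fixed] := (rho_eqP om0 B A r).1 rhor.
have [a0 amp0] := amplitude_exists (flow_sol om0 B A x0).
have [a1 amp1] := amplitude_exists (flow_sol om0 B A (x0 + pi)).
have kap1 : a0 (2 * pi) = 1.
  by apply: (fixed_parabolic om0 fixed amp0 amp1); case: par => -[h _]; [left|right].
have s0 : (shear om B A x0 r a1)%:C != 0.
  rewrite realC_eq0; apply/eqP => s0; have e := fixed_identity om0 fixed amp0 amp1 kap1 s0.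
  by case: par => -[_ [x]]; rewrite e ltxx.
have m0 := mu_gt0 A0.
have hat t := @polar_hat R om B A (flow om B A x0) a0 t.
have per := polar_periodic om0 amp0 Ll lrk fixed kap1.
have e_u := polar_u1_end om0 amp0 amp1 Ll lrk fixed kap1.
have e_v := polar_v1_end om0 amp0 amp1 Ll lrk fixed kap1.
have sol0 := polar_sol0 om0 amp0; have sol1 := polar_sol1 om0 amp1.
have w0 := polar_wronskian om0 amp0 amp1.
rewrite Ll in hat per sol0 sol1.
have [f [j fj] uE] := polynomial_of_shear scale_neq0 m0 sol0 sol1 w0 per s0 e_u e_v hat.
(* The signs account for evaluating [E] at [- z]. *)
pose E : {poly R[i]} := \sum_(j < l) (f j * (-1) ^+ j) *: 'X^j.
exists E.
  apply: contra_neq fj => E0; have : E`_j = 0 by rewrite E0 coef0.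
  rewrite coef_sum (bigD1 j)//= coefZ coefXn eqxx mulr1 big1 ?addr0 => [/eqP|i ij].
    by rewrite mulf_eq0 signr_eq0 orbF => /eqP.
  by rewrite coefZ coefXn eq_sym -val_eqE/= in ij *; rewrite (negbTE ij) mulr0.
rewrite lambdaE Ll; apply: (lsol_heun scale_neq0 sol0) => t tin.
rewrite uE// /heun_u; congr (_ * _).
rewrite /E horner_sum /trig_poly; apply: eq_bigr => i _.
by rewrite hornerZ hornerXn zkn -mulrA -exprMn mulN1r opprK.
Qed.

End PolynomialOfParabolic.

(** * From a polynomial to a nontrivial shear *)

Section ParabolicOfPolynomial.
Context {R : realType}.
Local Open Scope complex_scope.
Variable om : R.
Hypothesis om0 : 0 < om.
Variables B A : R.
Hypothesis A0 : 0 < A.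
Notation P := (poincare om B A).
Let a := (2 * om)^-1.
Notation m := (mu om A).
Notation L := (ell om B).

Lemma ephase_unit t : ephase m L t * conjc (ephase m L t) = 1.
Proof. by rewrite /ephase -/(ei _) eiJ -eiD subrr ei0. Qed.

(** Invariance at time 0 makes the initial vector a positive multiple of [(ei y, ei (- y))], that
    is, of the polar solution started at [x0 = - 2 y]. Periodicity then says that its modulus
    returns to 1 and its angle to itself modulo full turns, which gives the fixed point and the
    parity of its rotation number. *)
Lemma hat_invariant_polar (l : nat) U V :
  L = l%:Z%:~R -> periodic_sol a m L U V ->
  (forall t, ephase m L t * conjc (V t) = U t) -> U 0 != 0 ->
  exists x0 k a0, [/\ amplitude om (flow om B A x0) a0, a0 (2 * pi) = 1
    & P x0 = x0 + 2 * pi * (l%:Z - 2 * k)%:~R].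
Proof.
move=> Ll [sol uper vper] hat U0n.
have [y yE] := polar_form U0n; set c := (cabs (U 0))%:C in yE.
have cn : c != 0 by apply: contra_neq U0n => c0; rewrite yE c0 mul0r.
have V0 : V 0 = c * ei (- y).
  have := hat 0; rewrite ephase0 mul1r yE => /(congr1 conjc).
  by rewrite conjM eiJ conjcK conjc_real => ->.
pose x0 := - 2 * y.
have [a0 amp0] := amplitude_exists (flow_sol om0 B A x0).
have [a1 amp1] := amplitude_exists (flow_sol om0 B A (x0 + pi)).
have sol0 := polar_sol0 om0 amp0; have sol1 := polar_sol1 om0 amp1.
have w0 := polar_wronskian om0 amp0 amp1.
have x2 : x0 / 2 = - y by rewrite /x0; field.
have [||e _] := lsol_uniq sol0 sol1 w0 sol (lsolZ c sol0) _ _ (2 * pi).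
- by rewrite polar_u0// x2 opprK.
- by rewrite polar_v0// x2.
have {}e : polar_u om B A (flow om B A x0) a0 (2 * pi) = ei y.
  by apply: (mulfI cn); rewrite -e uper.
have ap : 0 < a0 (2 * pi) by have [_ _] := amp0.
have kap1 : a0 (2 * pi) = 1.
  by move: (congr1 cabs e); rewrite /polar_u cabsM !cabs_ei cabs_real mulr1 gtr0_norm.
move: e; rewrite /polar_u kap1 rmorph1 mul1r -/(P x0) => e.
have /ei_eq1[k kE] : ei ((phase m L (2 * pi) - P x0) / 2 - y) = 1 :> R[i].
  by rewrite eiD e -eiD subrr ei0.
exists x0, k, a0; split=> //.
have ph : phase m L (2 * pi) = 2 * pi * l%:Z%:~R.
  by have := @phase_end R om B A l l 0 Ll; rewrite !mulr0 !addr0; exact.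
rewrite intrB intrM; move: kE; rewrite ph.
have -> : y = - (x0 / 2) by rewrite x2 opprK.
by move: (P x0) => q; move: (pi : R) => p; lra.
Qed.

Variable E : {poly R[i]}.
Hypothesis E0 : E != 0.
Hypothesis hE : heun L (lambda om A) m E = 0.

Let l := size E.
Let Ll : L = l%:Z%:~R.
Proof. by apply: (heun_degree _ E0 hE); rewrite gt_eqF ?mu_gt0. Qed.

Lemma heun_sol_periodic : periodic_sol a m L (heun_u m E) (heun_v a m E).
Proof.
split; last 2 first.
- by rewrite /heun_u zk_end zk_start.
- by rewrite /heun_v zk_end zk_start.
by apply: (heun_lsol (scale_neq0 om0)); rewrite -(lambdaE om0).
Qed.

Lemma heun_u_neq0 m' : exists t, heun_u m' E t != 0.
Proof.
apply: contrapT => h; move: E0; suff -> : E = 0 by rewrite eqxx.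
have m1 : (-1 : R[i]) != 0 by rewrite oppr_eq0 oner_eq0.
apply: (poly_zero_on_circle m1) => t _; rewrite mulN1r.
have : heun_u m' E t = 0 by apply: contrapT => /eqP ht; apply: h; exists t.
by rewrite /heun_u => /eqP; rewrite mulf_eq0 (negbTE (cexp_neq0 _)) => /eqP.
Qed.

(** The symmetry is an antilinear involution, so a solution plus its image, and [i] times their
    difference, are invariant; both can vanish at 0 only for the zero solution. *)
Lemma heun_hat_invariant : exists U V, [/\ periodic_sol a m L U V,
  forall t, ephase m L t * conjc (V t) = U t & U 0 != 0].
Proof.
have per := heun_sol_periodic; have hper := periodic_hat Ll per.
have [t un] := heun_u_neq0 m.
move: (heun_u m E) (heun_v a m E) per hper un => u v per hper un.
have unit := ephase_unit.
have [e1|n1] := eqVneq (u 0 + conjc (v 0)) 0; last first.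
  exists (fun t => u t + ephase m L t * conjc (v t)), (fun t => v t + ephase m L t * conjc (u t)).
  split; [exact: periodic_solD|move=> s|by rewrite ephase0 mul1r].
  by rewrite conjD conjM conjcK mulrDr mulrA unit mul1r addrC.
have [e2|n2] := eqVneq (u 0 - conjc (v 0)) 0.
  have u0 : u 0 = 0.
    have : 2%:R * u 0 = 0 by rewrite -[RHS]addr0 -{1}e1 -e2; ring.
    by move/eqP; rewrite mulf_eq0 pnatr_eq0 => /eqP.
  have v0 : v 0 = 0 by move: e1; rewrite u0 add0r => e1; rewrite -[v 0]conjcK e1 conjc0.
  have [a0 amp0] := amplitude_exists (flow_sol om0 B A 0).
  have [a1 amp1] := amplitude_exists (flow_sol om0 B A (0 + pi)).
  have [sol _ _] := per.
  have [e _] := lsol0 (polar_sol0 om0 amp0) (polar_sol1 om0 amp1)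
    (polar_wronskian om0 amp0 amp1) sol u0 v0 t.
  by rewrite e eqxx in un.
exists (fun t => 'i * (u t + -1 * (ephase m L t * conjc (v t)))).
exists (fun t => 'i * (v t + -1 * (ephase m L t * conjc (u t)))).
split.
- exact/periodic_solZ/periodic_solD/periodic_solZ.
- move=> s; rewrite !(conjM, conjD) conjcK.
  rewrite conj_i.
  have -> : conjc (-1) = -1 :> R[i] by apply: complex_eq; rewrite !RI/= ?oppr0.
  transitivity ('i * ((ephase m L s * conjc (ephase m L s)) * u s - ephase m L s * conjc (v s))); first by ring.
  by rewrite unit; ring.
- by rewrite ephase0 mul1r mulN1r mulf_neq0// iC_neq0.
Qed.

End ParabolicOfPolynomial.

Section BoundaryOfPolynomial.
Context {R : realType}.
Local Open Scope complex_scope.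
Variable om : R.
Hypothesis om0 : 0 < om.
Variables B A : R.
Hypothesis A0 : 0 < A.
Notation P := (poincare om B A).
Let a := (2 * om)^-1.
Notation m := (mu om A).
Notation L := (ell om B).
Variable E : {poly R[i]}.
Hypothesis E0 : E != 0.
Hypothesis hE : heun L (lambda om A) m E = 0.

Let l := size E.
Let Ll : L = l%:Z%:~R.
Proof. by apply: (heun_degree _ E0 hE); rewrite gt_eqF ?mu_gt0. Qed.

Variables (x0 : R) (k : int) (a0 a1 : R -> R).
Hypothesis amp0 : amplitude om (flow om B A x0) a0.
Hypothesis amp1 : amplitude om (flow om B A (x0 + pi)) a1.
Hypothesis kap1 : a0 (2 * pi) = 1.
Let r := l%:Z - 2 * k.
Hypothesis fixed : P x0 = x0 + 2 * pi * r%:~R.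

Let nrk : l%:Z = r + 2 * k. Proof. by rewrite subrK. Qed.
Notation s := (shear om B A x0 r a1).
Notation u0 := (polar_u om B A (flow om B A x0) a0).
Notation v0 := (polar_v om B A (flow om B A x0) a0).
Notation u1 := (polar_u om B A (flow om B A (x0 + pi)) a1).
Notation v1 := (polar_v om B A (flow om B A (x0 + pi)) a1).

Lemma polynomial_shear_neq0 : s != 0.
Proof.
apply/eqP => s0.
have per0 := polar_periodic om0 amp0 Ll nrk fixed kap1.
have per1 : periodic_sol a m L u1
                               v1.
  split; first exact: polar_sol1.
    by rewrite (polar_u1_end om0 amp0 amp1 Ll nrk fixed kap1) s0 mul0r addr0.
  by rewrite (polar_v1_end om0 amp0 amp1 Ll nrk fixed kap1) s0 mul0r addr0.
have w0 := polar_wronskian om0 amp0 amp1.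
have [sol _ _] := heun_sol_periodic om0 hE.
have [sol0 _ _] := per0; have [sol1 _ _] := per1.
rewrite Ll in per0 per1 sol sol0 sol1.
pose f (j : 'I_l) : R[i] := E`_j * (-1) ^+ j.
have uf t : heun_u m E t = cexp (m%:C * zk 1 t) * trig_poly f t.
  rewrite /heun_u; congr (_ * _); rewrite horner_coef; apply: eq_bigr => j _.
  by rewrite zkn /f -mulrA -exprMn mulN1r.
have f0 := not_all_periodic (scale_neq0 om0) (mu_gt0 om0 A0) sol0 sol1 w0 per0 per1 sol uf.
have lgt0 : (0 < l)%N by rewrite lt0n size_poly_eq0.
have ll : (l.-1 < l)%N by rewrite prednK.
have := f0 (Ordinal ll); move/eqP; rewrite mulf_eq0 signr_eq0 orbF /=.
by rewrite -/(lead_coef E) lead_coef_eq0 (negbTE E0).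
Qed.

(** Nonzero shear makes the periodic solution built from [E] a multiple of [u0]. Cancelling
    [cexp (m z)] gives [E (- z)] the continuous argument [(L t - phi t) / 2] up to a constant, which
    increases by [pi (l - r)] over the period. *)
Lemma polynomial_rotation_le : r <= l%:Z.
Proof.
have [sol up vp] := heun_sol_periodic om0 hE.
have sol0 := polar_sol0 om0 amp0; have sol1 := polar_sol1 om0 amp1.
have w0 := polar_wronskian om0 amp0 amp1.
have [per0 p0 _] := polar_periodic om0 amp0 Ll nrk fixed kap1.
have p1 := polar_u1_end om0 amp0 amp1 Ll nrk fixed kap1.
have span t := lsol_span sol0 sol1 t sol.
set W := wronskian _ _ _ _ 0 in w0 span.
set c1 := wronskian _ _ (polar_u _ _ _ _ _) _ 0 in span.
set c2 := wronskian _ _ (heun_u _ _) _ 0 in span.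
have c20 : c2 = 0.
  have [e1 _] := span (2 * pi); have [e2 _] := span 0.
  have : c2 * (s%:C * u0 0) = 0.
    transitivity (W * heun_u m E (2 * pi) - W * heun_u m E 0); last by rewrite up subrr.
    by rewrite e1 e2 p0 p1; ring.
  rewrite polar_u0// => /eqP.
  rewrite !mulf_eq0 realC_eq0 (negbTE polynomial_shear_neq0).
  by rewrite (negbTE (ei_neq0 _)) !orbF => /eqP.
have uE t : W * heun_u m E t = c1 * u0 t.
  by have [-> _] := span t; rewrite c20 mul0r addr0.
have c10 : c1 != 0.
  have [t] := heun_u_neq0 E0 m; apply: contra_neq => c10.
  by apply: (mulfI w0); rewrite uE c10 !(mul0r, mulr0).
have dphi := (sol_ddt om B A _).1 (flow_sol om0 B A x0).
have [_ _ apos] := amp0.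
(* The factor [cexp (m z)] has modulus [expR (m * cos t)], moved into the radius, and argument
   [m * sin t], which is the sine term of half of [phase]. *)
have wind := @poly_winding R (E \Po - 'X) (c1 / W) (fun t => a0 t * expR (- (m * cos t)))
  (fun t => (L * t - flow om B A x0 t) / 2).
have /wind {}wind : c1 / W != 0 by rewrite mulf_neq0 ?invr_eq0.
have : (L * 0 - flow om B A x0 0) / 2 <= (L * (2 * pi) - flow om B A x0 (2 * pi)) / 2.
  apply: wind => [|t|t].
  - by apply: ddt_cont (ddtM (ddtB (ddtM (ddt_cst L) ddt_id) dphi) (ddt_cst 2^-1)).
  - by rewrite mulr_gt0 ?expR_gt0.
  have ce : cexp (m%:C * zk 1 t) = (expR (m * cos t))%:C * ei (m * sin t).
    by rewrite eiE zkE mul1r /cexp; apply: complex_eq; rewrite !RI/= !mul0r ?subr0 ?addr0.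
  rewrite horner_comp hornerN hornerX.
  have {uE}uE := uE t; rewrite /heun_u /polar_u ce in uE.
  have e : (phase m L t - flow om B A x0 t) / 2 = (L * t - flow om B A x0 t) / 2 + m * sin t.
    by rewrite /phase; field.
  rewrite e eiD in uE.
  have -> : (a0 t * expR (- (m * cos t)))%:C = (a0 t)%:C / (expR (m * cos t))%:C.
    by rewrite expRN (rmorphM (real_complex R)) (fmorphV (real_complex R)).
  have X0 : (expR (m * cos t))%:C != 0 by rewrite realC_eq0 gt_eqF// expR_gt0.
  have e0 := ei_neq0 (m * sin t).
  move: X0 e0 uE w0; set X := (expR _)%:C; set e1 := ei (m * sin t); set e2 := ei _.
  move: (W) (c1) X e1 e2 (E.[_]) (a0 t)%:C => w c X e1 e2 q b X0 e0 uE w0.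
  apply: (mulfI w0); apply: (mulfI X0); apply: (mulfI e0).
  transitivity (w * (X * e1 * q)); first by ring.
  by rewrite uE; field; rewrite w0 X0.
rewrite mulr0 sub0r flow0// -/(P x0) fixed Ll => h.
have : (r%:~R : R) <= l%:Z%:~R.
  have := pi_gt0 R; move: h; move: (pi : R) => p h p_gt0.
  by rewrite -(ler_pM2l p_gt0); lra.
by rewrite ler_int.
Qed.
End BoundaryOfPolynomial.

Section PolynomialSolutions.
Context {R : realType}.
Variable om : R.
Hypothesis om0 : 0 < om.
Variables B A : R.
Hypothesis B0 : 0 < B.
Hypothesis A0 : 0 < A.

Lemma parabolic_of_polynomial : has_polynomial_solution om B A ->
  exists n r : int, [/\ ell om B = n%:~R, rho om B A = r%:~R,
    (r = n %[mod 2])%Z, 0 <= r <= n & parabolic om B A r].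
Proof.
case=> E E0 hE.
have Ll : ell om B = (size E)%:Z%:~R.
  by apply: (heun_degree _ E0 hE); rewrite gt_eqF ?mu_gt0.
have [U [V [per hat U0]]] := heun_hat_invariant om0 A0 E0 hE.
have [x0 [k [a0 [amp0 kap1 fixed]]]] := hat_invariant_polar om0 Ll per hat U0.
have [a1 amp1] := amplitude_exists (flow_sol om0 B A (x0 + pi)).
have s0 := polynomial_shear_neq0 om0 A0 E0 hE amp0 amp1 kap1 fixed.
have rl := polynomial_rotation_le om0 A0 E0 hE amp0 amp1 kap1 fixed.
move: fixed s0 rl; set r := _ - 2 * k => fixed s0 rl.
have rhor : rho om B A = r%:~R by apply/(rho_eqP om0); exists x0.
exists (size E)%:Z, r; split=> //.
- by rewrite /r mulrC -mulNr addrC modzMDl.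
- by rewrite rl andbT -(ler_int R) -rhor rho_ge0// ltW.
case: (ltgtP (shear om B A x0 r a1) 0) => hs; last by rewrite hs eqxx in s0.
  by left; exact: (fixed_shear_lt0 om0 fixed amp0 amp1 kap1 hs).
by right; exact: (fixed_shear_gt0 om0 fixed amp0 amp1 kap1 hs).
Qed.

Lemma polynomial_of_boundary (n r : int) L :
  ell om B = n%:~R -> rho om B A = r%:~R -> (r = n %[mod 2])%Z ->
  phase_lock_area om L -> boundary L (B, A) -> ~ adjacency om (B, A) ->
  has_polynomial_solution om B A.
Proof.
move=> Ln rhor rn area bd nadj.
have par := boundary_parabolic om0 (lt0r_neq0 A0) rhor area bd nadj.
(* Positivity of [B] makes [n] a natural number, as needed for a polynomial with [n]
   coefficients. *)
have n0 : 0 < n by rewrite -(ltr_int R) -Ln divr_gt0.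
have /dvdzP[k kE] : (2 %| n - r)%Z by rewrite -eqz_mod_dvd rn.
move: n0 Ln kE; case: n {rn} => // l _ Ll kE.
apply: (polynomial_of_parabolic om0 (k := k) A0 Ll _ rhor par).
by rewrite mulrC -kE addrC subrK.
Qed.

End PolynomialSolutions.

Theorem theorem1p15 (R : realType) (omega : R) (omega_gt0 : 0 < omega) :
  (forall B A : R, 0 < B -> 0 < A ->
     has_polynomial_solution omega B A <->
     [/\ exists n r : int,
           [/\ ell omega B = n%:~R, rho omega B A = r%:~R,
               (r = n %[mod 2])%Z & 0 <= r <= n],
         exists2 L : set (R * R), phase_lock_area omega L & boundary L (B, A)
       & ~ adjacency omega (B, A)]) /\
  [set p : R * R | [/\ 0 < p.1, 0 < p.2
                     & has_polynomial_solution omega p.1 p.2]] =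
  [set p : R * R | [/\ 0 < p.1, 0 < p.2,
     exists r : int, [/\ phase_lock_area omega (level_set omega r%:~R),
                         boundary (level_set omega r%:~R) p
                       & parity_lines omega r p]
     & ~ adjacency omega p]].
Proof.
split=> [B A B0 A0|].
  split=> [/(parabolic_of_polynomial omega_gt0 B0 A0)|].
    move=> [n [r [Ln rhor rn rle par]]].
    have [area bd nadj] := parabolic_boundary omega_gt0 rhor par.
    by split=> //; [exists n, r | exists (level_set omega r%:~R)].
  case=> -[n [r [Ln rhor rn _]]] [L area bd] nadj.
  exact: (polynomial_of_boundary omega_gt0 B0 A0 Ln rhor rn area bd nadj).
apply/seteqP; split=> -[B A] /= [B0 A0].
  move=> /(parabolic_of_polynomial omega_gt0 B0 A0)[n [r [Ln rhor rn rle par]]].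
  have [area bd nadj] := parabolic_boundary omega_gt0 rhor par.
  by split=> //; exists r; split=> //; exists n.
case=> r [area bd [n [/= Ln rn _]]] nadj; split=> //.
have rhor : rho omega B A = r%:~R by apply: closure_level_set => //; case: bd.
exact: (polynomial_of_boundary omega_gt0 B0 A0 Ln rhor rn area bd nadj).
Qed.
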